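(* Let $u_0\in BV(\mathbb{R})$ be non-negative and let $u$ be the strong solution of the Total Variation Flow on $(0,\infty)\times\mathbb{R}$ with initial datum $u(0,\cdot)=u_0$. Let $I\subseteq\mathbb{R}$ be an open interval and assume that $u_0$ is continuous on $I$. Then for every $t>0$ the function $u(t)=u(t,\cdot)$ is continuous on the same interval $I$, and its oscillation is contractive, namely $$\operatorname*{osc}_I\big(u(t)\big)\le \operatorname*{osc}_I\big(u_0\big).$$
   Context: $BV(\mathbb{R})$ is the set of $f\in L^1_{loc}(\mathbb{R})$ whose distributional derivative $Df$ is a signed measure of finite total variation $|Df|(\mathbb{R})<\infty$. One always works with a good representative of a BV function (left and right limits exist at every point, and continuity statements refer to this representative). Strong solution of the Total Variation Flow (TVF) $\partial_t u=\partial_x(Du/|Du|)$ on $\mathbb{R}$ with initial datum $u_0$: a function $u\in L^\infty([0,\infty),BV(\mathbb{R}))\cap W^{1,2}_{loc}([0,\infty),L^2(\mathbb{R}))$ with $u(0,\cdot)=u_0$ for which there exists a measurable $z$ on $(0,\infty)\times\mathbb{R}$ with $\|z\|_\infty\le 1$, $\partial_x z\in L^2_{loc}([0,\infty),L^2(\mathbb{R}))$ (so that $z(t,\cdot)$ is taken to be continuous for a.e. $t$), such that $\partial_t u=\partial_x z$ on $(0,\infty)\times\mathbb{R}$ and, for all $\tau>0$, $\int_0^\tau\int_{\mathbb{R}} z(t,x)\,Du(t,dx)\,dt=\int_0^\tau |Du(t,\cdot)|(\mathbb{R})\,dt$. The oscillation is $\operatorname{osc}_I(f):=\sup_I f-\inf_I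 f$. *)

(* Defs.v *)
From HB Require Import structures.
From mathcomp Require Import all_boot all_order all_algebra.
From mathcomp Require Import all_classical all_reals all_analysis.

Set Implicit Arguments.
Unset Strict Implicit.
Unset Printing Implicit Defensive.

Import Order.TTheory GRing.Theory Num.Theory.
Import numFieldNormedType.Exports.

Local Open Scope classical_set_scope.
Local Open Scope ring_scope.

(** Functions of time and space are curried, [u t x] with [t] the time; only
    the values at times [0 <= t] matter. *)

Notation leb := (@lebesgue_measure _).
Notation leb2 := (@lebesgue_measure _ \x @lebesgue_measure _)%E.

(** ** Signed measures *)

Section signed_measures.
Context {R : realType}.
Implicit Type nu : {charge set (measurableTypeR R) -> \bar R}.

Definition hahn_pos nu : set R := projT1 (cid (Hahn_decomposition nu)).

Definition hahn_neg nu : set R :=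
  projT1 (cid (projT2 (cid (Hahn_decomposition nu)))).

Lemma hahn_posneg nu : hahn_decomposition nu (hahn_pos nu) (hahn_neg nu).
Proof. exact: projT2 (cid (projT2 (cid (Hahn_decomposition nu)))). Qed.

(** The library integrates against (nonnegative) measures only. *)
Definition charge_integral nu (f : R -> R) : \bar R :=
  (\int[jordan_pos (hahn_posneg nu)]_x (f x)%:E
   - \int[jordan_neg (hahn_posneg nu)]_x (f x)%:E)%E.

Definition total_variation_mass nu : \bar R :=
  charge_variation (hahn_posneg nu) setT.

End signed_measures.

(** ** BV functions on the line *)

Section bv_line.
Context {R : realType}.

(** [C_c^\infty(R)] *)
Definition test_function (phi : R -> R) : Prop :=
  (forall (n : nat) (x : R), derivable (derive1n n phi) x 1) /\
  compact (closure [set x | phi x != 0]).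

Definition distr_derivative (f : R -> R)
    (nu : {charge set (measurableTypeR R) -> \bar R}) : Prop :=
  forall phi : R -> R, test_function phi ->
    (\int[leb]_x (f x * derive1 phi x)%:E = - charge_integral nu phi)%E.

(** Charges are finite-valued, so their total variation is finite. *)
Definition bv_line (f : R -> R) : Prop :=
  locally_integrable setT f /\ exists nu, distr_derivative f nu.

(** [v] is a good representative of the class of [f] modulo null sets: it has
    one-sided limits everywhere and its value lies between them. *)
Definition good_representative (f v : R -> R) : Prop :=
  [/\ bv_line f,
      {ae leb, forall x, f x = v x} &
      forall x : R, exists l r : R,
        [/\ v @ x^'- --> l, v @ x^'+ --> r &
            Num.min l r <= v x <= Num.max l r]].

Definition osc (I : set R) (f : R -> R) : \bar R :=
  (ereal_sup [set (f x)%:E | x in I] - ereal_inf [set (f x)%:E | x in I])%E.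

End bv_line.

(** ** Distributional derivatives on [(0,\infty) x R] *)

Section space_time.
Context {R : realType}.
Implicit Types (phi u v w z : R -> R -> R).

Definition half_plane : set (R * R) := `]0, +oo[ `*` setT.

Definition partial_t phi : R -> R -> R := fun t x => derive1 (phi ^~ x) t.

Definition partial_x phi : R -> R -> R := fun t x => derive1 (phi t) x.

Definition iter_partial (s : seq bool) phi : R -> R -> R :=
  foldr (fun b psi => if b then partial_t psi else partial_x psi) phi s.

Definition smooth2 phi : Prop :=
  forall s : seq bool, let psi := iter_partial s phi in
    continuous (fun p : R * R => psi p.1 p.2) /\
    forall t x : R, derivable (psi ^~ x) t 1 /\ derivable (psi t) x 1.

(** [C_c^\infty((0,\infty) x R)] *)
Definition test_function2 phi : Prop :=
  let supp := (closure [set p : R * R | phi p.1 p.2 != 0])%classic in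
  [/\ smooth2 phi, compact supp & supp `<=` half_plane].

(** Only used for locally integrable functions, for which the real-valued
    integrals below make sense. *)
Definition weak_partial_t u v : Prop :=
  forall phi, test_function2 phi ->
    \int[leb2]_(p in half_plane) (u p.1 p.2 * partial_t phi p.1 p.2) =
    - \int[leb2]_(p in half_plane) (v p.1 p.2 * phi p.1 p.2).

Definition weak_partial_x z w : Prop :=
  forall phi, test_function2 phi ->
    \int[leb2]_(p in half_plane) (z p.1 p.2 * partial_x phi p.1 p.2) =
    - \int[leb2]_(p in half_plane) (w p.1 p.2 * phi p.1 p.2).

(** [L^2_loc([0,\infty), L^2(R))], with [L^2((0,T), L^2(R))] identified with
    [L^2((0,T) x R)] *)
Definition L2loc_L2 w : Prop :=
  measurable_fun (`[0, +oo[ `*` setT : set (R * R)) (fun p => w p.1 p.2) /\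
  forall T : R, 0 < T ->
    (\int[leb2]_(p in `[0%R, T] `*` setT) ((w p.1 p.2) ^+ 2)%:E < +oo)%E.

Definition continuous_L2 u : Prop :=
  forall t : R, 0 <= t ->
    ('N[leb]_2%:E[EFin \o (u s \- u t)%R])%E
      @[s --> within `[0, +oo[ (nbhs t)] --> 0%E.

(** An element of [W^{1,2}_loc([0,\infty), L^2(R))] is identified with its
    representative in [C([0,\infty), L^2(R))]: this is what gives a meaning to
    [u t] for every (and not merely almost every) [t >= 0]. [v] is the time
    derivative. *)
Definition W12loc_L2 u v : Prop :=
  [/\ L2loc_L2 u, L2loc_L2 v, weak_partial_t u v & continuous_L2 u].

(** [u \in L^\infty([0,\infty), BV(R))], where [Du t] is the derivative of
    [u t]. As [BV(R)] is made of [L^1_loc] functions, boundedness is that of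
    [t |-> |Du(t)|(R)]. *)
Definition Linfty_bv u
    (Du : R -> {charge set (measurableTypeR R) -> \bar R}) : Prop :=
  exists C : R, {ae leb, forall t : R, 0 < t ->
    [/\ locally_integrable setT (u t), distr_derivative (u t) (Du t) &
        (total_variation_mass (Du t) <= C%:E)%E]}.

Definition strong_solution_TVF (u0 : R -> R) u : Prop :=
  exists (Du : R -> {charge set (measurableTypeR R) -> \bar R})
         (ut z zx : R -> R -> R),
    [/\ Linfty_bv u Du,
        W12loc_L2 u ut &
        {ae leb, forall x, u 0 x = u0 x}] /\
    [/\ measurable_fun half_plane (fun p => z p.1 p.2),
        {ae leb2, forall p : R * R, half_plane p -> `|z p.1 p.2| <= 1},
        L2loc_L2 zx,
        weak_partial_x z zx &
        {ae leb, forall t : R, 0 < t -> continuous (z t)}] /\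
    {ae leb2, forall p : R * R, half_plane p -> ut p.1 p.2 = zx p.1 p.2} /\
    forall tau : R, 0 < tau ->
      (\int[leb]_(t in `]0%R, tau[) charge_integral (Du t) (z t) =
       \int[leb]_(t in `]0%R, tau[) total_variation_mass (Du t))%E.

End space_time.

(* Main.v *)
From HB Require Import structures.
Require Import Defs.
From mathcomp Require Import all_boot all_order all_algebra.
From mathcomp Require Import all_classical all_reals all_analysis.
From mathcomp Require Import measurable_realfun.
From mathcomp Require Import zify ring lra.

(** Everything follows from one local estimate: if [u 0] takes its values in
    [[lo, hi]] almost everywhere on an interval [(a, b)], then for every
    [T > 0] the essential oscillation of [u T] on the same [(a, b)] is at most
    [hi - lo] (lemma [oscillation_contraction]). Continuity of [u t] at a point
    of [I] comes from applying it to small intervals around the point, on which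
    the oscillation of [v0] is small; the contraction of [osc I] comes from
    applying it to intervals [(a, b)] included in [I] that contain two given
    points.

    The estimate is proved on a semi-discrete scheme. Cut [(a, b)] into cells
    of size [h] with left ends [x_i]. Let [U_i] be the mean of [u t] against a
    smooth window attached to [x_i], which is the mollifier convolved with the
    indicator of a cell, and let [z_i] be the mean of the flux [z t] against
    the mollifier attached to [x_i]. Differentiating the window gives the
    difference of two mollifiers, hence the equation of the flow becomes
    [U_i' = (z_(i+1) - z_i) / h] (lemma [ugrid_time]), an identity for every
    time thanks to the continuity of [t |-> u t] in [L^2].

    On this scheme the relation [z Du = |Du|] survives in the limit only, but
    with a quantitative error. The jump [U_i - U_(i-1)] is the integral
    against [Du] of a hat function, and the hats form a partition of unity.
    By duality the sum of the [|U_i - U_(i-1)|] is at most [|Du|(R)], and by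
    dominated convergence the sum of the [z_i (U_i - U_(i-1))] tends to the
    integral of [z] against [Du]. The difference of these two sums, the gap,
    is a sum of nonnegative terms, and the energy identity makes its time
    integral tend to [0] with [h] (lemmas [energy_gap] and [gap_small]).

    Put [delta := hi - lo] and follow the sum over the cells [i], [j] of
    [(a, b)] of [((U_i - U_j - delta)^+)^2], which vanishes at time [0]. For a
    fixed [j], the sequence [g_i := (U_i - U_j - delta)^+] vanishes at [i = j],
    so that its variation is at least the sum of its two boundary values.
    Summation by parts against [z_(i+1) - z_i] produces at most these boundary
    values, minus the variation of [g] if [z_i] is the sign of the jumps of
    [U]: the sum would be nonpositive, whatever the flux does at [a] and at
    [b], and this is why the estimate is local. In general the sum is at most
    the defect of [z_i] from being this sign, and the defect is at most
    the gap (lemmas [abel_sum_le_defect], [excess_rate], [defect_le_gap]).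
    After multiplication by [h^2] the double sum at time [T] is at most
    [4 (b - a)] times the time integral of the gap. If [u T] were above
    [alpha] on a subinterval and below [beta] on another one, with
    [alpha - beta > delta], it would also stay above a positive constant.

    That [u t] has a good representative for every [t > 0] and not only for
    almost every one rests on the same continuity in time: the variation of
    the mollified functions is at most the essential bound of [|Du t|(R)] for
    almost every [t], hence for every [t], hence [u t] has bounded variation
    along its Lebesgue points. It is then almost everywhere a difference of two
    bounded nondecreasing right-continuous functions, whose Stieltjes measures
    give its derivative. *)

Set Implicit Arguments.
Unset Strict Implicit.
Unset Printing Implicit Defensive.

Import Order.TTheory GRing.Theory Num.Theory.
Import numFieldNormedType.Exports HBNNSimple.

Local Open Scope classical_set_scope.
Local Open Scope ring_scope.

(** * Smooth functions and cut-off profiles *)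

Section smooth.
Context {R : realType}.
Implicit Types f g : R -> R.

Definition smooth f := forall (n : nat) (x : R), derivable (derive1n n f) x 1.

(** The step lets the shape of the derivative change inside the class [P]: sums,
    products and rescalings are handled without a formula for the [n]-th
    derivative. *)
Lemma smooth_coind (P : (R -> R) -> Prop) f :
  (forall g, P g -> (forall x, derivable g x 1) /\ P (derive1 g)) ->
  P f -> smooth f.
Proof.
move=> Pstep Pf n x; apply: (Pstep _ _).1 => {x}.
by elim: n => [//|n IHn]; rewrite derive1nS; apply: (Pstep _ _).2.
Qed.

Lemma smooth_derivable f x : smooth f -> derivable f x 1.
Proof. by move=> /(_ 0%N x). Qed.

Lemma smooth_derive1 f : smooth f -> smooth (derive1 f).
Proof.
move=> sf n x.
by have := sf n.+1 x; rewrite /derive1n iterSr.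
Qed.

Lemma smooth_continuous f : smooth f -> continuous f.
Proof.
by move=> sf x; apply/differentiable_continuous/derivable1_diffP/smooth_derivable.
Qed.

Lemma is_derive_smooth f (x : R) : smooth f -> is_derive x 1 f (derive1 f x).
Proof. by move=> sf; rewrite derive1E; apply/derivableP/smooth_derivable. Qed.

Lemma is_derive1_funE f (df : R -> R) :
  (forall x : R, is_derive x 1 f (df x)) -> derive1 f = df.
Proof. by move=> fdf; apply/funext => x; rewrite derive1E derive_val. Qed.

Lemma smooth_antiderivative f (F : R -> R) :
  smooth f -> (forall x : R, is_derive x 1 F (f x)) -> smooth F.
Proof.
move=> sf Ff [|n] x; first exact: (@ex_derive _ _ _ _ _ _ _ (Ff x)).
have := sf n x; rewrite /derive1n iterSr.
by rewrite (_ : @derive1 R R F = f)//; exact: is_derive1_funE.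
Qed.

Lemma smoothB f g : smooth f -> smooth g -> smooth (fun x => f x - g x).
Proof.
move=> sf sg.
apply: (@smooth_coind (fun k => exists f g,
  [/\ smooth f, smooth g & k = fun x => f x - g x])); last by exists f, g.
move=> k [f' [g' [sf' sg' ->]]].
have D (x : R) : is_derive x 1 (fun x => f' x - g' x) (derive1 f' x - derive1 g' x).
  by apply: is_deriveB; exact: is_derive_smooth.
split=> [x|]; first exact: (@ex_derive _ _ _ _ _ _ _ (D x)).
exists (derive1 f'), (derive1 g'); split; [exact: smooth_derive1..|].
exact: is_derive1_funE.
Qed.

Lemma is_derive_affine (f : R -> R) (a b c df : R) x :
  is_derive (b * x + c) 1 f df ->
  is_derive x 1 (fun x => a * f (b * x + c)) (a * b * df).
Proof.
move=> fdf.
have D : is_derive x 1 (fun x => b * x + c) b.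
  have -> : (fun x => b * x + c) = (b \*: (@id R)) \+ cst c by [].
  by apply: is_derive_eq; rewrite addr0 /GRing.scale/= mulr1.
have C := @is_derive1_comp R f (fun x => b * x + c) x _ _ fdf D.
have -> : (fun x => a * f (b * x + c)) = a \*: (f \o (fun x => b * x + c)) by [].
by rewrite -mulrA (mulrC b); exact: is_deriveZ.
Qed.

Lemma smooth_affine f a b c : smooth f -> smooth (fun x => a * f (b * x + c)).
Proof.
move=> sf.
apply: (@smooth_coind (fun k => exists f a,
  smooth f /\ k = fun x => a * f (b * x + c))); last by exists f, a.
move=> k [g [d [sg ->]]].
have D (x : R) : is_derive x 1 (fun x => d * g (b * x + c))
    (d * b * derive1 g (b * x + c)).
  by apply: is_derive_affine; exact: is_derive_smooth.
split=> [x|]; first exact: (@ex_derive _ _ _ _ _ _ _ (D x)).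
exists (derive1 g), (d * b); split; first exact: smooth_derive1.
exact: is_derive1_funE.
Qed.

(** The functions [p(1/x) exp(-1/x)], extended by [0]: a class of flat functions
    closed under differentiation. *)
Definition flat (p : {poly R}) (x : R) : R :=
  if 0 < x then p.[x^-1] * expR (- x^-1) else 0.

Lemma poly_expR_bounded (p : {poly R}) :
  exists C : R, forall y, 0 <= y -> `|p.[y] * expR (- y)| <= C.
Proof.
exists (\sum_(i < size p) `|p`_i| * i`!%:R) => y y0.
rewrite horner_coef mulr_suml (le_trans (ler_norm_sum _ _ _))//.
apply: ler_sum => i _; rewrite -mulrA normrM ler_wpM2l//.
rewrite ger0_norm ?mulr_ge0 ?exprn_ge0 ?expR_ge0//.
rewrite expRN ler_pdivrMr ?expR_gt0//.
have fi : (0 : R) < i`!%:R by rewrite ltr0n fact_gt0.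
rewrite -ler_pdivrMl// mulrC.
case: {+}i {fi} => -[|n] /= _; first by rewrite expr0 fact0 divr1 -[leLHS]addr0 (le_trans _ (expR_ge1Dx _))// lerD.
by rewrite (le_trans _ (expR_ge1Dxn n y0))// lerDr.
Qed.

(** This makes the derivative of [flat p] at [0] equal to [0]. *)
Lemma flat_quadratic (p : {poly R}) :
  exists C : R, forall x, `|flat p x| <= C * x ^+ 2.
Proof.
have [C HC] := poly_expR_bounded ('X^2 * p).
have C0 : 0 <= C by apply: le_trans (HC 0 (lexx _)).
exists C => x; rewrite /flat; case: ifPn => x0; last first.
  by rewrite normr0 mulr_ge0// sqr_ge0.
have := HC x^-1; rewrite invr_ge0 ltW// => /(_ isT).
have x2 : 0 < x ^+ 2 by rewrite exprn_gt0.
rewrite hornerM hornerXn -mulrA normrM exprVn normfV (gtr0_norm x2).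
by rewrite ler_pdivrMl// [X in _ <= X -> _]mulrC.
Qed.

Lemma is_derive_flat (p : {poly R}) (x : R) :
  is_derive x 1 (flat p) (flat ('X^2 * (p - p^`())) x).
Proof.
have [x0|x0|->] := ltgtP x 0.
- have -> : flat ('X^2 * (p - p^`())) x = 0 by rewrite /flat ltNge (ltW x0).
  apply: (@near_eq_is_derive _ _ _ (cst 0)).
    near=> y; rewrite /flat ifF//; apply/negbTE; rewrite -leNgt ltW//.
    near: y; exact: lt_nbhsl.
- have xN0 : x != 0 by rewrite gt_eqF.
  apply: (@near_eq_is_derive _ _ _ (fun y : R => p.[y^-1] * expR (- y^-1))).
    near=> y; rewrite /flat ifT//; near: y; exact: lt_nbhsr.
  have D1 : is_derive x 1 (fun y : R => y^-1) (- x ^- 2).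
    have -> : (- x ^- 2 : R) = - x ^- 2 *: 1 by rewrite /GRing.scale/= mulr1.
    exact: is_deriveV.
  have Dp : is_derive (x^-1) 1 (horner p) (p^`()).[x^-1].
    by rewrite derivE derive1E; apply/derivableP/derivable_horner.
  have D2 := @is_derive1_comp R (horner p) (fun y => y^-1) x _ _ Dp D1.
  have D1N : is_derive x 1 (fun y : R => - y^-1) (x ^- 2).
    by rewrite -[X in is_derive _ _ _ X]opprK; apply: is_deriveN.
  have D3 := @is_derive1_comp R expR (fun y => - y^-1) x _ _ (is_derive_expR _) D1N.
  have -> : (fun y => p.[y^-1] * expR (- y^-1)) =
    (horner p \o (fun y => y^-1)) * (expR \o (fun y => - y^-1)) by [].
  apply: is_derive_eq => /=.
  rewrite /flat x0 !hornerE /GRing.scale/= exprVn.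
  by ring.
- have -> : flat ('X^2 * (p - p^`())) 0 = 0 by rewrite /flat ltxx.
  have [C HC] := flat_quadratic p.
  have fp0 : flat p 0 = 0 by rewrite /flat ltxx.
  have C0 : 0 <= C.
    by have := HC 1; rewrite expr1n mulr1; apply: le_trans.
  have L : (h^-1 *: (flat p (h *: 1 + 0) - flat p 0)) @[h --> 0^'] --> (0:R).
    apply/cvgrPdist_le => e e0; near=> h.
    have h0 : h != 0 by near: h; exact: nbhs_dnbhs_neq.
    rewrite fp0 sub0r normrN subr0 addr0 /GRing.scale/= mulr1 normrM normfV.
    rewrite ler_pdivrMl ?normr_gt0// (le_trans (HC _))//.
    rewrite -real_normK ?num_real// expr2 mulrA mulrC ler_wpM2l//.
    have : `|h| <= e / (C + 1).
      near: h; apply: dnbhs0_le.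
      by rewrite divr_gt0// ltr_wpDl.
    move=> /(ler_wpM2l C0)/le_trans; apply.
    rewrite mulrA ler_pdivrMr ?ltr_wpDl// mulrDr mulr1 [e * C]mulrC.
    by rewrite lerDl ltW.
  split; first by apply/cvg_ex; exists 0.
  exact/cvg_lim.
Unshelve. all: by end_near. Qed.

Definition bump (x : R) : R := flat 1 x * flat 1 (1 - x).

(** The derivatives of the bump are finite sums of products of a [flat] function
    of [x] and a [flat] function of [1 - x]. *)
Lemma smooth_bump : smooth bump.
Proof.
pose F (s : seq ({poly R} * {poly R})) (x : R) :=
  \sum_(pq <- s) flat pq.1 x * flat pq.2 (1 - x).
apply: (@smooth_coind (fun k => exists s, k = F s)); last first.
  by exists [:: (1, 1)]; apply/funext => x; rewrite /F big_seq1.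
move=> _ [s ->].
pose d (p : {poly R}) := 'X^2 * (p - p^`())%R.
pose s' := [seq (d pq.1, pq.2) | pq <- s] ++ [seq (pq.1, - d pq.2) | pq <- s].
have flatN p x : flat (- p) x = - flat p x.
  by rewrite /flat; case: ifP; rewrite ?oppr0// hornerN mulNr.
have D (x : R) : is_derive x 1 (F s) (F s' x).
  rewrite /F big_cat !big_map /= -big_split/=.
  elim: s {s'} => [|[p q] s IHs].
    rewrite big_nil (_ : (fun _ => _) = cst 0); first exact: is_derive_cst.
    by apply/funext => y; rewrite big_nil.
  rewrite big_cons /=.
  have -> : (fun x => \sum_(pq <- (p, q) :: s) flat pq.1 x * flat pq.2 (1 - x)) =
      (flat p) * (fun x => 1 * flat q (- 1 * x + 1)) +
      (fun x => \sum_(pq <- s) flat pq.1 x * flat pq.2 (1 - x)).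
    apply/funext => y; rewrite big_cons/=; congr (_ * _ + _).
    by rewrite mul1r mulN1r addrC.
  apply: is_deriveD.
  have D1 := is_derive_flat p x.
  have := is_derive_flat q (- 1 * x + 1).
  move=> /(@is_derive_affine (flat q) 1 (-1) 1) D2.
  apply: is_derive_eq; rewrite /GRing.scale/= flatN /d.
  by rewrite !(mul1r,mulN1r) (addrC _ 1); ring.
split=> [x|]; first exact: (@ex_derive _ _ _ _ _ _ _ (D x)).
by exists s'; exact: is_derive1_funE.
Qed.

Lemma flat1_ge0 x : 0 <= flat 1 x.
Proof.
by rewrite /flat; case: ifP => // _; rewrite hornerE mul1r expR_ge0.
Qed.

Lemma bump_ge0 x : 0 <= bump x.
Proof. by rewrite mulr_ge0// flat1_ge0. Qed.

Lemma bump_out x : ~~ (0 < x < 1) -> bump x = 0.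
Proof.
rewrite negb_and /bump /flat subr_gt0 => /orP[/negbTE->|/negbTE->].
  by rewrite mul0r.
by rewrite mulr0.
Qed.

Lemma bump_gt0 x : 0 < x < 1 -> 0 < bump x.
Proof.
move=> /andP[x0 x1]; rewrite /bump /flat x0 subr_gt0 x1 !hornerE.
by rewrite mulr_gt0// ?mulr_gt0 ?expR_gt0.
Qed.

(** The lower bound [-1] stands for [-oo]: only functions vanishing on
    [`]-oo, 0]] are integrated. *)
Definition primitive (f : R -> R) (x : R) : R :=
  \int[lebesgue_measure]_(t in `[-1, x]) f t.

Lemma primitive_le0 (f : R -> R) x : (forall y, y <= 0 -> f y = 0) ->
  x <= 0 -> primitive f x = 0.
Proof.
move=> f0 x0; rewrite /primitive /Rintegral (eq_integral (cst 0%E)) ?integral0//.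
by move=> t; rewrite inE/= in_itv/= => /andP[_ tx]; rewrite f0// (le_trans tx).
Qed.

Lemma is_derive_primitive (f : R -> R) (x : R) : continuous f ->
  (forall y, y <= 0 -> f y = 0) -> is_derive x 1 (primitive f) (f x).
Proof.
move=> cf f0.
have [x0|x0] := ltP x 0.
  rewrite f0 ?ltW//.
  apply: (@near_eq_is_derive _ _ _ (cst 0)).
    near=> y; rewrite primitive_le0// ltW//.
    near: y; exact: lt_nbhsl.
have x1 : x < x + 1 by rewrite ltrDl.
have I : lebesgue_measure.-integrable `[-1, (x+1)] (EFin \o f).
  apply: continuous_compact_integrable; first exact: segment_compact.
  exact: continuous_subspaceT.
have [] := continuous_FTC1 x1 I _ (cf x).
  by rewrite /= lte_fin (lt_le_trans _ x0).
by move=> dF <-; rewrite derive1E; exact/derivableP.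
Unshelve. all: by end_near. Qed.

Lemma MVT_everywhere (F f : R -> R) (a b : R) : (forall x : R, is_derive x 1 F (f x)) ->
  a <= b -> exists2 c, a <= c <= b & F b - F a = f c * (b - a).
Proof.
move=> Ff ab.
have [|c] := @MVT_segment _ F f a b ab.
- apply: continuous_subspaceT => x.
  apply/differentiable_continuous/derivable1_diffP.
  exact: (@ex_derive _ _ _ _ _ _ _ (Ff x)).
- by rewrite in_itv/= => cab E; exists c.
Qed.

Lemma nondecreasing_is_derive (F f : R -> R) : (forall x : R, is_derive x 1 F (f x)) ->
  (forall x, 0 <= f x) -> {homo F : x y / x <= y}.
Proof.
move=> Ff f0 x y xy; have [c _ E] := MVT_everywhere Ff xy.
by rewrite -subr_ge0 E mulr_ge0// subr_ge0.
Qed.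

Let prim_bump (x : R) : is_derive x 1 (primitive bump) (bump x).
Proof.
apply: is_derive_primitive; first exact/smooth_continuous/smooth_bump.
by move=> y y0; rewrite bump_out// negb_and -leNgt y0.
Qed.

(** A primitive with zero increment on a subinterval of [(0, 1)] would contradict
    the mean value theorem, since the bump is positive there. *)
Lemma bump_mass_gt0 : 0 < primitive bump 1.
Proof.
have [|c /andP[c1 c2]] := @MVT_everywhere _ _ (4^-1) (2^-1) prim_bump; first by lra.
move=> E.
have : 0 < primitive bump (2^-1) - primitive bump (4^-1).
  by rewrite E mulr_gt0// ?bump_gt0//; lra.
have nd := nondecreasing_is_derive prim_bump bump_ge0.
have := nd (2^-1) 1; have := nd 0 (4^-1).
rewrite [primitive bump 0]primitive_le0//; last first.
  by move=> y y0; rewrite bump_out// negb_and -leNgt y0.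
lra.
Qed.

Definition mollifier (x : R) : R := (primitive bump 1)^-1 * bump x.

Definition smooth_step (x : R) : R := (primitive bump 1)^-1 * primitive bump x.

Definition smooth_ramp : R -> R := primitive smooth_step.

Lemma smooth_mollifier : smooth mollifier.
Proof.
have -> : mollifier = fun x => (primitive bump 1)^-1 * bump (1 * x + 0).
  by apply/funext => x; rewrite mul1r addr0.
exact/smooth_affine/smooth_bump.
Qed.

Lemma mollifier_ge0 x : 0 <= mollifier x.
Proof. by rewrite mulr_ge0 ?bump_ge0// invr_ge0 ltW// bump_mass_gt0. Qed.

Lemma mollifier_out x : ~~ (0 < x < 1) -> mollifier x = 0.
Proof. by move=> x01; rewrite /mollifier bump_out// mulr0. Qed.

Lemma is_derive_smooth_step (x : R) : is_derive x 1 smooth_step (mollifier x).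
Proof.
have := @is_derive_affine (primitive bump) (primitive bump 1)^-1 1 0 _ x (prim_bump _).
rewrite mul1r addr0 mulr1; apply: near_eq_is_derive.
by near=> y; rewrite mul1r addr0.
Unshelve. all: by end_near. Qed.

Lemma smooth_smooth_step : smooth smooth_step.
Proof. exact: (smooth_antiderivative smooth_mollifier is_derive_smooth_step). Qed.

Lemma smooth_step_le0 x : x <= 0 -> smooth_step x = 0.
Proof.
move=> x0; rewrite /smooth_step [primitive bump x]primitive_le0 ?mulr0// => y y0.
by rewrite bump_out// negb_and -leNgt y0.
Qed.

Lemma smooth_step_ge1 x : 1 <= x -> smooth_step x = 1.
Proof.
move=> x1; rewrite /smooth_step.
have [c /andP[c1 c2] E] := MVT_everywhere prim_bump x1.
rewrite bump_out in E; last by rewrite negb_and -!leNgt c1 orbT.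
move/eqP: E; rewrite mul0r subr_eq0 => /eqP->.
by rewrite mulVf// gt_eqF// bump_mass_gt0.
Qed.

Lemma smooth_step_nondecreasing : {homo smooth_step : x y / x <= y}.
Proof. exact: nondecreasing_is_derive is_derive_smooth_step mollifier_ge0. Qed.

Lemma smooth_step01 x : 0 <= smooth_step x <= 1.
Proof.
have [x0|/ltW x0] := leP x 0; first by rewrite smooth_step_le0// lexx ler01.
have [x1|/ltW x1] := leP 1 x; first by rewrite smooth_step_ge1// lexx ler01.
rewrite -{1}(smooth_step_le0 (lexx 0)) smooth_step_nondecreasing//=.
by rewrite -(smooth_step_ge1 (lexx 1)) smooth_step_nondecreasing.
Qed.

Lemma is_derive_smooth_ramp (x : R) : is_derive x 1 smooth_ramp (smooth_step x).
Proof.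
apply: is_derive_primitive; last exact: smooth_step_le0.
exact/smooth_continuous/smooth_smooth_step.
Qed.

Lemma smooth_smooth_ramp : smooth smooth_ramp.
Proof. exact: (smooth_antiderivative smooth_smooth_step is_derive_smooth_ramp). Qed.

Lemma smooth_ramp_le0 x : x <= 0 -> smooth_ramp x = 0.
Proof. exact: primitive_le0 smooth_step_le0. Qed.

(** The convolution of the mollifier with the indicator of [[0, 1]]. *)
Definition window (x : R) : R := smooth_step x - smooth_step (x - 1).

(** The convolution of the step with the indicator of [[-1, 0]], that is, the
    primitive of [x |-> window (x + 1)]. *)
Definition wide_step (x : R) : R := smooth_ramp (x + 1) - smooth_ramp x.

(** The convolution of [window] with the indicator of [[-1, 0]]. As a difference
    of two translates of [wide_step], its integer translates have telescoping
    sums: it generates a partition of unity. *)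
Definition hat (x : R) : R := wide_step x - wide_step (x - 1).

Lemma is_derive_shiftB (F f : R -> R) (a b x : R) : (forall x : R, is_derive x 1 F (f x)) ->
  is_derive x 1 (fun x => F (x + a) - F (x + b)) (f (x + a) - f (x + b)).
Proof.
move=> Ff.
have D c : is_derive x 1 (fun x => F (x + c)) (f (x + c)).
  have := @is_derive_affine F 1 1 c _ x (Ff _).
  rewrite !mul1r; apply: near_eq_is_derive.
  by near=> y; rewrite !mul1r.
exact: is_deriveB.
Unshelve. all: by end_near. Qed.

Lemma smooth_shift f a : smooth f -> smooth (fun x => f (x + a)).
Proof.
move=> /(@smooth_affine f 1 1 a).
by under [X in smooth X -> _]eq_fun do rewrite !mul1r.
Qed.

Lemma is_derive_window (x : R) :
  is_derive x 1 window (mollifier x - mollifier (x - 1)).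
Proof.
have := @is_derive_shiftB _ _ 0 (-1) x is_derive_smooth_step.
by rewrite addr0; apply: near_eq_is_derive; near=> y; rewrite addr0.
Unshelve. all: by end_near. Qed.

Lemma smooth_window : smooth window.
Proof.
apply: smoothB; first exact: smooth_smooth_step.
exact/smooth_shift/smooth_smooth_step.
Qed.

Lemma window_ge0 x : 0 <= window x.
Proof. by rewrite subr_ge0 smooth_step_nondecreasing// gerBl. Qed.

Lemma window_out x : ~~ (0 < x < 2) -> window x = 0.
Proof.
rewrite negb_and -!leNgt /window => /orP[x0|x2].
  by rewrite !smooth_step_le0 ?subrr// lerBlDr (le_trans x0).
by rewrite !smooth_step_ge1 ?subrr//; lra.
Qed.

Lemma is_derive_wide_step (x : R) : is_derive x 1 wide_step (window (x + 1)).
Proof.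
have := @is_derive_shiftB _ _ 1 0 x is_derive_smooth_ramp.
rewrite /window addrK addr0; apply: near_eq_is_derive; near=> y.
by rewrite addr0.
Unshelve. all: by end_near. Qed.

Lemma smooth_wide_step : smooth wide_step.
Proof.
apply: smoothB; last exact: smooth_smooth_ramp.
exact/smooth_shift/smooth_smooth_ramp.
Qed.

Lemma wide_step_nondecreasing : {homo wide_step : x y / x <= y}.
Proof.
by apply: nondecreasing_is_derive is_derive_wide_step _ => x; exact: window_ge0.
Qed.

Lemma wide_step_leN1 x : x <= -1 -> wide_step x = 0.
Proof. by move=> x1; rewrite /wide_step !smooth_ramp_le0 ?subrr//; lra. Qed.

Lemma wide_step_ge1 x : 1 <= x -> wide_step x = 1.
Proof.
move=> x1; rewrite /wide_step.
have [|c /andP[c1 c2] ->] := MVT_everywhere is_derive_smooth_ramp (_ : x <= x + 1).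
  by rewrite lerDl.
by rewrite smooth_step_ge1 ?(le_trans x1)// addrAC subrr add0r mulr1.
Qed.

Lemma wide_step01 x : 0 <= wide_step x <= 1.
Proof.
have [x0|/ltW x0] := leP x (-1); first by rewrite wide_step_leN1// lexx ler01.
have [x1|/ltW x1] := leP 1 x; first by rewrite wide_step_ge1// lexx ler01.
rewrite -{1}(wide_step_leN1 (lexx (-1))) wide_step_nondecreasing//=.
by rewrite -(wide_step_ge1 (lexx 1)) wide_step_nondecreasing.
Qed.

Lemma is_derive_hat (x : R) : is_derive x 1 hat (window (x + 1) - window x).
Proof.
have := @is_derive_shiftB _ _ 0 (-1) x is_derive_wide_step.
rewrite addr0 subrK; apply: near_eq_is_derive; near=> y.
by rewrite addr0.
Unshelve. all: by end_near. Qed.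

Lemma smooth_hat : smooth hat.
Proof.
apply: smoothB; first exact: smooth_wide_step.
exact/smooth_shift/smooth_wide_step.
Qed.

Lemma hat_ge0 x : 0 <= hat x.
Proof. by rewrite subr_ge0 wide_step_nondecreasing// gerBl. Qed.

Lemma hat_out x : ~~ (-1 < x < 2) -> hat x = 0.
Proof.
rewrite negb_and -!leNgt /hat => /orP[x0|x2].
  by rewrite !wide_step_leN1 ?subrr//; lra.
by rewrite !wide_step_ge1 ?subrr//; lra.
Qed.

Lemma sum_hat x (m n : nat) : (m <= n)%N ->
  \sum_(m <= i < n) hat (x - i%:R) = wide_step (x - m%:R) - wide_step (x - n%:R).
Proof.
move=> mn; rewrite -opprB -(telescope_sumr (fun i => wide_step (x - i%:R)))// -sumrN.
by apply: eq_bigr => i _; rewrite opprB /hat -[in RHS]addn1 natrD [- (_ + 1)]opprD addrA.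
Qed.

End smooth.

(** * Pairing with bounded compactly supported weights *)

Section pairing.
Context {R : realType}.
Implicit Types (w f phi psi : R -> R) (M K : R).

(** Local integrability on the symmetric intervals, with global measurability: the
    form in which it is used against a [weight]. *)
Definition loc_int w :=
  measurable_fun setT w /\ forall K, leb.-integrable `[- K, K] (EFin \o w).

Definition weight M K phi :=
  [/\ measurable_fun setT phi, forall x, `|phi x| <= M &
      forall x, K < `|x| -> phi x = 0].

(** The duality bracket between locally integrable functions and weights. *)
Definition pair w phi : R := \int[leb]_x (w x * phi x).

Lemma weight_ge0 M K phi : weight M K phi -> 0 <= M.
Proof. by move=> [_ /(_ 0) M0 _]; exact: le_trans M0. Qed.

Lemma weightW M K M' K' phi : M <= M' -> K <= K' ->
  weight M K phi -> weight M' K' phi.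
Proof.
move=> MM KK [mphi pM pK]; split=> // x; first exact: le_trans MM.
by move=> Kx; apply: pK; exact: le_lt_trans Kx.
Qed.

Lemma weight_restrict M K phi w : weight M K phi ->
  (fun x => w x * phi x) = (fun x => w x * phi x) \_ `[- K, K].
Proof.
move=> [_ _ pK]; apply/funext => x; rewrite /patch; case: ifPn => //.
by rewrite notin_setE/= in_itv/= -ler_norml => /negP; rewrite -ltNge => /pK->; rewrite mulr0.
Qed.

Lemma pair_itv w phi M K : weight M K phi ->
  pair w phi = \int[leb]_(x in `[- K, K]) (w x * phi x).
Proof. by move=> wp; rewrite Rintegral_mkcond -(weight_restrict _ wp). Qed.

Lemma weight_integrable_itv w phi M K : loc_int w -> weight M K phi ->
  leb.-integrable `[- K, K] (fun x => (w x * phi x)%:E).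
Proof.
move=> [mw wi] [mp pM pK].
have -> : (fun x => (w x * phi x)%:E) = ((EFin \o w) \* (EFin \o phi))%E.
  by apply/funext => x; rewrite /= EFinM.
apply: integrableMl => //; first exact: measurable_funTS.
exists M; split; first exact: num_real.
by move=> N MN x _ /=; rewrite (le_trans (pM x))// ltW.
Qed.

Lemma pair_integrable w phi M K : loc_int w -> weight M K phi ->
  leb.-integrable setT (fun x => (w x * phi x)%:E).
Proof.
move=> wl wp; have := weight_integrable_itv wl wp.
rewrite integrable_mkcond//.
rewrite (_ : _ \_ _ = (EFin \o (fun x => w x * phi x) \_ `[- K, K])); last first.
  by apply/funext => x; rewrite /patch/=; case: ifP.
by rewrite -(weight_restrict _ wp).
Qed.

Lemma pair_diff_le w1 w2 phi M K : loc_int w1 -> loc_int w2 -> weight M K phi ->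
  `|pair w1 phi - pair w2 phi| <= M * \int[leb]_(x in `[- K, K]) `|w1 x - w2 x|.
Proof.
move=> l1 l2 wp; rewrite !(pair_itv _ wp) -RintegralB//;
  [|exact: (weight_integrable_itv l1 wp)|exact: (weight_integrable_itv l2 wp)].
have mI : measurable (`[- K, K] : set R) by exact: measurable_itv.
have I : leb.-integrable `[- K, K] (EFin \o (fun x => w1 x - w2 x)).
  by apply: (integrableB _ (l1.2 K) (l2.2 K)).
have I' : leb.-integrable `[- K, K] (fun x => (w1 x * phi x - w2 x * phi x)%:E).
  apply: (@integrableB _ _ _ leb _ mI (fun x => (w1 x * phi x)%:E)
    (fun x => (w2 x * phi x)%:E)).
    exact: (weight_integrable_itv l1 wp).
  exact: (weight_integrable_itv l2 wp).
rewrite (le_trans (le_normr_Rintegral _ _))// -RintegralZl//; last exact: integrable_norm.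
apply: le_Rintegral => //; first exact: integrable_norm.
  apply: (@integrableZl _ _ _ leb _ mI M (fun x => `|w1 x - w2 x|%:E)) => //; exact: integrable_norm.
by move=> x _; rewrite -mulrBl normrM mulrC ler_wpM2r//; case: wp.
Qed.

Lemma pairBr w phi psi M1 K1 M2 K2 : loc_int w -> weight M1 K1 phi -> weight M2 K2 psi ->
  pair w (fun x => phi x - psi x) = pair w phi - pair w psi.
Proof.
move=> wl w1 w2; rewrite /pair -RintegralB//; [|exact: pair_integrable wl w1|exact: pair_integrable wl w2].
by apply: eq_Rintegral => x _; rewrite mulrBr.
Qed.

Lemma pairZr w phi M K c : loc_int w -> weight M K phi ->
  pair w (fun x => c * phi x) = c * pair w phi.
Proof.
move=> wl w1; rewrite /pair -RintegralZl//; last exact: pair_integrable wl w1.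
by apply: eq_Rintegral => x _; rewrite mulrCA.
Qed.

Lemma weightB M1 K1 M2 K2 phi psi : weight M1 K1 phi -> weight M2 K2 psi ->
  weight (M1 + M2) (Num.max K1 K2) (fun x => phi x - psi x).
Proof.
move=> [mp pM pK] [mp' pM' pK']; split => [|x|x].
- exact: measurable_funB.
- by rewrite (le_trans (ler_normB _ _))// lerD.
- by rewrite gt_max => /andP[/pK-> /pK'->]; rewrite subrr.
Qed.

End pairing.
(** * Test functions *)

Section test_functions.
Context {R : realType}.
Implicit Types (f phi eta xi : R -> R) (K s t : R).

Lemma compact_closure_itv (A : set R) (a b : R) : A `<=` `[a, b] ->
  closure A `<=` `[a, b] /\ compact (closure A).
Proof.
move=> Aab.
have cAab : closure A `<=` `[a, b].
  have := closure_subset Aab; rewrite -(closure_id `[a, b]).1//.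
  exact: itv_closed.
split=> //; apply: subclosed_compact cAab; first exact: closed_closure.
exact: segment_compact.
Qed.

Lemma itv_normE K x : (x \in `[- K, K]) = (`|x| <= K).
Proof. by rewrite in_itv/= ler_norml. Qed.

Lemma test_functionP phi K : smooth phi -> (forall x, K < `|x| -> phi x = 0) ->
  test_function phi.
Proof.
move=> sphi phi0; split=> //.
apply: (@compact_closure_itv _ (- K) K _).2 => x /= /eqP phix.
rewrite -[_ \in _]/(x \in `[- K, K]) itv_normE leNgt; apply/negP => /phi0.
exact: phix.
Qed.

Lemma derive1_out phi (a b : R) : (forall x, ~~ (a <= x <= b) -> phi x = 0) ->
  forall x, ~~ (a <= x <= b) -> derive1 phi x = 0.
Proof.
move=> phi0 x; rewrite negb_and -!ltNge => xab; rewrite derive1E.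
have : is_derive x (1 : R) phi 0.
  apply: (@near_eq_is_derive _ _ _ (cst 0)).
  case/orP: xab => [xa|bx]; near=> y; rewrite phi0// negb_and -!ltNge.
    by apply/orP; left; near: y; exact: lt_nbhsl.
  by apply/orP; right; near: y; exact: lt_nbhsr.
by move=> ?; rewrite derive_val.
Unshelve. all: by end_near. Qed.

Lemma continuous_weight phi K : continuous phi -> (forall x, K < `|x| -> phi x = 0) ->
  exists M, weight M K phi.
Proof.
move=> cphi phi0.
have [K0|K0] := ltP K 0.
  exists 0; split=> //; last by move=> x; rewrite phi0 ?normr0// (lt_le_trans K0).
  exact: continuous_measurable_fun.
have [|c _ cM] := @EVT_max R (fun x => `|phi x|) (- K) K (ge0_cp K0).2.
  by apply: continuous_subspaceT => x; apply: continuous_comp; [exact: cphi|exact: norm_continuous].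
exists `|phi c|; split=> //; first exact: continuous_measurable_fun.
move=> x; have [xK|/phi0->] := leP `|x| K; last by rewrite normr0.
by apply: cM; rewrite itv_normE.
Qed.

(** Every iterated partial derivative of a tensor product is again a tensor
    product of smooth functions. *)
Lemma smooth2_mul eta xi : smooth eta -> smooth xi ->
  smooth2 (fun t x => eta t * xi x).
Proof.
move=> seta sxi s.
have [e [x [se sx ->]]] : exists e x, [/\ smooth e, smooth x &
    iter_partial s (fun t y => eta t * xi y) = fun t y => e t * x y].
  elim: s => [|b s [e [x [se sx E]]]]; first by exists eta, xi.
  rewrite /iter_partial /= -/(iter_partial s _) E; case: b.
  - exists (derive1 e), x; split; [exact: smooth_derive1|exact: sx|].
    apply/funext => t; apply/funext => y; rewrite /partial_t derive1E.
    have := is_derive_smooth t se => D.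
    rewrite (_ : (fun t => _) = x y \*: e); last by apply/funext => r; rewrite mulrC.
    by rewrite derive_val /GRing.scale/= mulrC.
  - exists e, (derive1 x); split; [exact: se|exact: smooth_derive1|].
    apply/funext => t; apply/funext => y; rewrite /partial_x derive1E.
    have := is_derive_smooth y sx => D.
    by rewrite -[LHS]/('D_1 (e t \*: x) y) derive_val /GRing.scale/=.
split=> [p|t y].
  apply: (@continuousM R (R * R)%type (fun p => e p.1) (fun p => x p.2)).
    apply: (@continuous_comp _ _ _ (@fst R R) e); first exact: cvg_fst.
    exact: smooth_continuous.
  apply: (@continuous_comp _ _ _ (@snd R R) x); first exact: cvg_snd.
  exact: smooth_continuous.
split.
- rewrite (_ : (fun t => _) = x y \*: e); last by apply/funext => r; rewrite mulrC.
  by apply: derivableZ; exact: smooth_derivable.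
- by have := @derivableZ _ _ _ x (e t) y 1 (smooth_derivable sx).
Qed.

Lemma partial_t_mul eta xi t x : smooth eta ->
  partial_t (fun t x => eta t * xi x) t x = derive1 eta t * xi x.
Proof.
move=> se; rewrite /partial_t derive1E.
have := is_derive_smooth t se => D.
rewrite (_ : (fun t => _) = xi x \*: eta); last by apply/funext => r; rewrite mulrC.
by rewrite derive_val /GRing.scale/= mulrC.
Qed.

Lemma partial_x_mul eta xi t x : smooth xi ->
  partial_x (fun t x => eta t * xi x) t x = eta t * derive1 xi x.
Proof.
move=> sx; rewrite /partial_x derive1E.
have := is_derive_smooth x sx => D.
by rewrite -[LHS]/('D_1 (eta t \*: xi) x) derive_val /GRing.scale/=.
Qed.

Lemma test_function2_mul eta xi (s t K : R) : smooth eta -> smooth xi -> 0 < s ->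
  (forall r, ~~ (s <= r <= t) -> eta r = 0) ->
  (forall x, K < `|x| -> xi x = 0) ->
  test_function2 (fun t x => eta t * xi x).
Proof.
move=> se sx s0 eta0 xi0.
have sub : [set p : R * R | eta p.1 * xi p.2 != 0] `<=` `[s, t] `*` `[- K, K].
  move=> [r x] /=; rewrite mulf_eq0 negb_or => /andP[/eqP er /eqP xx]; split => /=.
    by rewrite in_itv/=; apply/negPn/negP => /eta0.
  by rewrite itv_normE leNgt; apply/negP => /xi0.
have clo : closed (`[s, t] `*` `[- K, K] : set (R * R)).
  rewrite -[_ `*` _]/((@fst R R @^-1` `[s, t]) `&` (@snd R R @^-1` `[- K, K])).
  by apply: closedI; apply: closed_comp => [? _|];
    [exact: cvg_fst|exact: itv_closed|exact: cvg_snd|exact: itv_closed].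
have csub := closure_subset sub; rewrite -[X in _ `<=` X](closure_id _).1// in csub.
split.
- exact: smooth2_mul.
- apply: subclosed_compact csub; first exact: closed_closure.
  by apply: compact_setX; exact: segment_compact.
- move=> [r x] /csub [/= + _]; rewrite in_itv/= => /andP[sr _]; split=> //=.
  by rewrite in_itv/= andbT (lt_le_trans s0).
Qed.

End test_functions.
(** * Functions of time and space on slabs *)

Section slab.
Context {R : realType}.
Implicit Types (g u : R -> R -> R) (eta xi : R -> R) (s t T K M : R).

(** A nonempty open interval is not negligible. *)
Lemma ae_ex_itv (P : R -> Prop) (a b : R) : a < b -> {ae leb, forall x, P x} ->
  exists2 x, a < x < b & P x.
Proof.
move=> ab [N [mN N0 PN]]; apply: contrapT => H.
have sub : `]a, b[ `<=` N.
  move=> x /=; rewrite in_itv/= => xab; apply: PN => Px; apply: H; by exists x.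
have : (leb (`]a, b[ : set R) <= leb N)%E by apply: le_measure; rewrite ?inE.
rewrite N0 leNgt lebesgue_measure_itv/= lte_fin ab -EFinB lte_fin subr_gt0 ab.
by [].
Qed.

Definition slab T K : set (R * R) := `[0, T] `*` `[- K, K].

Lemma measurable_slab T K : measurable (slab T K).
Proof. by apply: measurableX. Qed.

Lemma slab_lty T K : (leb2 (slab T K) < +oo)%E.
Proof.
rewrite product_measure1E//= !lebesgue_measure_itv/=.
by case: ifPn => _; case: ifPn => _; rewrite -?EFinB -?EFinM ?mule0 ?mul0e ?ltry.
Qed.

Definition measurable2 g := measurable_fun [set: R * R] (fun p => g p.1 p.2).

Lemma measurable2_section g t : measurable2 g -> measurable_fun setT (g t).
Proof. by move=> mg; exact: (measurableT_comp mg (pair1_measurable t)). Qed.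

(** The last two clauses are those required by Fubini on a slab: sections and
    joint integrability. *)
Definition slab_int g := [/\ measurable2 g, forall t, loc_int (g t) &
  forall T K, leb2.-integrable (slab T K) (fun p => (g p.1 p.2)%:E)].

(** Testing against a tensor product is testing in time the function
    [t |-> pair (g t) xi]. *)
Lemma slab_fubini g eta xi T K M N : slab_int g ->
  measurable_fun setT eta -> (forall t, `|eta t| <= N) ->
  (forall t, ~~ (0 <= t <= T) -> eta t = 0) -> weight M K xi ->
  leb.-integrable setT (fun t => (eta t * pair (g t) xi)%:E) /\
  \int[leb2]_p (g p.1 p.2 * (eta p.1 * xi p.2)) =
  \int[leb]_t (eta t * pair (g t) xi).
Proof.
move=> [mg lg ig] me eN e0 wx; have [mx xM x0] := wx.
pose h (p : R * R) := eta p.1 * xi p.2.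
have mh : measurable_fun setT h.
  apply: measurable_funM.
    exact: (measurableT_comp me measurable_fst).
  exact: (measurableT_comp mx measurable_snd).
have I : leb2.-integrable setT (fun p => (g p.1 p.2 * h p)%:E).
  have : leb2.-integrable (slab T K) (fun p => (g p.1 p.2 * h p)%:E).
    have -> : (fun p : R * R => (g p.1 p.2 * h p)%:E) =
        ((fun p => (g p.1 p.2)%:E) \* (EFin \o h))%E.
      by apply/funext => p; rewrite /= EFinM.
    apply: integrableMl => //; [exact: measurable_slab|exact: measurable_funTS|].
    exists (N * M); split; first exact: num_real.
    move=> r Nr p _ /=; rewrite (le_trans _ (ltW Nr))// normrM ler_pM//.
  rewrite integrable_mkcond; last exact: measurable_slab.
  congr (leb2.-integrable _ _); apply/funext => p; rewrite /patch; case: ifPn => //.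
  rewrite notin_setE /slab /= !in_itv/= => /not_andP[|] /negP pN.
    by rewrite /h e0// mul0r mulr0.
  by rewrite /h x0 ?mulr0//; move: pN; rewrite -ler_norml -ltNge.
have FE : fubini_F leb (fun p => (g p.1 p.2 * h p)%:E) =
    fun t => (eta t * pair (g t) xi)%:E.
  apply/funext => t; rewrite /fubini_F/= /h.
  have Ig := pair_integrable (lg t) wx.
  transitivity ((eta t)%:E * \int[leb]_x (g t x * xi x)%:E)%E.
    by rewrite -integralZl//; apply: eq_integral => x _; rewrite mulrCA EFinM.
  by rewrite EFinM /pair /Rintegral fineK// integrable_fin_num.
split; first by rewrite -FE; exact: integrable_fubini_F.
rewrite /Rintegral -FE; congr fine; exact/esym/integral12_prod_meas1.
Qed.

Lemma slab_fubini_half_plane g eta xi s T K M N : slab_int g ->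
  measurable_fun setT eta -> (forall t, `|eta t| <= N) -> 0 < s ->
  (forall t, ~~ (s <= t <= T) -> eta t = 0) -> weight M K xi ->
  \int[leb2]_(p in half_plane) (g p.1 p.2 * (eta p.1 * xi p.2)) =
  \int[leb]_t (eta t * pair (g t) xi).
Proof.
move=> ig me eN s0 e0 wx.
have e0' t : ~~ (0 <= t <= T) -> eta t = 0.
  rewrite negb_and -!ltNge => tN; apply: e0; rewrite negb_and -!ltNge.
  by case/orP: tN => [t0|->]; [rewrite (lt_trans t0)|rewrite orbT].
rewrite -(slab_fubini ig me eN e0' wx).2 Rintegral_mkcond.
apply: eq_Rintegral => p _; rewrite /patch; case: ifPn => //.
rewrite notin_setE /half_plane /= => /not_andP[|//] /negP; rewrite in_itv/= andbT -leNgt => p0.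
by rewrite e0 ?mul0r ?mulr0// negb_and -!ltNge (le_lt_trans p0).
Qed.

End slab.
(** * Sections of a function of class L2 *)

Section L2_regularity.
Context {R : realType}.
Variable u : R -> R -> R.
Hypothesis uL2 : L2loc_L2 u.

Lemma L2loc_section t : 0 <= t -> measurable_fun setT (u t).
Proof.
move=> t0; apply: (measurable_comp _ _ uL2.1 (@pair1_measurable _ _ _ R t)).
  by apply: measurableX => //.
by move=> _ [x _ <-]; split => //=; rewrite in_itv/= t0.
Qed.

Lemma L2loc_ae T : 0 < T ->
  {ae leb, forall t, 0 <= t <= T -> (\int[leb]_x ((u t x) ^+ 2)%:E < +oo)%E}.
Proof.
move=> T0.
pose D : set (R * R) := `[0, T] `*` setT.
have mD : measurable D by apply: measurableX.
pose f := (fun p : R * R => ((u p.1 p.2) ^+ 2)%:E) \_ D.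
have mf : measurable_fun setT f.
  apply/(measurable_restrict _ _ _).1 => //; rewrite setTI.
  apply/measurable_EFinP/measurable_funX.
  apply: measurable_funS uL2.1; first exact: measurableX.
  by move=> p [/= + _]; rewrite !in_itv/= => /andP[-> _].
have f0 p : (0 <= f p)%E by rewrite /f /patch; case: ifP => // _; rewrite lee_fin sqr_ge0.
have := @fubini_tonelli1 _ _ _ _ R (@lebesgue_measure R) (@lebesgue_measure R) f mf f0.
rewrite -integral_mkcond => E; have := uL2.2 _ T0; rewrite E => Flty.
have : leb.-integrable setT (fubini_F (@lebesgue_measure R) f).
  apply/integrableP; split.
    exact: measurable_fun_fubini_tonelli_F.
  apply: le_lt_trans Flty; apply: ge0_le_integral => //.
  - by apply: measurableT_comp => //; exact: measurable_fun_fubini_tonelli_F.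
  - exact: measurable_fun_fubini_tonelli_F.
  - by move=> x _; rewrite gee0_abs//; exact: integral_ge0.
move=> /integrable_ae => /(_ measurableT); apply: filterS => t /(_ I) fin tT.
have : (fubini_F (@lebesgue_measure R) f t < +oo)%E.
  by move: fin; rewrite fin_numElt => /andP[].
rewrite /fubini_F /f /patch; congr (_ < _)%E; apply: eq_integral => x _.
by rewrite ifT// inE/D/= in_itv/=.
Qed.

(** Since [|w| <= w^2 + 1]. *)
Lemma sqr_lty_loc_int (w : R -> R) : measurable_fun setT w ->
  (\int[leb]_x ((w x) ^+ 2)%:E < +oo)%E -> loc_int w.
Proof.
move=> mw wlty; split=> // K.
have I2 : leb.-integrable setT (fun x => ((w x) ^+ 2)%:E).
  apply/integrableP; split; first by apply/measurable_EFinP/measurable_funX.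
  by under eq_integral do rewrite gee0_abs ?lee_fin ?sqr_ge0//.
have I : leb.-integrable `[- K, K] ((fun x => ((w x) ^+ 2)%:E) \+ cst 1%E)%E.
  apply: integrableD => //; first exact: integrableS I2.
  apply/integrableP; split => //.
  under eq_integral do rewrite /= normr1.
  rewrite integral_cst//= lebesgue_measure_itv/= mul1e.
  by case: ifP => //; rewrite -EFinB ltry.
apply: le_integrable I => //; first exact/measurable_EFinP/measurable_funTS.
move=> x _; rewrite -[X in (_ <= `|X|)%E]/((w x ^+ 2 + 1)%:E) lee_fin [leRHS]ger0_norm ?addr_ge0 ?sqr_ge0//.
have := sqr_ge0 (`|w x| - 1); rewrite -[w x ^+ 2]real_normK ?num_real//.
by have := normr_ge0 (w x); nra.
Qed.

Hypothesis uC : continuous_L2 u.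

Lemma Lnorm2_indic_lty (K : R) :
  ('N[leb]_2%:E[EFin \o (\1_(`[(- K)%R, K]) : R -> R)] < +oo)%E.
Proof.
rewrite unlock /Lnorm/= poweR_lty//.
rewrite (_ : integral _ _ _ = \int[leb]_x (\1_(`[(- K)%R, K]) x)%:E)%E; last first.
  apply: eq_integral => x _; rewrite indicE; case: (_ \in _) => /=.
    by rewrite normr1 powR1.
  by rewrite normr0 powR0// pnatr_eq0.
rewrite integral_indic// setIT/= lebesgue_measure_itv/=.
by case: ifP => // _; rewrite -EFinB ltry.
Qed.

(** Hoelder inequality against the indicator of [[-K, K]]. *)
Lemma L1_le_Lnorm2 (w : R -> R) K : measurable_fun setT w ->
  (\int[leb]_(x in `[(- K)%R, K]) `|(w x)%:E| <=
   'N[leb]_2%:E[EFin \o w] *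
   'N[leb]_2%:E[EFin \o (\1_(`[(- K)%R, K]) : R -> R)])%E.
Proof.
move=> mw.
have mI : measurable_fun setT (\1_(`[- K, K]) : R -> R) by exact: measurable_indic.
have := @hoelder _ _ R leb w (\1_(`[(- K)%R, K])) 2 2 mw mI.
move=> /(_ ltac:(lra) ltac:(lra) ltac:(lra)); apply: le_trans.
rewrite Lnorm1 [leLHS]integral_mkcond le_eqVlt; apply/orP; left; apply/eqP.
apply: eq_integral => x _ /=; rewrite indicE /patch.
by case: ifPn; rewrite ?mulr1// mulr0 normr0.
Qed.

Lemma Lnorm2_loc_int (w : R -> R) : measurable_fun setT w ->
  ('N[leb]_2%:E[EFin \o w] < +oo)%E -> loc_int w.
Proof.
move=> mw wlty; split=> // K; apply/integrableP; split.
  exact/measurable_EFinP/measurable_funTS.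
apply: le_lt_trans (L1_le_Lnorm2 _ mw) _.
by rewrite lte_mul_pinfty ?Lnorm_ge0 ?Lnorm2_indic_lty// ge0_fin_numE// Lnorm_ge0.
Qed.

Lemma L2_continuous_near (t e : R) : 0 <= t -> 0 < e -> exists2 d, 0 < d &
  forall s, 0 <= s -> `|t - s| < d ->
    ('N[leb]_2%:E[EFin \o (u s \- u t)%R] <= e%:E)%E.
Proof.
move=> t0 e0; have /fine_cvgP[fin cv] := uC t0.
have /cvgrPdist_lt/(_ _ e0) cv' := cv.
have : \forall s \near within `[0, +oo[ (nbhs t),
    ('N[leb]_2%:E[EFin \o (u s \- u t)%R] <= e%:E)%E.
  near=> s.
  have fs : ('N[leb]_2%:E[EFin \o (u s \- u t)%R])%E \is a fin_num by near: s.
  have : `|0 - fine ('N[leb]_2%:E[EFin \o (u s \- u t)%R])| < e by near: s.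
  rewrite sub0r normrN ger0_norm ?fine_ge0 ?Lnorm_ge0// => /ltW.
  by rewrite -lee_fin fineK.
rewrite near_withinE => /nbhs_ballP[d /= d0 H]; exists d => // s s0 ts.
by apply: (H s) => //=; rewrite in_itv/= s0.
Unshelve. all: by end_near. Qed.

(** The section [u s] is in [L^2] for almost every [s]. Given [t], take such an [s]
    close to [t]: then [u t - u s] is in [L^2] too. *)
Lemma section_loc_int t : 0 <= t -> loc_int (u t).
Proof.
move=> t0; have [d d0 H] := L2_continuous_near t0 ltr01.
have td : t < t + d by rewrite ltrDl.
have := L2loc_ae (_ : 0 < t + d); rewrite ltr_wpDl// => /(_ isT).
move=> /(ae_ex_itv td)[s /andP[ts std] Hs].
have s0 : 0 <= s by rewrite (le_trans t0)// ltW.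
have ls : loc_int (u s).
  apply: sqr_lty_loc_int; first exact: L2loc_section.
  by apply: Hs; rewrite s0 ltW.
have ld : loc_int (u s \- u t).
  apply: Lnorm2_loc_int.
    by apply: measurable_funB; exact: L2loc_section.
  apply: le_lt_trans (H s s0 _) (ltry _).
  by rewrite distrC gtr0_norm ?subr_gt0// ltrBlDl.
split=> [|K]; first exact: L2loc_section.
have -> : EFin \o u t = ((EFin \o u s) \- (EFin \o (u s \- u t)%R))%E.
  by apply/funext => x /=; rewrite -EFinB opprB addrC subrK.
by apply: integrableB => //; [exact: ls.2|exact: ld.2].
Qed.

Lemma section_L1_continuous t K e : 0 <= t -> 0 < e -> exists2 d, 0 < d &
  forall s, 0 <= s -> `|t - s| < d ->
    \int[leb]_(x in `[- K, K]) `|u s x - u t x| <= e.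
Proof.
move=> t0 e0.
have := @Lnorm2_indic_lty K.
set c := 'N[_]__[_]%E => clty.
have c0 : (0 <= c)%E by exact: Lnorm_ge0.
have cf : c \is a fin_num by rewrite ge0_fin_numE.
have fc : 0 <= fine c by rewrite fine_ge0.
have [|d d0 H] := @L2_continuous_near t (e / (fine c + 1)) t0.
  by rewrite divr_gt0// ltr_wpDl.
exists d => // s s0 ts; have {}H := H s s0 ts.
have mw : measurable_fun setT (u s \- u t).
  by apply: measurable_funB; exact: L2loc_section.
rewrite -lee_fin /Rintegral fineK; last first.
  rewrite ge0_fin_numE; last by apply: integral_ge0 => x _; rewrite lee_fin.
  apply: le_lt_trans (L1_le_Lnorm2 _ mw) _.
  rewrite -/c lte_mul_pinfty ?Lnorm_ge0// ge0_fin_numE ?Lnorm_ge0//.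
  by apply: le_lt_trans H (ltry _).
apply: le_trans (L1_le_Lnorm2 _ mw) _; rewrite -/c.
apply: (@le_trans _ _ ((e / (fine c + 1))%:E * c)%E); first exact: lee_wpmul2r.
rewrite -(fineK cf) -EFinM lee_fin mulrAC ler_pdivrMr ?ltr_wpDl//.
by rewrite ler_wpM2l ?ltW// ltrDl.
Qed.

Lemma L2_slab_integrable T K :
  leb2.-integrable (slab T K) (fun p => (u p.1 p.2)%:E).
Proof.
wlog T0 : T / 0 < T.
  move=> wT; apply: integrableS (wT (T + `|T| + 1) _); try exact: measurable_slab.
    move=> p [/= + ?]; rewrite !in_itv/= => /andP[p0 pT]; split => //=.
    by rewrite in_itv/= p0/= (le_trans pT)// -addrA lerDl addr_ge0.
  by rewrite ltr_wpDl// -lerBlDl sub0r -normrN ler_norm.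
have mu_ : measurable_fun (slab T K) (fun p => u p.1 p.2).
  apply: measurable_funS uL2.1; first exact: measurableX.
  by move=> p [/= + _]; rewrite !in_itv/= => /andP[-> _].
have I2 : leb2.-integrable (slab T K) (fun p => ((u p.1 p.2) ^+ 2)%:E).
  apply/integrableP; split; first exact/measurable_EFinP/measurable_funX.
  under eq_integral do rewrite gee0_abs ?lee_fin ?sqr_ge0//.
  apply: le_lt_trans (uL2.2 _ T0).
  apply: ge0_subset_integral => //.
  - exact: measurable_slab.
  - exact: measurableX.
  - apply/measurable_EFinP/measurable_funX; apply: measurable_funS uL2.1; first exact: measurableX.
    by move=> p [/= + _]; rewrite !in_itv/= => /andP[-> _].
  - by move=> p _; rewrite lee_fin sqr_ge0.
  - by move=> p [].
have I : leb2.-integrable (slab T K) ((fun p => ((u p.1 p.2) ^+ 2)%:E) \+ cst 1%E)%E.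
  apply: integrableD => //; first exact: measurable_slab.
  apply/integrableP; split => //.
  under eq_integral do rewrite /= normr1.
  rewrite integral_cst//=; last exact: measurable_slab.
  by rewrite mul1e; exact: slab_lty.
apply: le_integrable I => //; [exact: measurable_slab|exact/measurable_EFinP|].
move=> p _; rewrite -[X in (_ <= `|X|)%E]/((u p.1 p.2 ^+ 2 + 1)%:E) lee_fin [leRHS]ger0_norm ?addr_ge0 ?sqr_ge0//.
have := sqr_ge0 (`|u p.1 p.2| - 1); rewrite -[u p.1 p.2 ^+ 2]real_normK ?num_real//.
by have := normr_ge0 (u p.1 p.2); nra.
Qed.

(** Makes [u] measurable on the whole plane, negative times included. *)
Definition extend0 (g : R -> R -> R) (t x : R) : R := if 0 <= t then g t x else 0.

Lemma extend0_slab_int : slab_int (extend0 u).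
Proof.
split.
- apply: measurable_fun_if => //.
  + by apply: measurable_fun_ler => //; exact: measurable_fst.
  + rewrite setTI; apply: measurable_funS uL2.1; first exact: measurableX.
    by move=> p /= p0; split => //=; rewrite in_itv/= p0.
- move=> t; rewrite /extend0; have [t0|t0] := leP 0 t.
    exact: section_loc_int.
  split=> [|K]; first exact: measurable_cst.
  exact: integrable0.
- move=> T K; apply: eq_integrable (L2_slab_integrable T K); first exact: measurable_slab.
  by move=> p; rewrite inE/= => -[/=]; rewrite in_itv/= /extend0 => /andP[-> _].
Qed.

End L2_regularity.
(** * Almost everywhere statements and limits of integrals *)

Section dominated.
Context d (T : measurableType d) (R : realType) (m : {measure set T -> \bar R}).

Lemma ae_mono (P Q : T -> Prop) : {ae m, forall x, P x} ->
  (forall x, P x -> Q x) -> {ae m, forall x, Q x}.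
Proof. by move=> aeP PQ; apply: filterS aeP => x; exact: PQ. Qed.

Lemma ae_and (P Q : T -> Prop) : {ae m, forall x, P x} ->
  {ae m, forall x, Q x} -> {ae m, forall x, P x /\ Q x}.
Proof. by move=> aeP aeQ; apply: filterS2 aeP aeQ => x. Qed.

Lemma Rdominated (D : set T) (f_ : nat -> T -> R) (f g : T -> R) :
  measurable D -> (forall n, measurable_fun D (f_ n)) -> measurable_fun D f ->
  {ae m, forall x, D x -> f_ n x @[n --> \oo] --> f x} ->
  m.-integrable D (EFin \o g) ->
  {ae m, forall x, forall n, D x -> `|f_ n x| <= g x} ->
  \int[m]_(x in D) f_ n x @[n --> \oo] --> \int[m]_(x in D) f x.
Proof.
move=> mD mf_ mf cv ig dom.
have [] := @dominated_convergence _ _ _ m D mD (fun n => EFin \o f_ n) (EFin \o f) (EFin \o g).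
- by move=> n; apply/measurable_EFinP.
- exact/measurable_EFinP.
- apply: filterS cv => x cv Dx; apply/fine_cvgP; split; first exact: nearW.
  exact: cv.
- exact: ig.
- by apply: filterS dom => x dom n Dx /=; rewrite lee_fin dom.
move=> If _ cvf; rewrite /Rintegral.
apply: fine_cvg; rewrite fineK; first exact: cvf.
exact: integrable_fin_num.
Qed.

Lemma Rintegral_sum (I : Type) (s : seq I) (D : set T) (f : I -> T -> R) :
  measurable D -> (forall i, m.-integrable D (EFin \o f i)) ->
  m.-integrable D (EFin \o (fun x => \sum_(i <- s) f i x)) /\
  \int[m]_(x in D) (\sum_(i <- s) f i x) = \sum_(i <- s) \int[m]_(x in D) f i x.
Proof.
move=> mD fi; elim: s => [|i s [IH1 IH2]].
  rewrite (_ : (fun x => _) = cst 0); last by apply/funext => x; rewrite big_nil.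
  rewrite big_nil (_ : EFin \o cst 0 = cst 0%E)//; split; first exact: integrable0.
  by rewrite Rintegral_cst// mul0r.
have -> : (fun x => \sum_(j <- i :: s) f j x) =
    (fun x => f i x + \sum_(j <- s) f j x).
  by apply/funext => x; rewrite big_cons.
split; first exact: (integrableD _ (fi i) IH1).
by rewrite big_cons RintegralD// IH2.
Qed.

End dominated.
(** * Rescaled profiles as approximate identities *)

Section approximate_identity.
Context {R : realType}.
Implicit Types (w f phi : R -> R) (a b h K M C : R).

Lemma loc_int_cst C : loc_int (cst C : R -> R).
Proof.
split=> // K; apply/integrableP; split; first exact/measurable_EFinP.
under eq_integral do rewrite /=.
by rewrite integral_cst//= lebesgue_measure_itv/=; case: ifP => _; rewrite -?EFinB -?EFinM ?mule0 ltry.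
Qed.

Definition mass phi := pair (cst 1) phi.

Lemma pair_cst C phi M K : weight M K phi -> pair (cst C) phi = C * mass phi.
Proof.
move=> wp; rewrite -(pairZr _ (loc_int_cst 1) wp) /pair.
by apply: eq_Rintegral => x _ /=; rewrite mul1r.
Qed.

(** Only the values of [w] where the weight is positive matter. *)
Lemma pair_le_ae w phi C (a b M K : R) : loc_int w -> weight M K phi ->
  (forall x, 0 <= phi x) -> (forall x, ~~ (a < x < b) -> phi x = 0) ->
  {ae leb, forall x, a < x < b -> w x <= C} ->
  pair w phi <= C * mass phi.
Proof.
move=> lw wp p0 pout wC; rewrite -(pair_cst C wp) -subr_ge0.
have I1 := pair_integrable (loc_int_cst C) wp; have I2 := pair_integrable lw wp.
rewrite /pair -RintegralB//.
have -> : \int[leb]_x (cst C x * phi x - w x * phi x) =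
    \int[leb]_x `|cst C x * phi x - w x * phi x|.
  have mI : measurable_fun setT (fun x => cst C x * phi x - w x * phi x).
    apply: measurable_funB; apply: measurable_funM => //; first by case: wp.
      by case: lw.
    by case: wp.
  congr fine; apply: ae_eq_integral => //.
  - exact/measurable_EFinP.
  - by apply/measurable_EFinP; apply: measurableT_comp.
  apply: (ae_mono wC) => x {}wC _; congr (_%:E); rewrite ger0_norm// -mulrBl.
  have [xab|/pout->] := boolP (a < x < b); last by rewrite mulr0.
  by rewrite mulr_ge0// subr_ge0 wC.
by apply: Rintegral_ge0.
Qed.

Lemma pair_ge_ae w phi C (a b M K : R) : loc_int w -> weight M K phi ->
  (forall x, 0 <= phi x) -> (forall x, ~~ (a < x < b) -> phi x = 0) ->
  {ae leb, forall x, a < x < b -> C <= w x} ->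
  C * mass phi <= pair w phi.
Proof.
move=> lw wp p0 pout wC; rewrite -(pair_cst C wp) -subr_ge0.
have I1 := pair_integrable (loc_int_cst C) wp; have I2 := pair_integrable lw wp.
rewrite /pair -RintegralB//.
have -> : \int[leb]_x (w x * phi x - cst C x * phi x) =
    \int[leb]_x `|w x * phi x - cst C x * phi x|.
  have mI : measurable_fun setT (fun x => w x * phi x - cst C x * phi x).
    apply: measurable_funB; apply: measurable_funM => //; try by case: wp.
    by case: lw.
  congr fine; apply: ae_eq_integral => //.
  - exact/measurable_EFinP.
  - by apply/measurable_EFinP; apply: measurableT_comp.
  apply: (ae_mono wC) => x {}wC _; congr (_%:E); rewrite ger0_norm// -mulrBl.
  have [xab|/pout->] := boolP (a < x < b); last by rewrite mulr0.
  by rewrite mulr_ge0// subr_ge0 wC.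
by apply: Rintegral_ge0.
Qed.

Lemma mass_antiderivative (Phi phi : R -> R) M K : 0 < K -> continuous phi ->
  weight M K phi -> (forall x : R, is_derive x 1 Phi (phi x)) ->
  mass phi = Phi K - Phi (- K).
Proof.
move=> K0 cphi wp dPhi; rewrite /mass (pair_itv _ wp) /Rintegral.
have NKK : - K < K by rewrite gtrN.
have cPhi : continuous Phi.
  move=> x; apply/differentiable_continuous/derivable1_diffP.
  exact: (@ex_derive _ _ _ _ _ _ _ (dPhi x)).
under eq_integral do rewrite mul1r.
rewrite (continuous_FTC2 NKK (F := Phi)) //.
- exact: continuous_subspaceT.
- split.
  + by move=> x _; exact: (@ex_derive _ _ _ _ _ _ _ (dPhi x)).
  + exact/cvg_at_right_filter/cPhi.
  + exact/cvg_at_left_filter/cPhi.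
- by move=> x _; rewrite derive1E derive_val.
Qed.

Definition rescale f h a x := f ((x - a) / h).

Lemma is_derive_rescale f df h a (x : R) : is_derive ((x - a) / h) 1 f df ->
  is_derive x 1 (rescale f h a) (h^-1 * df).
Proof.
move=> fdf.
have := @is_derive_affine R f 1 h^-1 (- (a / h)) df x.
rewrite mul1r [h^-1 * x]mulrC -mulNr -mulrDl => /(_ fdf).
by apply: near_eq_is_derive; near=> y; rewrite mul1r [h^-1 * y]mulrC -mulrDl.
Unshelve. all: by end_near. Qed.

Lemma smooth_rescale f h a : smooth f -> smooth (rescale f h a).
Proof.
move=> /(@smooth_affine _ f 1 h^-1 (- (a / h))).
rewrite (_ : (fun x => _) = rescale f h a)//.
by apply/funext => x; rewrite mul1r mulrC -mulNr -mulrDl.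
Qed.

Lemma smoothZ f (c : R) : smooth f -> smooth (fun x => c * f x).
Proof.
move=> /(@smooth_affine _ f c 1 0).
rewrite (_ : (fun x => _) = (fun x => c * f x))//.
by apply/funext => x; rewrite mul1r addr0.
Qed.

Lemma rescale_out f h a (p q x : R) : 0 < h -> (forall y, ~~ (p < y < q) -> f y = 0) ->
  ~~ (a + p * h < x < a + q * h) -> rescale f h a x = 0.
Proof.
move=> h0 f0 xN; apply: f0; apply: contraNN xN.
by rewrite ltr_pdivlMr// ltr_pdivrMr// ltrBrDl ltrBlDl.
Qed.

(** Unit mass, supported in [[a, a + h]]: pairing with it is a local mean to the
    right of [a]. *)
Definition moll h a x := h^-1 * rescale mollifier h a x.

(** Unit mass, supported in [[a, a + 2 h]]: the mean of [moll h] over the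
    translations from [a] to [a + h]. *)
Definition win h a x := h^-1 * rescale window h a x.

Lemma moll_out h a x : 0 < h -> ~~ (a < x < a + h) -> moll h a x = 0.
Proof.
move=> h0 xN; rewrite /moll (@rescale_out _ h a 0 1) ?mulr0 ?mul0r ?addr0 ?mul1r//.
exact: mollifier_out.
Qed.

Lemma win_out h a x : 0 < h -> ~~ (a < x < a + 2 * h) -> win h a x = 0.
Proof.
move=> h0 xN; rewrite /win (@rescale_out _ h a 0 2) ?mulr0 ?mul0r ?addr0//.
exact: window_out.
Qed.

Lemma moll_ge0 h a x : 0 < h -> 0 <= moll h a x.
Proof. by move=> h0; rewrite mulr_ge0 ?mollifier_ge0// invr_ge0 ltW. Qed.

Lemma win_ge0 h a x : 0 < h -> 0 <= win h a x.
Proof. by move=> h0; rewrite mulr_ge0 ?window_ge0// invr_ge0 ltW. Qed.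

Lemma smooth_moll h a : smooth (moll h a).
Proof. exact/smoothZ/smooth_rescale/smooth_mollifier. Qed.

Lemma smooth_win h a : smooth (win h a).
Proof. exact/smoothZ/smooth_rescale/smooth_window. Qed.

Lemma itv_out_norm (a b K x : R) : `|a| <= K -> `|b| <= K -> K < `|x| -> ~~ (a < x < b).
Proof.
rewrite !ler_norml ltNge ler_norml => /andP[aK _] /andP[_ bK]; apply: contraNN.
by move=> /andP[ax xb]; rewrite (le_trans aK (ltW ax)) (le_trans (ltW xb) bK).
Qed.

Lemma moll_weight h a : 0 < h -> exists M,
  weight M (`|a| + h) (moll h a).
Proof.
move=> h0; apply: continuous_weight; first exact/smooth_continuous/smooth_moll.
move=> x xK; apply: moll_out => //; apply: itv_out_norm xK.
  by rewrite lerDl ltW.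
by rewrite (le_trans (ler_normD _ _))// (gtr0_norm h0).
Qed.

Lemma win_weight h a : 0 < h -> exists M,
  weight M (`|a| + 2 * h) (win h a).
Proof.
move=> h0; apply: continuous_weight; first exact/smooth_continuous/smooth_win.
have h20 : 0 < 2 * h by rewrite mulr_gt0.
move=> x xK; apply: win_out => //; apply: itv_out_norm xK.
  by rewrite lerDl ltW.
by rewrite (le_trans (ler_normD _ _))// (gtr0_norm h20).
Qed.

Lemma is_derive_step h a (x : R) : is_derive x 1 (rescale smooth_step h a) (moll h a x).
Proof. exact/is_derive_rescale/is_derive_smooth_step. Qed.

Lemma mass_moll h a : 0 < h -> mass (moll h a) = 1.
Proof.
move=> h0; have [M wM] := moll_weight a h0.
have K0 : 0 < `|a| + h by rewrite ltr_wpDl.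
rewrite (mass_antiderivative K0 _ wM (is_derive_step h a)); last exact/smooth_continuous/smooth_moll.
have /andP[a1 a2] : - `|a| <= a <= `|a| by rewrite -ler_norml.
rewrite /rescale smooth_step_ge1; last first.
  by rewrite ler_pdivlMr// mul1r; lra.
rewrite smooth_step_le0 ?subr0// pmulr_lle0 ?invr_gt0//; lra.
Qed.

Lemma mass_win h a : 0 < h -> mass (win h a) = 1.
Proof.
move=> h0; have [M wM] := win_weight a h0.
have K0 : 0 < `|a| + 2 * h by rewrite ltr_wpDl// mulr_gt0.
have D (x : R) : is_derive x 1 (rescale wide_step h (a + h)) (win h a x).
  rewrite /win /rescale (_ : (x - a) / h = (x - (a + h)) / h + 1); last first.
    by field; rewrite gt_eqF.
  exact/is_derive_rescale/is_derive_wide_step.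
rewrite (mass_antiderivative K0 _ wM D); last exact/smooth_continuous/smooth_win.
have /andP[a1 a2] : - `|a| <= a <= `|a| by rewrite -ler_norml.
rewrite /rescale wide_step_ge1; last first.
  by rewrite ler_pdivlMr// mul1r; lra.
rewrite wide_step_leN1 ?subr0// ler_pdivrMr// mulN1r; lra.
Qed.

(** This identity turns the equation [u_t = z_x], tested against a window, into a
    finite difference of the flux. *)
Lemma is_derive_win h a (x : R) :
  is_derive x 1 (win h a) (h^-1 * (moll h a x - moll h (a + h) x)).
Proof.
have [->|h0] := eqVneq h 0.
  rewrite invr0 mul0r (_ : win 0 a = cst 0); first exact: is_derive_cst.
  by apply/funext => y; rewrite /win invr0 mul0r.
have -> : h^-1 * (moll h a x - moll h (a + h) x) =
    h^-1 *: (h^-1 * (mollifier ((x - a) / h) - mollifier ((x - a) / h - 1))).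
  rewrite /GRing.scale/= -mulrBr; congr (_ * (_ * (_ - mollifier _))).
  by field.
exact/is_deriveZ/is_derive_rescale/is_derive_window.
Qed.

(** This identity turns a jump between neighbouring window means into an integral
    of a hat against the distributional derivative. *)
Lemma is_derive_rescale_hat h a (x : R) : h != 0 ->
  is_derive x 1 (rescale hat h a) (win h (a - h) x - win h a x).
Proof.
move=> h0.
have -> : win h (a - h) x - win h a x =
    h^-1 * (window ((x - a) / h + 1) - window ((x - a) / h)).
  rewrite /win -mulrBr; congr (_ * (window _ - _)).
  by field.
exact/is_derive_rescale/is_derive_hat.
Qed.

(** A mean of [w] is as close to [c] as the values of [w]. *)
Lemma pair_near w phi c e (a b M K : R) : loc_int w -> weight M K phi ->
  (forall x, 0 <= phi x) -> (forall x, ~~ (a < x < b) -> phi x = 0) ->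
  mass phi = 1 ->
  (forall x, a < x < b -> `|w x - c| <= e) -> `|pair w phi - c| <= e.
Proof.
move=> lw wp p0 pout m1 wC; rewrite ler_distl; apply/andP; split.
  rewrite -[leLHS]mulr1 -m1; apply: pair_ge_ae wp _ _ _ => //; first exact: pout.
  by apply: aeW => x /wC; rewrite ler_distl => /andP[].
rewrite -[leRHS]mulr1 -m1; apply: pair_le_ae wp _ _ _ => //; first exact: pout.
by apply: aeW => x /wC; rewrite ler_distl => /andP[].
Qed.

(** The mollifier at [s] looks only to the right of [s]. *)
Lemma pair_moll_cvg w s (e : R) : loc_int w -> 0 < e ->
  w x @[x --> s^'+] --> w s ->
  exists2 d, 0 < d & forall h, 0 < h -> h < d -> `|pair w (moll h s) - w s| <= e.
Proof.
move=> lw e0 /cvgrPdist_le/(_ _ e0) [d /= d0 H].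
exists d => // h h0 hd; have [M wM] := moll_weight s h0.
apply: (pair_near lw wM _ _ (mass_moll s h0)).
- by move=> x; exact: moll_ge0.
- by move=> x; exact: moll_out.
- move=> x /andP[sx xsh]; rewrite distrC; apply: H => //=.
  by rewrite distrC gtr0_norm ?subr_gt0// ltrBlDl (lt_trans xsh)// ltrD2l.
Qed.

End approximate_identity.

(** * The equation integrated in time *)

Lemma Rintegral_itv_cat {R : realType} (f : R -> R) (a b c : R) :
  leb.-integrable `[a, c] (EFin \o f) -> a <= b -> b <= c ->
  \int[leb]_(r in `[a, c]) f r =
  \int[leb]_(r in `[a, b]) f r + \int[leb]_(r in `[b, c]) f r.
Proof.
move=> I1; rewrite le_eqVlt => /predU1P[<-|ab] bc.
  by rewrite set_itv1 Rintegral_set1 add0r.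
have I2 : leb.-integrable `]b, c] (EFin \o f).
  by apply: integrableS I1 => //; apply: subset_itv; rewrite bnd_simp// ltW.
have := @Rintegral_itvB _ f (BLeft a) (BRight c) b I1.
rewrite !bnd_simp (ltW ab) => /(_ isT bc); rewrite (Rintegral_itv_obnd_cbnd I2) => <-.
by rewrite addrC subrK.
Qed.

Section time_identity.
Context {R : realType}.
Implicit Types (xi eta : R -> R) (s t T K M h : R).

Lemma bounded_slab_int (Z : R -> R -> R) : measurable2 Z ->
  (forall t x, `|Z t x| <= 1) -> slab_int Z.
Proof.
move=> mZ Z1; split=> //.
- move=> t; split; first exact: measurable2_section.
  move=> K; apply: (le_integrable _ _ _ ((loc_int_cst 1).2 K)) => //.
    by apply/measurable_EFinP/measurable_funTS; exact: measurable2_section.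
  by move=> x _; rewrite lee_fin normr1.
- move=> T K; have mS := measurable_slab T K.
  have I1 : leb2.-integrable (slab T K) (EFin \o (cst 1 : R * R -> R)).
    apply/integrableP; split; first exact/measurable_EFinP.
    under eq_integral do rewrite /= normr1.
    by rewrite integral_cst// mul1e; exact: slab_lty.
  apply: (le_integrable _ _ _ I1) => //.
    by apply/measurable_EFinP/measurable_funTS.
  by move=> p _; rewrite lee_fin normr1.
Qed.

Lemma slab_pair_integrable (g : R -> R -> R) xi T K M : slab_int g -> weight M K xi ->
  leb.-integrable setT (fun t => (\1_(`[0%R, T]) t * pair (g t) xi)%:E).
Proof.
move=> sg wx.
have mI : measurable_fun setT (\1_(`[0, T]) : R -> R) by exact: measurable_indic.
apply: (slab_fubini (T := T) (N := 1) sg mI _ _ wx).1 => [t|t tT].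
- by rewrite indicE; case: (_ \in _); rewrite ?normr1 ?normr0.
- by rewrite indicE memNset//= in_itv/=; exact/negP.
Qed.

Lemma slab_pair_loc_int (g : R -> R -> R) xi T K M : slab_int g -> weight M K xi ->
  loc_int (fun t => \1_(`[0%R, T]) t * pair (g t) xi).
Proof.
move=> sg wx; have I := slab_pair_integrable T sg wx; split.
  by apply/measurable_EFinP; exact: measurable_int I.
by move=> K'; exact: integrableS I.
Qed.

Lemma slab_pair_integrable_itv (g : R -> R -> R) xi a b K M : slab_int g -> weight M K xi ->
  0 <= a -> leb.-integrable `[a, b] (fun t => (pair (g t) xi)%:E).
Proof.
move=> sg wx a0; have I := slab_pair_integrable b sg wx.
have : leb.-integrable `[a, b] (fun t => (\1_(`[0%R, b]) t * pair (g t) xi)%:E).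
  exact: integrableS I.
apply: eq_integrable => // t; rewrite inE/= in_itv/= => /andP[ta tb].
by rewrite indicE mem_set ?mul1r//= in_itv/= (le_trans a0 ta).
Qed.

Lemma pair_bounded (w xi : R -> R) M K : loc_int w -> (forall x, `|w x| <= 1) -> weight M K xi ->
  `|pair w xi| <= M * \int[leb]_(x in `[- K, K]) (cst 1 x).
Proof.
move=> lw w1 wx.
have := pair_diff_le lw (loc_int_cst 0) wx.
rewrite (pair_cst 0 wx) mul0r subr0 => /le_trans; apply.
rewrite ler_wpM2l ?(weight_ge0 wx)//.
have I1 := (loc_int_cst 1).2 K.
apply: le_Rintegral => //; last by move=> x _; rewrite subr0.
have -> : (EFin \o (fun x => `|w x - cst 0 x|)) = (EFin \o (fun x => `|w x|)).
  by apply/funext => x /=; rewrite subr0.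
exact: integrable_norm (lw.2 K).
Qed.

Variables (u Z : R -> R -> R).
Hypothesis su : slab_int u.
Hypothesis uC : forall t K e, 0 <= t -> 0 < e -> exists2 d, 0 < d &
  forall s, 0 <= s -> `|t - s| < d ->
    \int[leb]_(x in `[- K, K]) `|u s x - u t x| <= e.
Hypothesis mZ : measurable2 Z.
Hypothesis Z1 : forall t x, `|Z t x| <= 1.
Hypothesis weak : forall eta xi s T K, smooth eta -> smooth xi -> 0 < s ->
  (forall t, ~~ (s <= t <= T) -> eta t = 0) -> (forall x, K < `|x| -> xi x = 0) ->
  \int[leb]_t (derive1 eta t * pair (u t) xi) =
  \int[leb]_t (eta t * pair (Z t) (derive1 xi)).

Lemma pair_continuous xi M K t e : weight M K xi -> 0 <= t -> 0 < e ->
  exists2 d, 0 < d & forall s, 0 <= s -> `|t - s| < d ->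
    `|pair (u s) xi - pair (u t) xi| <= e.
Proof.
move=> wx t0 e0; have M0 := weight_ge0 wx.
have [|d d0 H] := @uC t K (e / (M + 1)) t0; first by rewrite divr_gt0// ltr_wpDl.
exists d => // s s0 ts; have [_ lu _] := su.
rewrite (le_trans (pair_diff_le (lu s) (lu t) wx))//.
apply: (@le_trans _ _ (M * (e / (M + 1)))); first by rewrite ler_wpM2l// H.
by rewrite mulrA ler_pdivrMr ?ltr_wpDl// mulrC ler_wpM2l ?ltW// ltrDl.
Qed.

Lemma weight_derive1 xi K : smooth xi -> (forall x, K < `|x| -> xi x = 0) ->
  exists M, weight M K (derive1 xi).
Proof.
move=> sx x0; apply: continuous_weight; first exact/smooth_continuous/smooth_derive1.
move=> x xK; apply: (@derive1_out _ xi (- K) K).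
  by move=> y; rewrite -ler_norml -ltNge => /x0.
by rewrite -ler_norml -ltNge.
Qed.

Let inv_succ (n : nat) : R := n.+1%:R^-1.

Let inv_succ_gt0 n : 0 < inv_succ n. Proof. by rewrite invr_gt0 ltr0n. Qed.

Let inv_succ_le1 n : inv_succ n <= 1. Proof. by rewrite invf_le1 ?ltr0n// ler1n. Qed.

Let inv_succ_cvg0 (d : R) : 0 < d -> \forall n \near \oo, inv_succ n < d.
Proof. by move=> d0; near=> n; near: n; exact: near_infty_natSinv_lt (PosNum d0). Unshelve. all: by end_near. Qed.

Lemma moll_time_cvg xi M K s T : weight M K xi -> 0 <= s -> s + 1 <= T ->
  pair (fun t => \1_(`[0%R, T]) t * pair (u t) xi) (moll (inv_succ n) s) @[n --> \oo]
  --> pair (u s) xi.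
Proof.
move=> wx s0 sT; set w := fun t => _ * _.
have lw : loc_int w by exact: slab_pair_loc_int wx.
have wE t : 0 <= t <= T -> w t = pair (u t) xi.
  by move=> tT; rewrite /w indicE mem_set ?mul1r//= in_itv/=.
have ws : w s = pair (u s) xi by rewrite wE// s0 (le_trans _ sT)// lerDl.
apply/cvgrPdist_le => e e0.
have rc : w x @[x --> s^'+] --> w s.
  apply/cvgrPdist_le => {}e {}e0.
  have [d d0 H] := pair_continuous wx s0 e0.
  near=> x.
  have sx : s < x by [].
  have xs1 : x < s + 1 by near: x; apply: nbhs_right_lt; rewrite ltrDl.
  have xsd : x < s + d by near: x; apply: nbhs_right_lt; rewrite ltrDl.
  have x0 : 0 <= x by rewrite (le_trans s0)// ltW.
  rewrite ws wE; last by rewrite x0 (le_trans (ltW xs1)).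
  by rewrite distrC H// distrC gtr0_norm ?subr_gt0// ltrBlDl.
have [d d0 H] := pair_moll_cvg lw e0 rc.
near=> n; rewrite -ws distrC; apply: H; first exact: inv_succ_gt0.
by near: n; exact: inv_succ_cvg0.
Unshelve. all: by end_near. Qed.

(** The smooth steps converge to the indicator of [(s, +oo)], at [s] included, as
    they vanish at [s]. *)
Lemma step_cvg s t : rescale smooth_step (inv_succ n) s t @[n --> \oo] --> ((s < t)%R%:R : R).
Proof.
have [st|ts] := ltP s t; last first.
  rewrite (_ : (fun n => _) = cst 0); first exact: cvg_cst.
  apply/funext => n; rewrite /rescale smooth_step_le0// pmulr_lle0 ?invr_gt0 ?inv_succ_gt0//.
  by rewrite subr_le0.
apply: cvg_near_cst; near=> n; rewrite /rescale smooth_step_ge1//.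
rewrite ler_pdivlMr ?inv_succ_gt0// mul1r ltW//.
by near: n; apply: inv_succ_cvg0; rewrite subr_gt0.
Unshelve. all: by end_near. Qed.

(** Test with a smoothed indicator of [[s, t]] in time. Its derivative is a
    difference of mollifiers at [s] and at [t], for which continuity in time
    gives the limit; on the other side dominated convergence applies. *)
Lemma time_identity_pos xi K s t : smooth xi -> (forall x, K < `|x| -> xi x = 0) ->
  0 < s -> s <= t ->
  pair (u s) xi - pair (u t) xi = \int[leb]_(r in `[s, t]) pair (Z r) (derive1 xi).
Proof.
move=> sx x0 s0 st; have [M wx] := continuous_weight (smooth_continuous sx) x0.
have [M' wx'] := weight_derive1 sx x0.
have t0 : 0 <= t by rewrite (le_trans _ st)// ltW.
pose T := t + 1.
pose w r := \1_(`[0%R, T]) r * pair (u r) xi.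
pose q r := pair (Z r) (derive1 xi).
have sZ := bounded_slab_int mZ Z1.
have lw : loc_int w by exact: slab_pair_loc_int wx.
pose eta n := fun r => rescale smooth_step (inv_succ n) s r - rescale smooth_step (inv_succ n) t r.
have deta n : derive1 (eta n) = fun r => moll (inv_succ n) s r - moll (inv_succ n) t r.
  apply: is_derive1_funE => r; apply: is_deriveB; exact: is_derive_step.
have eta0 n r : ~~ (s <= r <= T) -> eta n r = 0.
  rewrite negb_and -!ltNge /eta /rescale => /orP[rs|Tr].
    rewrite !smooth_step_le0 ?subrr// pmulr_lle0 ?invr_gt0 ?inv_succ_gt0//.
      by rewrite subr_le0 ltW// (lt_le_trans rs).
    by rewrite subr_le0 ltW.
  rewrite !smooth_step_ge1 ?subrr// ler_pdivlMr ?inv_succ_gt0// mul1r (le_trans (inv_succ_le1 n))//.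
    by rewrite lerBrDr addrC (le_trans _ (ltW Tr)).
  by rewrite lerBrDr addrC (le_trans _ (ltW Tr))// /T lerD2r.
have L : \int[leb]_r (derive1 (eta n) r * pair (u r) xi) @[n --> \oo] -->
    pair (u s) xi - pair (u t) xi.
  have -> : (fun n => \int[leb]_r (derive1 (eta n) r * pair (u r) xi)) =
      (fun n => pair w (moll (inv_succ n) s) - pair w (moll (inv_succ n) t)).
    apply/funext => n.
    have [Ms ws] := moll_weight s (inv_succ_gt0 n).
    have [Mt wt] := moll_weight t (inv_succ_gt0 n).
    rewrite -(pairBr lw ws wt) deta; apply: eq_Rintegral => r _.
    have [rT|rT] := boolP (0 <= r <= T).
      by rewrite /w indicE mem_set ?mul1r 1?mulrC//= in_itv/=.
    rewrite !moll_out ?subrr ?mulr0 ?mul0r ?inv_succ_gt0//; apply: contraNN rT => /andP[r1 r2].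
      rewrite (le_trans t0 (ltW r1)) (le_trans (ltW r2))//.
      by rewrite lerD2l.
    rewrite (le_trans (ltW s0) (ltW r1)) (le_trans (ltW r2))//.
    by rewrite lerD.
  apply: cvgB; apply: moll_time_cvg wx _ _ => //; first exact: ltW.
  by rewrite lerD2r.
have Rr : \int[leb]_r (eta n r * q r) @[n --> \oo] --> \int[leb]_(r in `[s, t]) q r.
  have mT : measurable (`[0, T] : set R) by [].
  have Iq : leb.-integrable `[0, T] (EFin \o q).
    exact: slab_pair_integrable_itv sZ wx' (lexx 0).
  have mq : measurable_fun `[0, T] q by apply/measurable_EFinP; exact: measurable_int Iq.
  have -> : (fun n => \int[leb]_r (eta n r * q r)) =
      (fun n => \int[leb]_(r in `[0, T]) (eta n r * q r)).
    apply/funext => n; rewrite [RHS]Rintegral_mkcond; apply: eq_Rintegral => r _.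
    rewrite /patch; case: ifPn => //; rewrite notin_setE/= in_itv/= => /negP rT.
    rewrite eta0 ?mul0r//; apply: contraNN rT => /andP[r1 ->].
    by rewrite (le_trans (ltW s0)).
  have -> : \int[leb]_(r in `[s, t]) q r =
      \int[leb]_(r in `[0, T]) (((s < r)%R%:R - (t < r)%R%:R : R) * q r).
    have mq' : leb.-integrable `]s, t] (EFin \o q).
      apply: integrableS Iq => //; apply: subset_itv; rewrite bnd_simp ?ltW//.
      by rewrite ltrDl.
    rewrite -(Rintegral_itv_obnd_cbnd mq').
    rewrite Rintegral_mkcond [RHS]Rintegral_mkcond; apply: eq_Rintegral => r _.
    rewrite /patch !mem_setE !in_itv/=.
    have [sr|rs] := ltP s r; have [tr|rt] := ltP t r => /=.
    - by rewrite subrr mul0r; case: ifP.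
    - by rewrite (le_trans (ltW s0) (ltW sr)) (le_trans rt) ?lerDl//= subr0 mul1r.
    - by have := lt_le_trans (le_lt_trans st tr) rs; rewrite ltxx.
    - by rewrite subrr mul0r; case: ifP.
  apply: (@Rdominated _ _ R leb `[0, T] (fun n r => eta n r * q r)
    (fun r => ((s < r)%R%:R - (t < r)%R%:R : R) * q r) (fun r => `|q r|)).
  - exact: mT.
  - move=> n; apply: measurable_funM => //; apply: measurable_funTS.
    by apply: measurable_funB; apply: continuous_measurable_fun;
      exact/smooth_continuous/smooth_rescale/smooth_smooth_step.
  - apply: measurable_funM => //; apply: measurable_funTS.
    apply: measurable_funB; apply: (@measurableT_comp _ _ _ _ _ _ (fun b : bool => b%:R : R));
      by [|apply: measurable_fun_ltr].
  - apply: aeW => r _; apply: cvgMl; first by apply: cvgB; exact: step_cvg.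
  - exact: integrable_norm.
  - apply: aeW => r n _; rewrite normrM ler_piMl// /eta.
    have /andP[a0 a1] := smooth_step01 ((r - s) / inv_succ n).
    have /andP[b0 b1] := smooth_step01 ((r - t) / inv_succ n).
    by rewrite ler_norml /rescale; lra.
have E : (fun n => \int[leb]_r (derive1 (eta n) r * pair (u r) xi)) =
    (fun n => \int[leb]_r (eta n r * q r)).
  apply/funext => n; apply: weak sx s0 (eta0 n) x0.
  by apply: smoothB; exact/smooth_rescale/smooth_smooth_step.
rewrite E in L.
by rewrite -(cvg_lim (@Rhausdorff R) L) (cvg_lim (@Rhausdorff R) Rr).
Qed.

(** The case [s = 0] is the limit of positive initial times, as both sides are
    continuous in [s]. *)
Lemma time_identity xi K s t : smooth xi -> (forall x, K < `|x| -> xi x = 0) ->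
  0 <= s -> s <= t ->
  pair (u s) xi - pair (u t) xi = \int[leb]_(r in `[s, t]) pair (Z r) (derive1 xi).
Proof.
move=> sx x0; rewrite le_eqVlt => /predU1P[<-|]; last exact: (time_identity_pos sx x0).
rewrite le_eqVlt => /predU1P[<-|t0]; first by rewrite subrr set_itv1 Rintegral_set1.
have [M wx] := continuous_weight (smooth_continuous sx) x0.
have [M' wx'] := weight_derive1 sx x0.
pose q r := pair (Z r) (derive1 xi).
have sZ := bounded_slab_int mZ Z1.
pose B := M' * \int[leb]_(x in `[- K, K]) (cst 1 x).
have qB r : `|q r| <= B by apply: pair_bounded => //; case: sZ.
have B0 : 0 <= B by exact: le_trans (qB 0).
have Iq a b : 0 <= a -> leb.-integrable `[a, b] (EFin \o q).
  by move=> a0; exact: slab_pair_integrable_itv sZ wx' a0.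
apply/eqP; rewrite -subr_eq0 -normr_le0; apply/ler_addgt0Pr => e e0; rewrite add0r.
have e2 : 0 < e / 2 by rewrite divr_gt0.
have [d d0 H] := pair_continuous wx (lexx 0) e2.
(* Close enough to [0] for the continuity of [u], and for the integral over
   [[0, s']] of a function bounded by [B] to be small. *)
pose s' := Num.min (Num.min (d / 2) t) (e / 2 / (B + 1)).
have s'0 : 0 < s' by rewrite !lt_min !divr_gt0//= ?t0// ltr_wpDl.
have s't : s' <= t by rewrite !ge_min lexx orbT.
have s'd : s' < d by rewrite gt_min gt_min ltr_pdivrMr// ltr_pMr// ltr1n.
have s'B : s' <= e / 2 / (B + 1) by rewrite ge_min lexx orbT.
have E := time_identity_pos sx x0 s'0 s't.
rewrite -/q (Rintegral_itv_cat (Iq _ _ (lexx 0)) (ltW s'0) s't).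
set A := \int[leb]_(r in `[0, s']) q r.
have -> : \int[leb]_(r in `[s', t]) q r = pair (u s') xi - pair (u t) xi by [].
have Ae : `|A| <= e / 2.
  rewrite (le_trans (le_normr_Rintegral _ _))//; first exact: Iq.
  have I0 : leb.-integrable `[0, s'] (EFin \o (cst B : R -> R)).
    apply: integrableS ((loc_int_cst B).2 s') => //.
    by apply: subset_itv; rewrite bnd_simp// oppr_le0 ltW.
  apply: (@le_trans _ _ (\int[leb]_(r in `[0, s']) (cst B r))).
    by apply: le_Rintegral => //; exact: integrable_norm (Iq _ _ (lexx 0)).
  rewrite Rintegral_cst//= lebesgue_measure_itv/= lte_fin s'0 /= subr0.
  apply: (le_trans (ler_wpM2l B0 s'B)).
  by rewrite mulrA ler_pdivrMr ?ltr_wpDl// mulrC ler_wpM2l ?ltW// ltrDl.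
have := H _ (ltW s'0); rewrite sub0r normrN gtr0_norm// => /(_ s'd) He.
rewrite [leRHS]splitr.
have -> : pair (u 0) xi - pair (u t) xi - (A + (pair (u s') xi - pair (u t) xi)) =
   - (pair (u s') xi - pair (u 0) xi) - A by ring.
by rewrite (le_trans (ler_normB _ _))// normrN lerD.
Qed.

End time_identity.
(** * Real integrals against a signed measure *)

Section charge_integrals.
Context {R : realType}.
Variable nu : {charge set (measurableTypeR R) -> \bar R}.
Implicit Types (psi phi : R -> R) (C : R).

Let Jp : {finite_measure set (measurableTypeR R) -> \bar R} := jordan_pos (hahn_posneg nu).
Let Jn : {finite_measure set (measurableTypeR R) -> \bar R} := jordan_neg (hahn_posneg nu).

(** The real value of [charge_integral], meaningful for bounded integrands. *)
Definition Rcharge_integral psi : R :=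
  \int[jordan_pos (hahn_posneg nu)]_x psi x - \int[jordan_neg (hahn_posneg nu)]_x psi x.

Lemma finite_bounded_integrable (m : {finite_measure set (measurableTypeR R) -> \bar R}) psi C :
  measurable_fun setT psi -> (forall x, `|psi x| <= C) ->
  m.-integrable setT (EFin \o psi).
Proof.
move=> mpsi psiC; apply: measurable_bounded_integrable => //.
  by rewrite -ge0_fin_numE// fin_num_measure.
exists C; split; first exact: num_real.
by move=> N CN x _ /=; rewrite (le_trans (psiC x))// ltW.
Qed.

Lemma charge_integralE psi C : measurable_fun setT psi -> (forall x, `|psi x| <= C) ->
  charge_integral nu psi = (Rcharge_integral psi)%:E.
Proof.
move=> mpsi psiC; rewrite /charge_integral /Rcharge_integral EFinB /Rintegral.
have Ip := finite_bounded_integrable Jp mpsi psiC.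
have In := finite_bounded_integrable Jn mpsi psiC.
by rewrite !fineK//; exact: integrable_fin_num.
Qed.

Lemma Rcharge_integral_sum (I : Type) (s : seq I) (phi : I -> R -> R) (c : I -> R) (C : I -> R) :
  (forall i, measurable_fun setT (phi i)) -> (forall i x, `|phi i x| <= C i) ->
  Rcharge_integral (fun x => \sum_(i <- s) c i * phi i x) = \sum_(i <- s) c i * Rcharge_integral (phi i).
Proof.
move=> mphi phiC.
have sumE (m : {finite_measure set (measurableTypeR R) -> \bar R}) :
    \int[m]_x (\sum_(i <- s) c i * phi i x) = \sum_(i <- s) c i * \int[m]_x phi i x.
  have Ii i : m.-integrable setT (EFin \o phi i).
    exact: finite_bounded_integrable (mphi i) (phiC i).
  have [|_ ->] := @Rintegral_sum _ _ R m I s setT (fun i x => c i * phi i x) measurableT.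
    by move=> i; exact: (@integrableZl _ _ _ m _ measurableT (c i) (EFin \o phi i)).
  by apply: eq_bigr => i _; rewrite RintegralZl.
rewrite /Rcharge_integral (sumE Jp) (sumE Jn) -sumrB.
by apply: eq_bigr => i _; rewrite mulrBr.
Qed.

Definition Rvariation : R := fine (total_variation_mass nu).

Lemma RvariationE : total_variation_mass nu = Rvariation%:E.
Proof.
rewrite /Rvariation fineK// /total_variation_mass /charge_variation/=.
by rewrite fin_numD !fin_num_measure.
Qed.

Lemma norm_Rcharge_integral psi : measurable_fun setT psi -> (forall x, `|psi x| <= 1) ->
  `|Rcharge_integral psi| <= Rvariation.
Proof.
move=> mpsi psi1.
have bnd (m : {finite_measure set (measurableTypeR R) -> \bar R}) :
    `|\int[m]_x psi x| <= fine (m setT).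
  have I := finite_bounded_integrable m mpsi psi1.
  have I1 : m.-integrable setT (EFin \o (cst 1 : R -> R)).
    by apply: (@finite_bounded_integrable m (cst 1) 1) => // x; rewrite normr1.
  rewrite (le_trans (le_normr_Rintegral _ I))//.
  rewrite -[leRHS]mul1r -Rintegral_cst//.
  apply: le_Rintegral => //; exact: integrable_norm.
rewrite (le_trans (ler_normB _ _))//.
rewrite /Rvariation /total_variation_mass /charge_variation/=.
by rewrite fineD ?fin_num_measure// lerD//; [exact: (bnd Jp)|exact: (bnd Jn)].
Qed.

Lemma Rcharge_integral_cvg (psi_ : nat -> R -> R) psi :
  (forall n, measurable_fun setT (psi_ n)) -> measurable_fun setT psi ->
  (forall n x, `|psi_ n x| <= 1) -> (forall x, psi_ n x @[n --> \oo] --> psi x) ->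
  Rcharge_integral (psi_ n) @[n --> \oo] --> Rcharge_integral psi.
Proof.
move=> mpsi_ mpsi psi1 cv.
have cvm (m : {finite_measure set (measurableTypeR R) -> \bar R}) :
    \int[m]_x psi_ n x @[n --> \oo] --> \int[m]_x psi x.
  apply: (@Rdominated _ _ R m setT psi_ psi (cst 1)) => //.
  - exact: aeW.
  - by apply: (@finite_bounded_integrable m (cst 1) 1) => // x; rewrite normr1.
  - by apply: aeW => x n _.
by apply: cvgB; [exact: (cvm Jp)|exact: (cvm Jn)].
Qed.

(** Multiply each function by the sign of its integral: the resulting combination
    is bounded by [1], and total variation is dual to such functions. *)
Lemma sum_norm_Rcharge_integral (n : nat) (phi : nat -> R -> R) :
  (forall i, measurable_fun setT (phi i)) -> (forall i x, 0 <= phi i x) ->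
  (forall x, \sum_(0 <= i < n) phi i x <= 1) ->
  \sum_(0 <= i < n) `|Rcharge_integral (phi i)| <= Rvariation.
Proof.
move=> mphi phi0 phi1.
have phin i x : (i < n)%N -> phi i x <= 1.
  move=> ni; rewrite (le_trans _ (phi1 x))// big_mkord (bigD1 (Ordinal ni))//=.
  by rewrite lerDl sumr_ge0.
pose phi' i := if (i < n)%N then phi i else cst 0.
have m' i : measurable_fun setT (phi' i).
  by rewrite /phi'; case: ifP => // _; exact: measurable_cst.
have b' i x : `|phi' i x| <= 1.
  rewrite /phi'; case: ifPn => [/phin|_]; last by rewrite normr0.
  by rewrite ger0_norm.
have := @Rcharge_integral_sum nat (index_iota 0 n) phi' (fun i => Num.sg (Rcharge_integral (phi i))) (fun=> 1) m' b'.
rewrite [RHS]big_nat (eq_bigr (fun i => `|Rcharge_integral (phi i)|)); last first.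
  by move=> i /andP[_ ni]; rewrite /phi' ni -normrEsg.
rewrite -big_nat => <-; rewrite (le_trans (ler_norm _))//; apply: norm_Rcharge_integral.
  rewrite (_ : (fun x => _) = (fun x => \sum_(i < n) Num.sg (Rcharge_integral (phi i)) * phi' i x)); last first.
    by apply/funext => x; rewrite big_mkord.
  by apply: measurable_sum => i; exact: measurable_funM.
move=> x; rewrite (le_trans (ler_norm_sum _ _ _))// (le_trans _ (phi1 x))//.
rewrite big_nat [leRHS]big_nat; apply: ler_sum => i /andP[_ ni].
rewrite /phi' ni normrM (ger0_norm (phi0 _ _)) ler_piMl//.
by rewrite normr_sg lern1 leq_b1.
Qed.

End charge_integrals.
(** * Discretization of a function of bounded variation and of its flux *)

Section grids.
Context {R : realType}.
Implicit Types (w z : R -> R) (nu : {charge set (measurableTypeR R) -> \bar R}).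

Lemma hat_weight (h a : R) : 0 < h -> exists M, weight M (`|a| + 2 * h) (rescale hat h a).
Proof.
move=> h0; apply: continuous_weight; first exact/smooth_continuous/smooth_rescale/smooth_hat.
have h20 : 0 < 2 * h by rewrite mulr_gt0.
move=> x xK; apply: (rescale_out h0 hat_out); apply: itv_out_norm xK.
  by rewrite (le_trans (ler_normD _ _))// mulN1r normrN (gtr0_norm h0); lra.
by rewrite (le_trans (ler_normD _ _))// (gtr0_norm h20).
Qed.

Lemma distr_pair w nu (phi : R -> R) K : loc_int w -> smooth phi ->
  (forall x, K < `|x| -> phi x = 0) -> distr_derivative w nu ->
  pair w (derive1 phi) = - Rcharge_integral nu phi.
Proof.
move=> lw sphi phi0 /(_ _ (test_functionP sphi phi0)) E.
have [M [mphi phiM _]] := continuous_weight (smooth_continuous sphi) phi0.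
by rewrite /pair /Rintegral E (charge_integralE nu mphi phiM).
Qed.

(** The difference of the two windows is the derivative of a hat. *)
Lemma jump_Rcharge_integral w nu (h a : R) : 0 < h -> loc_int w -> distr_derivative w nu ->
  pair w (win h a) - pair w (win h (a - h)) = Rcharge_integral nu (rescale hat h a).
Proof.
move=> h0 lw dw.
have [M1 w1] := win_weight a h0; have [M2 w2] := win_weight (a - h) h0.
have [M [_ _ hat0]] := hat_weight a h0.
have := distr_pair lw (@smooth_rescale R hat h a smooth_hat) hat0 dw.
have -> : derive1 (rescale hat h a) = fun x => win h (a - h) x - win h a x.
  by apply: is_derive1_funE => x; apply: is_derive_rescale_hat; rewrite gt_eqF.
by rewrite (pairBr lw w2 w1) => /eqP; rewrite eq_sym eqr_oppLR opprB => /eqP->.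
Qed.

Lemma pair_moll_norm z (h a : R) : 0 < h -> loc_int z -> (forall x, `|z x| <= 1) ->
  `|pair z (moll h a)| <= 1.
Proof.
move=> h0 lz z1; have [M wM] := moll_weight a h0.
rewrite -[pair _ _]subr0; apply: (pair_near lz wM).
- by move=> x; exact: moll_ge0.
- by move=> x; exact: moll_out.
- exact: mass_moll.
- by move=> x _; rewrite subr0.
Qed.

Variables (a b : R).
Hypothesis ab : a < b.

Definition mesh (n : nat) : R := (b - a) / n.+1%:R.
(** The grid starts [n.+1] lengths of [(a, b)] to the left of [a] and extends at
    least as far to the right of [b], so that it exhausts the line as [n] grows.
    The nodes of index [first_node n] to [first_node n + n.+1] are those in
    [[a, b]]. *)
Definition node (n i : nat) : R := a - n.+1%:R * (b - a) + i%:R * mesh n.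
Definition nnodes (n : nat) : nat := (3 * n.+1 ^ 2)%N.
Definition first_node (n : nat) : nat := (n.+1 ^ 2)%N.

Lemma mesh_gt0 n : 0 < mesh n.
Proof. by rewrite divr_gt0 ?subr_gt0// ltr0n. Qed.

Lemma mesh_cvg0 (d : R) : 0 < d -> \forall n \near \oo, mesh n < d.
Proof.
move=> d0; have e0 : 0 < d / (b - a) by rewrite divr_gt0// subr_gt0.
near=> n; rewrite /mesh mulrC -ltr_pdivlMr ?subr_gt0//.
by near: n; exact: near_infty_natSinv_lt (PosNum e0).
Unshelve. all: by end_near. Qed.

Lemma nodeS n i : node n i.+1 = node n i + mesh n.
Proof. by rewrite /node -[i.+1%:R]natr1 mulrDl mul1r addrA. Qed.

Lemma node_first n i : node n (first_node n + i) = a + i%:R * mesh n.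
Proof.
rewrite /node /first_node natrD mulrDl addrA; congr (_ + _).
rewrite /mesh natrX expr2 -addrA.
have : n.+1%:R != 0 :> R by rewrite pnatr_eq0.
move: (n.+1%:R : R) => N N0; rewrite -[RHS]addr0; congr (_ + _).
by field.
Qed.

Lemma rescale_hat_node n i x :
  rescale hat (mesh n) (node n i) x = hat ((x - node n 0) / mesh n - i%:R).
Proof.
have h0 : mesh n != 0 by rewrite gt_eqF// mesh_gt0.
rewrite /rescale /node mul0r addr0; congr hat.
by move: (n.+1%:R : R) (mesh n) h0 => N h h0; field.
Qed.

Lemma sum_hat_le1 n i j x : (i <= j)%N ->
  0 <= \sum_(i <= k < j) rescale hat (mesh n) (node n k) x <= 1.
Proof.
move=> ij; under eq_bigr do rewrite rescale_hat_node.
rewrite sum_hat//; set y := _ / _.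
have /andP[p0 p1] := wide_step01 (y - i%:R); have /andP[q0 q1] := wide_step01 (y - j%:R).
apply/andP; split; last lra.
by rewrite subr_ge0 wide_step_nondecreasing// lerD2l lerN2 ler_nat.
Qed.

(** Any given point is eventually inside the grid. *)
Lemma sum_hat_eq1 x : \forall n \near \oo,
  \sum_(1 <= k < nnodes n) rescale hat (mesh n) (node n k) x = 1.
Proof.
near=> n.
have h0 := mesh_gt0 n.
have N0 : 0 < n.+1%:R :> R by rewrite ltr0n.
have nn : (1 <= nnodes n)%N by rewrite /nnodes muln_gt0/= expn_gt0.
under eq_bigr do rewrite rescale_hat_node.
rewrite sum_hat//.
have xN : `|x - a| / (b - a) + 2 <= n.+1%:R.
  apply: (@le_trans _ _ n%:R); last by rewrite ler_nat.
  by near: n; exact: nbhs_infty_ger.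
have xab : `|x - a| <= (n.+1%:R - 2) * (b - a).
  by rewrite -ler_pdivrMr ?subr_gt0// lerBrDr.
have bah : b - a = n.+1%:R * mesh n.
  by rewrite /mesh mulrCA divff ?mulr1// gt_eqF.
have N1 : 1 <= n.+1%:R :> R by rewrite ler1n.
move: xab; rewrite ler_norml => /andP[xa1 xa2].
rewrite wide_step_ge1; last first.
  rewrite lerBrDr ler_pdivlMr// /node mul0r addr0.
  have : 2 * mesh n <= 2 * (b - a).
    by rewrite ler_pM2l// bah ler_peMl// ltW.
  lra.
rewrite wide_step_leN1 ?subr0//.
rewrite lerBlDr ler_pdivrMr// /node mul0r addr0 /nnodes natrM natrX.
have : 2 * mesh n <= 2 * (b - a).
  by rewrite ler_pM2l// bah ler_peMl// ltW.
have -> : (-1 + 3 * n.+1%:R ^+ 2) * mesh n = 3 * n.+1%:R * (b - a) - mesh n.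
  by rewrite bah; ring.
have : 0 < b - a by rewrite subr_gt0.
move: xa2 N1; move: (n.+1%:R : R) (mesh n) (b - a) h0 => N h d h0; nra.
Unshelve. all: by end_near. Qed.

Definition zgrid z n i : R := pair z (moll (mesh n) (node n i)).

(** The values of [zgrid] interpolated by the partition of unity: integrating it
    against [Du] gives the discrete product of flux and jumps. *)
Definition zinterp z n x : R :=
  \sum_(1 <= k < nnodes n) zgrid z n k * rescale hat (mesh n) (node n k) x.

Lemma rescale_hat_ge0 h c x : 0 <= rescale hat h c x :> R.
Proof. exact: hat_ge0. Qed.

Lemma zgrid_norm z n i : loc_int z -> (forall x, `|z x| <= 1) -> `|zgrid z n i| <= 1.
Proof. by move=> lz z1; apply: pair_moll_norm => //; exact: mesh_gt0. Qed.

Lemma zinterp_norm z n x : loc_int z -> (forall x, `|z x| <= 1) -> `|zinterp z n x| <= 1.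
Proof.
move=> lz z1.
have nn : (1 <= nnodes n)%N by rewrite /nnodes muln_gt0/= expn_gt0.
have /andP[_ s1] := sum_hat_le1 n x nn.
rewrite (le_trans (ler_norm_sum _ _ _))// (le_trans _ s1)//; apply: ler_sum => i _.
by rewrite normrM (ger0_norm (rescale_hat_ge0 _ _ _)) ler_piMl ?rescale_hat_ge0// zgrid_norm.
Qed.

Lemma zinterp_cvg z x : loc_int z -> continuous z ->
  zinterp z n x @[n --> \oo] --> z x.
Proof.
move=> lz cz; apply/cvgrPdist_le => e e0.
have /cvgrPdist_le/(_ _ e0)/nbhs_ballP[d /= d0 H] := cz x.
(* The node of a hat charging [x] is within [2 h] of [x] and its mollifier reaches [h]
   further. *)
have d3 : 0 < d / 3 by rewrite divr_gt0.
near=> n.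
have S1 : \sum_(1 <= k < nnodes n) rescale hat (mesh n) (node n k) x = 1.
  by near: n; exact: sum_hat_eq1.
have hd : mesh n < d / 3 by near: n; exact: mesh_cvg0.
have h0 := mesh_gt0 n.
rewrite distrC -[z x]mulr1 -[in X in `|_ - X|]S1 mulr_sumr -sumrB.
rewrite (le_trans (ler_norm_sum _ _ _))// -[leRHS]mulr1 -[in leRHS]S1 mulr_sumr.
apply: ler_sum => i _; rewrite -mulrBl normrM (ger0_norm (rescale_hat_ge0 _ _ _)).
have [xi|xi] := boolP (node n i + -1 * mesh n < x < node n i + 2 * mesh n); last first.
  by rewrite (rescale_out h0 hat_out xi) !mulr0.
rewrite ler_wpM2r ?rescale_hat_ge0//.
have [M wM] := moll_weight (node n i) h0.
apply: (pair_near lz wM (fun x => moll_ge0 _ _ h0) _ (mass_moll _ h0)).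
  by move=> y; exact: moll_out.
move=> y yi; rewrite distrC; apply: H; rewrite /ball/= ltr_norml.
by move: xi yi => /andP[] ? ? /andP[] ? ?; apply/andP; split; lra.
Unshelve. all: by end_near. Qed.

Lemma measurable_rescale_hat h c : measurable_fun setT (rescale hat h c : R -> R).
Proof.
apply: continuous_measurable_fun; apply: smooth_continuous.
exact: smooth_rescale smooth_hat.
Qed.

Lemma measurable_zinterp z n : measurable_fun setT (zinterp z n).
Proof.
rewrite /zinterp.
elim: (index_iota 1 (nnodes n)) => [|i s IHs].
  by under eq_fun do rewrite big_nil; exact: measurable_cst.
under eq_fun do rewrite big_cons.
by apply: measurable_funD => //; apply: measurable_funM => //; exact: measurable_rescale_hat.
Qed.

Definition ugrid w n i : R := pair w (win (mesh n) (node n i)).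
Definition ujump w n i : R := ugrid w n i - ugrid w n i.-1.

Definition jump_var w n : R := \sum_(1 <= k < nnodes n) `|ujump w n k|.
Definition jump_z w z n : R := \sum_(1 <= k < nnodes n) zgrid z n k * ujump w n k.

Lemma ujumpE w nu n i : (0 < i)%N -> loc_int w -> distr_derivative w nu ->
  ujump w n i = Rcharge_integral nu (rescale hat (mesh n) (node n i)).
Proof.
case: i => // i _ lw dw.
by rewrite -(@jump_Rcharge_integral w nu _ _ (mesh_gt0 n) lw dw) /ujump/= /ugrid nodeS addrK.
Qed.

(** Each jump is the integral of a hat, and the hats form a subpartition of unity. *)
Lemma jump_var_le w nu n : loc_int w -> distr_derivative w nu ->
  jump_var w n <= Rvariation nu.
Proof.
move=> lw dw.
have nn : (1 <= nnodes n)%N by rewrite /nnodes muln_gt0/= expn_gt0.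
rewrite /jump_var -[1%N]add0n big_addn.
pose phi i := rescale hat (mesh n) (node n (i + 1)).
apply: (@le_trans _ _ (\sum_(0 <= i < nnodes n - 1) `|Rcharge_integral nu (phi i)|)).
  by apply: ler_sum => i _; rewrite (ujumpE _ _ lw dw)// addn1.
apply: sum_norm_Rcharge_integral.
- by move=> i; exact: measurable_rescale_hat.
- by move=> i x; exact: rescale_hat_ge0.
- move=> x; have /andP[_] := sum_hat_le1 n x nn.
  by rewrite -{1}[1%N]add0n big_addn.
Qed.

Lemma jump_zE w nu z n : loc_int w -> distr_derivative w nu ->
  jump_z w z n = Rcharge_integral nu (zinterp z n).
Proof.
move=> lw dw; rewrite (@Rcharge_integral_sum _ nu nat _ (fun i => rescale hat (mesh n) (node n i))
   (zgrid z n) (fun=> 1)).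
- rewrite /jump_z big_nat [RHS]big_nat; apply: eq_bigr => i /andP[i0 _].
  by rewrite (ujumpE _ _ lw dw).
- by move=> i; exact: measurable_rescale_hat.
- move=> i x; rewrite ger0_norm ?rescale_hat_ge0//.
  by have /andP[_] := sum_hat_le1 n x (leqnSn i); rewrite big_nat1.
Qed.

(** The interpolated fluxes are bounded by [1] and converge pointwise, hence also
    after integration against [Du]. *)
Lemma jump_z_cvg w nu z : loc_int w -> distr_derivative w nu ->
  loc_int z -> continuous z -> (forall x, `|z x| <= 1) ->
  jump_z w z n @[n --> \oo] --> Rcharge_integral nu z.
Proof.
move=> lw dw lz cz z1.
under eq_fun do rewrite (jump_zE _ _ lw dw).
apply: Rcharge_integral_cvg.
- by move=> n; exact: measurable_zinterp.
- by case: lz.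
- by move=> n x; exact: zinterp_norm.
- by move=> x; exact: zinterp_cvg.
Qed.

Lemma jump_z_le w nu z n : loc_int w -> distr_derivative w nu ->
  loc_int z -> (forall x, `|z x| <= 1) -> `|jump_z w z n| <= Rvariation nu.
Proof.
move=> lw dw lz z1; rewrite (jump_zE _ _ lw dw); apply: norm_Rcharge_integral.
  exact: measurable_zinterp.
by move=> x; exact: zinterp_norm.
Qed.

End grids.
(** * Integrals of functions that may fail to be measurable *)

Section lower_integral.
Context d (T : measurableType d) (R : realType) (m : {measure set T -> \bar R}).

(** The integral of a nonnegative function is a supremum over the simple functions
    below it. Multiplying such a simple function by the indicator of a set of
    full measure changes none of the integrals involved and puts it below the
    other function. *)
Lemma ge0_le_lower_integral (D : set T) (f g : T -> \bar R) :
  (forall x, 0 <= f x)%E -> (forall x, 0 <= g x)%E ->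
  {ae m, forall x, D x -> (f x <= g x)%E} ->
  (\int[m]_(x in D) f x <= \int[m]_(x in D) g x)%E.
Proof.
move=> f0 g0 [N [mN N0 fgN]].
rewrite !ge0_integralE//; apply: ub_ereal_sup => _ [h hf <-].
pose h' := proj_nnsfun h (measurableC mN).
have -> : sintegral m h = sintegral m h'.
  rewrite -!integralT_nnsfun; apply: ae_eq_integral => //.
  - exact/measurable_EFinP.
  - exact/measurable_EFinP.
  exists N; split=> // x /= hx; apply: contrapT => xN; apply: hx => _ /=.
  by rewrite mindicE mem_set ?mulr1.
apply: ereal_sup_ubound; exists h' => // x /=.
rewrite mindicE; case: (boolP (x \in ~` N)) => [xN|_]; last first.
  by rewrite mulr0 /patch; case: ifP.
rewrite mulr1 (le_trans (hf x))//.
rewrite /patch; case: ifPn => // xD.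
move: xN xD; rewrite !inE => xN xD; apply: contrapT => H; apply: xN; apply: fgN => /=.
by move=> /(_ xD).
Qed.

(** In the energy identity of a strong solution the integrands in time are not
    assumed to be measurable, so equality almost everywhere has to suffice. *)
Lemma ae_eq_lower_integral (D : set T) (f g : T -> \bar R) :
  {ae m, forall x, D x -> f x = g x} ->
  (\int[m]_(x in D) f x = \int[m]_(x in D) g x)%E.
Proof.
move=> fg; rewrite [LHS]integralE [RHS]integralE; congr (_ - _)%E; apply/eqP; rewrite eq_le.
  apply/andP; split; apply: ge0_le_lower_integral => //;
  by apply: (ae_mono fg) => x /[swap] Dx /(_ Dx) E; rewrite !funeposE E.
apply/andP; split; apply: ge0_le_lower_integral => //;
by apply: (ae_mono fg) => x /[swap] Dx /(_ Dx) E; rewrite !funenegE E.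
Qed.

End lower_integral.
(** * The energy identity forces the gap to vanish *)

Section energy_identity.
Context {R : realType}.
Variables (T C : R) (F CI : R -> \bar R) (Fr Gr : R -> R) (V S : nat -> R -> R).
Let D : set R := `]0, T[.
Hypothesis F0 : forall t, (0 <= F t)%E.
Hypothesis V0 : forall n t, 0 <= V n t.
Hypothesis IV : forall n, leb.-integrable D (EFin \o V n).
Hypothesis IS : forall n, leb.-integrable D (EFin \o S n).
Hypothesis good : {ae leb, forall t, D t ->
  [/\ CI t = (Gr t)%:E, F t = (Fr t)%:E, forall n, `|S n t| <= C,
      forall n, V n t <= Fr t & S n t @[n --> \oo] --> Gr t]}.
Hypothesis CIF : (\int[leb]_(t in D) CI t = \int[leb]_(t in D) F t)%E.
Hypothesis FC : {ae leb, forall t, D t -> (F t <= C%:E)%E}.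

(** [F] stands for the total variation and [CI] for the integral of the flux
    against the derivative. [V n <= F] and [S n] tends to [CI] boundedly, so
    equality of the integrals of [CI] and [F] leaves room only for a vanishing
    difference of [V n] and [S n]. The limit of the measurable [S n] gives a
    measurable representative of [CI]. *)
Lemma energy_gap (e : R) : 0 < e ->
  \forall n \near \oo, \int[leb]_(t in D) (V n t - S n t) <= e.
Proof.
move=> e0; have [N [mN N0 goodN]] := good.
have mD : measurable D by exact: measurable_itv.
have IC : leb.-integrable D (EFin \o (cst `|C| : R -> R)).
  apply: integrableS ((loc_int_cst `|C|).2 `|T|) => //.
  apply: subset_itv; rewrite bnd_simp ?oppr_le0//.
  exact: ler_norm.
(* Restricting to the complement of a measurable null set turns convergence almost
   everywhere into convergence everywhere and makes the limit measurable. *)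
pose S' n := S n \_ (~` N); pose G' := Gr \_ (~` N).
have mS' n : measurable_fun D (S' n).
  have mS : measurable_fun D (S n) by apply/measurable_EFinP; exact: measurable_int (IS n).
  apply/(measurable_restrict _ _ _).1 => //; first exact: measurableC.
  by apply: measurable_funS mS => // x [].
have cv t : D t -> S' n t @[n --> \oo] --> G' t.
  move=> Dt; rewrite /S' /G' /patch; case: ifPn => [tN|_]; last exact: cvg_cst.
  have : ~ N t by move: tN; rewrite inE.
  by apply: contra_notP => H; apply: goodN => /(_ Dt)[].
have mG' : measurable_fun D G'.
  by apply: (measurable_fun_cvg mS') => t Dt; exact: cv.
have CIG : (\int[leb]_(t in D) CI t = \int[leb]_(t in D) (G' t)%:E)%E.
  apply: ae_eq_lower_integral; exists N; split=> // t /= H.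
  apply: contrapT => Nt; apply: H => Dt.
  rewrite /G' /patch mem_set//.
  by apply: contrapT => H; apply: Nt; apply: goodN => /(_ Dt)[].
have cvS : \int[leb]_(t in D) S n t @[n --> \oo] --> \int[leb]_(t in D) G' t.
  have mS n : measurable_fun D (S n) by apply/measurable_EFinP; exact: measurable_int (IS n).
  apply: (@Rdominated _ _ R leb D S G' (fun t => `|C|)) => //.
  - exists N; split=> // t /= H; apply: contrapT => Nt; apply: H => Dt.
    rewrite /G' /patch mem_set//.
    by apply: contrapT => H; apply: Nt; apply: goodN => /(_ Dt)[].
  - apply: (ae_mono good) => t H n Dt; have [_ _ SC _ _] := H Dt.
    by rewrite (le_trans (SC n))// ler_norm.
have VF n : (\int[leb]_(t in D) (V n t)%:E <= \int[leb]_(t in D) F t)%E.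
  apply: ge0_le_lower_integral => //; first by move=> t; rewrite lee_fin.
  by apply: (ae_mono good) => t H Dt; have [_ -> _ VFr _] := H Dt; rewrite lee_fin.
have Ffin : (\int[leb]_(t in D) F t \is a fin_num)%E.
  rewrite ge0_fin_numE; last exact: integral_ge0.
  apply: (@le_lt_trans _ _ (\int[leb]_(t in D) `|C|%:E)%E).
    apply: ge0_le_lower_integral => //; apply: (ae_mono FC) => t H Dt.
    by rewrite (le_trans (H Dt))// lee_fin ler_norm.
  exact: integrable_lty IC.
have VG n : \int[leb]_(t in D) V n t <= \int[leb]_(t in D) G' t.
  rewrite /Rintegral -CIG CIF fine_le//.
  by apply: integrable_fin_num => //; exact: (IV n).
have /cvgrPdist_le/(_ _ e0) cvS' := cvS.
near=> n; rewrite RintegralB//.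
have : `|\int[leb]_(t in D) G' t - \int[leb]_(t in D) S n t| <= e by near: n.
move=> /(le_trans (ler_norm _)); apply: le_trans.
by rewrite lerD2r.
Unshelve. all: by end_near. Qed.

End energy_identity.

(** * The squared excess along a Lipschitz curve *)

Section quadratic_constant.
Context {R : realType}.

(** Cut [[0, T]] into [N] pieces: the increments add up to [O(1/N)]. *)
Lemma quadratic_increments_constant (f : R -> R) (K T : R) : 0 <= T ->
  (forall s t, 0 <= s -> s <= t -> t <= T -> `|f t - f s| <= K * (t - s) ^+ 2) ->
  f T = f 0.
Proof.
move=> T0 fK.
have K0T : 0 <= K * T ^+ 2.
  by have := fK 0 T (lexx _) T0 (lexx _); rewrite subr0; exact: le_trans.
have bnd (N : nat) : `|f T - f 0| <= K * T ^+ 2 / N.+1%:R.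
  have N0 : N.+1%:R != 0 :> R by rewrite pnatr_eq0.
  have N0' : 0 < N.+1%:R :> R by rewrite ltr0n.
  pose p (i : nat) : R := i%:R * (T / N.+1%:R).
  have -> : f T - f 0 = \sum_(0 <= i < N.+1) (f (p i.+1) - f (p i)).
    by rewrite (telescope_sumr (fun i => f (p i)))// /p mul0r mulrCA divff// mulr1.
  rewrite (le_trans (ler_norm_sum _ _ _))//.
  apply: (@le_trans _ _ (\sum_(0 <= i < N.+1) K * (T / N.+1%:R) ^+ 2)).
    rewrite big_nat [leRHS]big_nat; apply: ler_sum => i /andP[_ iN].
    have h0 : 0 <= T / N.+1%:R by rewrite divr_ge0.
    have -> : T / N.+1%:R = p i.+1 - p i by rewrite /p -mulrBl -[i.+1%:R]natr1 addrAC subrr add0r mul1r.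
    apply: fK; first by rewrite mulr_ge0.
      by rewrite ler_wpM2r// ler_nat.
    by rewrite /p mulrCA ler_piMr// ler_pdivrMr// mul1r ler_nat.
  rewrite sumr_const_nat subn0 -mulr_natl le_eqVlt; apply/orP; left; apply/eqP.
  by field.
apply/eqP; rewrite -subr_eq0 -normr_le0; apply/ler_addgt0Pr => e e0; rewrite add0r.
near \oo => N.
apply: le_trans (bnd N) _; rewrite ler_pdivrMr ?ltr0n//.
have : K * T ^+ 2 / e <= N%:R by near: N; exact: nbhs_infty_ger.
rewrite ler_pdivrMr// => /le_trans; apply; rewrite mulrC ler_wpM2l ?ler_nat// ltW//.
Unshelve. all: by end_near. Qed.

End quadratic_constant.

Section excess.
Context {R : realType}.
Variable delta : R.

Definition excess (r : R) : R := Num.max (r - delta) 0.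

Lemma excess_ge0 r : 0 <= excess r.
Proof. by rewrite le_max lexx orbT. Qed.

Lemma excess_nondecreasing (r s : R) : r <= s -> 0 <= excess s - excess r <= s - r.
Proof.
rewrite /excess => rs.
by have [?|?] := leP (s - delta) 0; have [?|?] := leP (r - delta) 0; apply/andP; split; lra.
Qed.

(** The square of the positive part is of class C1 with a derivative of Lipschitz
    constant [2]. *)
Lemma excess_sqr_taylor (r s : R) :
  `|excess s ^+ 2 - excess r ^+ 2 - 2 * excess r * (s - r)| <= (s - r) ^+ 2.
Proof.
rewrite /excess ler_norml (_ : s - r = (s - delta) - (r - delta)); last by ring.
move: (s - delta) (r - delta) => b a.
have := sqr_ge0 b; have := sqr_ge0 a; have := sqr_ge0 (b - a).
have [b0|b0] := leP b 0; have [a0|a0] := leP a 0 => ? ? ?; apply/andP; split; nra.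
Qed.

Lemma excess_lip (r s : R) : `|excess s - excess r| <= `|s - r|.
Proof.
have [rs|/ltW sr] := leP r s.
  have /andP[? ?] := excess_nondecreasing rs; rewrite !ger0_norm// subr_ge0//.
have /andP[? ?] := excess_nondecreasing sr; rewrite distrC [leRHS]distrC !ger0_norm// subr_ge0//.
Qed.

(** A chain rule for a Lipschitz function [w] given as an integral. The difference
    of the two sides, as a function of the end point, has quadratic increments
    by Taylor's inequality, hence is constant. *)
Lemma excess_chain_rule (w omega : R -> R) (B T : R) : 0 <= T ->
  measurable_fun `[0, T] w ->
  leb.-integrable `[0, T] (EFin \o omega) -> (forall t, `|omega t| <= B) ->
  (forall s t, 0 <= s -> s <= t -> t <= T ->
     w t - w s = \int[leb]_(r in `[s, t]) omega r) ->
  leb.-integrable `[0, T] (EFin \o (fun t => 2 * excess (w t) * omega t)) /\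
  excess (w T) ^+ 2 - excess (w 0) ^+ 2 =
  \int[leb]_(t in `[0, T]) (2 * excess (w t) * omega t).
Proof.
move=> T0 mw Io oB wE.
have B0 : 0 <= B := le_trans (normr_ge0 _) (oB 0).
have Ist s t : 0 <= s -> t <= T -> leb.-integrable `[s, t] (EFin \o omega).
  by move=> s0 tT; apply: integrableS Io => //; apply: subset_itv; rewrite bnd_simp.
have len s t : s <= t -> \int[leb]_(r in `[s, t]) (cst B r) = B * (t - s).
  move=> st; rewrite Rintegral_cst//= lebesgue_measure_itv/= lte_fin.
  by case: ltP => //= ts; rewrite -?EFinB//= (@le_anti _ _ s t) ?st// subrr.
have Icst c s t : leb.-integrable `[s, t] (EFin \o (cst c : R -> R)).
  apply/integrableP; split; first exact/measurable_EFinP.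
  under eq_integral do rewrite /=.
  by rewrite integral_cst//= lebesgue_measure_itv/=; case: ifP => _; rewrite -?EFinB -?EFinM ?mule0 ltry.
have wlip s t : 0 <= s -> s <= t -> t <= T -> `|w t - w s| <= B * (t - s).
  move=> s0 st tT; rewrite wE// (le_trans (le_normr_Rintegral _ _))//; first exact: Ist.
  rewrite -len//; apply: le_Rintegral => //.
  exact: integrable_norm (Ist _ _ s0 tT).
have me : measurable_fun `[0, T] (fun t => 2 * excess (w t)).
  apply: measurable_funM => //; apply: measurable_maxr => //.
  exact: measurable_funB.
pose J t := 2 * excess (w t) * omega t.
have IJ : leb.-integrable `[0, T] (EFin \o J).
  rewrite (_ : EFin \o J = ((EFin \o (fun t => (2 * excess (w t))%R)) \* (EFin \o omega))%E); last first.
    by apply/funext => t; rewrite /= EFinM.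
  apply: integrableMr => //.
  exists (2 * (excess (w 0) + B * T)); split; first exact: num_real.
  move=> M MB t /=; rewrite in_itv/= => /andP[t0 tT]; rewrite (le_trans _ (ltW MB))//.
  rewrite ger0_norm ?mulr_ge0 ?excess_ge0// ler_pM2l//.
  have := excess_lip (w 0) (w t); rewrite ler_distl => /andP[_ /le_trans]; apply.
  rewrite lerD2l (le_trans (wlip _ _ (lexx 0) t0 tT))// ler_wpM2l// subr0//.
have IJst s t : 0 <= s -> t <= T -> leb.-integrable `[s, t] (EFin \o J).
  by move=> s0 tT; apply: integrableS IJ => //; apply: subset_itv; rewrite bnd_simp.
split; first exact: IJ.
pose f t := excess (w t) ^+ 2 - \int[leb]_(r in `[0, t]) J r.
suff : f T = f 0.
  rewrite /f set_itv1 Rintegral_set1 subr0 => <-.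
  by rewrite opprB addrC addrNK.
apply: (@quadratic_increments_constant R f (3 * B ^+ 2) T T0) => s t s0 st tT.
have IJt : leb.-integrable `[0, t] (EFin \o J) by exact: IJst.
have ws : w t - w s = \int[leb]_(r in `[s, t]) omega r by exact: wE.
set A := excess (w t) ^+ 2 - excess (w s) ^+ 2 - 2 * excess (w s) * (w t - w s).
set E := \int[leb]_(r in `[s, t]) (J r - 2 * excess (w s) * omega r).
have EE : E = \int[leb]_(r in `[s, t]) J r - 2 * excess (w s) * (w t - w s).
  rewrite /E RintegralB//; [|exact: IJst|].
    by rewrite RintegralZl ?ws//; exact: Ist.
  exact: (@integrableZl _ _ _ leb _ _ (2 * excess (w s)) (EFin \o omega) (Ist _ _ s0 tT)).
have -> : f t - f s = A - E.
  by rewrite EE /A /f (Rintegral_itv_cat IJt s0 st); ring.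
have t_s : 0 <= t - s by rewrite subr_ge0.
have Ale : `|A| <= (B * (t - s)) ^+ 2.
  rewrite (le_trans (excess_sqr_taylor _ _))//.
  rewrite -real_normK ?num_real// lerXn2r ?nnegrE ?mulr_ge0//.
  exact: wlip.
have Ele : `|E| <= 2 * (B * (t - s)) * B * (t - s).
  have IE : leb.-integrable `[s, t] (EFin \o (fun r => J r - 2 * excess (w s) * omega r)).
    apply: (@integrableB _ _ _ leb _ _ (EFin \o J) (fun r => (2 * excess (w s) * omega r)%:E)) => //.
      exact: IJst.
    exact: (@integrableZl _ _ _ leb _ _ (2 * excess (w s)) (EFin \o omega) (Ist _ _ s0 tT)).
  rewrite (le_trans (le_normr_Rintegral _ _))//.
  have -> : 2 * (B * (t - s)) * B * (t - s) =
      \int[leb]_(r in `[s, t]) (cst (2 * (B * (t - s)) * B) r).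
    rewrite Rintegral_cst//= lebesgue_measure_itv/= lte_fin.
    case: ltP => //= ts; rewrite -?EFinB//= (@le_anti _ _ s t) ?st// subrr.
    by rewrite !mulr0.
  apply: le_Rintegral => //; first exact: integrable_norm.
  move=> r; rewrite /= in_itv/= => /andP[sr rt].
  rewrite /J -mulrBl -mulrBr !normrM ger0_norm// ler_pM// ler_pM2l//.
  rewrite (le_trans (excess_lip _ _))// (le_trans (wlip _ _ s0 sr (le_trans rt tT)))//.
  by rewrite ler_wpM2l// lerD2r.
rewrite (le_trans (ler_normB _ _))// (le_trans (lerD Ale Ele))//.
by rewrite le_eqVlt; apply/orP; left; apply/eqP; ring.
Qed.

End excess.
(** * Summation by parts for the discrete flow *)

Section discrete.
Context {R : realType}.
Implicit Types (g U z : nat -> R).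

(** A sum of nonnegative terms when the [z i] are bounded by [1], which vanishes
    when [z i.+1] is the sign of the jump of [U] from [i] to [i.+1]. *)
Definition defect U z (m : nat) : R :=
  \sum_(0 <= i < m) (`|U i.+1 - U i| - z i.+1 * (U i.+1 - U i)).

Lemma abel_sum g z (m : nat) :
  \sum_(0 <= i < m.+1) g i * (z i.+1 - z i) =
  g m * z m.+1 - g 0%N * z 0%N - \sum_(0 <= i < m) z i.+1 * (g i.+1 - g i).
Proof.
elim: m => [|m IH]; first by rewrite big_nat1 big_geq// subr0 mulrBr.
by rewrite big_nat_recr//= IH [in RHS]big_nat_recr//=; ring.
Qed.

(** Apply it where [g j = 0]: the variation pays for both boundary values. *)
Lemma variation_ge g (m j : nat) : (j <= m)%N ->
  g 0%N - g j + (g m - g j) <= \sum_(0 <= i < m) `|g i.+1 - g i|.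
Proof.
move=> jm; rewrite (big_cat_nat (n := j))//= lerD//.
  rewrite -opprB -(telescope_sumr g)// -sumrN.
  by apply: ler_sum => i _; rewrite -normrN ler_norm.
by rewrite -(telescope_sumr g)//; apply: ler_sum => i _; exact: ler_norm.
Qed.

(** [g] behaves as a [2]-Lipschitz nondecreasing function of [U]. Its jumps have
    the sign of those of [U], so that [z] is the sign of these jumps up to twice
    the defect. As [|z| <= 1], the boundary terms are at most [g m] and [g 0],
    which the variation of [g] absorbs because of its zero at [j]. *)
Lemma abel_sum_le_defect g U z (m j : nat) : (j <= m)%N -> (forall i, `|z i| <= 1) ->
  (forall i, 0 <= g i) -> g j = 0 ->
  (forall i, (U i <= U i.+1 /\ 0 <= g i.+1 - g i <= 2 * (U i.+1 - U i)) \/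
             (U i.+1 <= U i /\ 0 <= g i - g i.+1 <= 2 * (U i - U i.+1))) ->
  \sum_(0 <= i < m.+1) g i * (z i.+1 - z i) <= 2 * defect U z m.
Proof.
move=> jm z1 g0 gj gU; rewrite abel_sum.
have z1' i : -1 <= z i <= 1 by rewrite -ler_norml.
have step : \sum_(0 <= i < m) `|g i.+1 - g i| - \sum_(0 <= i < m) z i.+1 * (g i.+1 - g i)
    <= 2 * defect U z m.
  rewrite /defect mulr_sumr -sumrB; apply: ler_sum => i _.
  have /andP[zl zr] := z1' i.+1.
  case: (gU i) => -[UU /andP[gl gr]].
    have UU' : 0 <= U i.+1 - U i by rewrite subr_ge0.
    rewrite (ger0_norm gl) (ger0_norm UU').
    move: (g i.+1 - g i) (U i.+1 - U i) (z i.+1) zl zr gl gr UU' => G W Z.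
    clear; nra.
  have UU' : 0 <= U i - U i.+1 by rewrite subr_ge0.
  rewrite -[g i.+1 - g i]opprB -[U i.+1 - U i]opprB !normrN.
  rewrite (ger0_norm gl) (ger0_norm UU').
  move: (g i - g i.+1) (U i - U i.+1) (z i.+1) zl zr gl gr UU' => G W Z.
  clear; nra.
have := variation_ge g jm; rewrite gj !subr0 => vg.
have /andP[? ?] := z1' m.+1; have /andP[? ?] := z1' 0%N.
have := g0 m; have := g0 0%N; move: step vg.
set A := \sum_(0 <= i < m) `|g i.+1 - g i|.
set B := \sum_(0 <= i < m) z i.+1 * (g i.+1 - g i); set E := defect U z m.
have zm : g m * z m.+1 <= g m by rewrite ler_piMr.
have z0 : - (g 0%N * z 0%N) <= g 0%N by rewrite -mulrN ler_piMr// lerNl.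
move: zm z0; lra.
Qed.

Variable delta : R.
Hypothesis delta0 : 0 <= delta.

Lemma excess_le0 r : r <= delta -> excess delta r = 0.
Proof. by move=> rd; rewrite /excess max_r// subr_le0. Qed.

(** Freeze [j] and sum over [i], then freeze [i] and sum over [j]. In the second
    case the excess is a function of [- U j], and the pair [(- U, - z)] has the
    same defect. *)
Lemma excess_rate U z (m : nat) : (forall i, `|z i| <= 1) ->
  \sum_(0 <= i < m.+1) \sum_(0 <= j < m.+1)
    2 * excess delta (U i - U j) * ((z i.+1 - z i) - (z j.+1 - z j)) <=
  m.+1%:R * (4 * defect U z m).
Proof.
move=> z1.
under eq_bigr do under eq_bigr do rewrite mulrBr.
under eq_bigr do rewrite sumrB.
rewrite sumrB [X in X - _]exchange_big/= -sumrN.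
have -> : m.+1%:R * (4 * defect U z m) =
    \sum_(0 <= j < m.+1) 2 * defect U z m + \sum_(0 <= i < m.+1) 2 * defect U z m.
  have cE x : \sum_(0 <= i < m.+1) x = m.+1%:R * x :> R.
    by rewrite sumr_const_nat subn0 mulr_natl.
  by rewrite !cE; ring.
apply: lerD.
  rewrite big_nat [leRHS]big_nat; apply: ler_sum => j /andP[_ jm].
  apply: (@abel_sum_le_defect (fun i => 2 * excess delta (U i - U j)) U z m j) => //.
  - by move=> i; rewrite mulr_ge0 ?excess_ge0.
  - by rewrite subrr excess_le0 ?mulr0.
  - move=> i; have [ii|/ltW ii] := leP (U i) (U i.+1); [left|right]; split=> //.
      have /andP[? ?] := @excess_nondecreasing _ delta (U i - U j) (U i.+1 - U j) (lerB ii (lexx _)).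
      by apply/andP; split; lra.
    have /andP[? ?] := @excess_nondecreasing _ delta (U i.+1 - U j) (U i - U j) (lerB ii (lexx _)).
    by apply/andP; split; lra.
rewrite big_nat [leRHS]big_nat; apply: ler_sum => i /andP[_ im].
rewrite -sumrN.
have -> : defect U z m = defect (fun k => - U k) (fun k => - z k) m.
  apply: eq_bigr => k _; rewrite -opprD normrN mulNr mulrN opprK.
  by congr (`|_| - _); ring.
rewrite (eq_bigr (fun j => 2 * excess delta (U i - U j) * (- z j.+1 - - z j))); last first.
  by move=> j _; rewrite -mulrN; congr (_ * _); ring.
apply: (@abel_sum_le_defect (fun j => 2 * excess delta (U i - U j)) (fun k => - U k)
  (fun k => - z k) m i) => //.
- by move=> k; rewrite normrN.
- by move=> k; rewrite mulr_ge0 ?excess_ge0.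
- by rewrite subrr excess_le0 ?mulr0.
- move=> k; have [kk|/ltW kk] := leP (- U k) (- U k.+1); [left|right]; split=> //.
    have /andP[? ?] := @excess_nondecreasing _ delta (U i - U k) (U i - U k.+1) (lerD (lexx _) kk).
    by apply/andP; split; lra.
  have /andP[? ?] := @excess_nondecreasing _ delta (U i - U k.+1) (U i - U k) (lerD (lexx _) kk).
  by apply/andP; split; lra.
Qed.

End discrete.

(** * Contraction of the local oscillation *)

Section counting.
Context {R : realType}.

(** An interval of length at least ten cells contains enough cells to cover half
    of it. *)
Lemma cells_inside (a b p q h : R) (n : nat) : 0 < h -> b - a = n.+2%:R * h ->
  a <= p -> q <= b -> 10 * h <= q - p ->
  exists i0 L : nat, [/\ (i0 + L <= n.+1)%N, (q - p) / 2 <= h * L%:R &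
    forall i, (i0 <= i < i0 + L)%N -> p <= a + i%:R * h /\ a + i%:R * h + 2 * h <= q].
Proof.
move=> h0 bah ap qb qp.
have hN : h != 0 by rewrite gt_eqF.
pose k0 := Num.truncn ((p - a) / h); pose k1 := Num.truncn ((q - p) / h).
have /andP[k0l k0r] : k0%:R <= (p - a) / h < k0.+1%:R.
  by apply: truncn_itv; apply: divr_ge0; [rewrite subr_ge0|exact: ltW].
have qp0 : 0 <= (q - p) / h by rewrite divr_ge0 ?(ltW h0)//; lra.
have /andP[k1l k1r] : k1%:R <= (q - p) / h < k1.+1%:R by exact: truncn_itv.
rewrite ler_pdivlMr// in k0l; rewrite ler_pdivlMr// in k1l.
rewrite ltr_pdivrMr// -[k0.+1%:R]natr1 mulrDl mul1r in k0r.
rewrite ltr_pdivrMr// -[k1.+1%:R]natr1 mulrDl mul1r in k1r.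
have k14 : (4 <= k1)%N.
  rewrite leqNgt; apply/negP => k14.
  have : k1%:R <= 3 :> R by rewrite ler_nat.
  move=> k13; have : k1%:R * h <= 3 * h by rewrite ler_pM2r.
  lra.
have LE : (k1 - 4)%N%:R = k1%:R - 4 :> R by rewrite natrB.
(* Starting at the first node after [p] costs one cell and the width of the windows
   two: [4] leaves a margin. *)
exists k0.+1, (k1 - 4)%N; split.
- rewrite -(ler_nat R) natrD LE -[k0.+1%:R]natr1 -(ler_pM2r h0).
  have : n.+1%:R * h = n.+2%:R * h - h by rewrite -[n.+2%:R in RHS]natr1 mulrDl mul1r addrK.
  rewrite -bah => ->; rewrite !mulrDl mulNr !mul1r; lra.
- have -> : h * (k1 - 4)%N%:R = k1%:R * h - 4 * h by rewrite LE; ring.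
  lra.
- move=> i /andP[i0 i1]; split.
    have : k0.+1%:R * h <= i%:R * h by rewrite ler_pM2r// ler_nat.
    rewrite -[k0.+1%:R]natr1 mulrDl mul1r; lra.
  have : i.+1%:R * h <= (k0.+1%:R + (k1 - 4)%N%:R) * h.
    by rewrite ler_pM2r// -natrD ler_nat.
  rewrite LE -[k0.+1%:R]natr1 -[i.+1%:R]natr1 !mulrDl mulNr !mul1r; lra.
Qed.

End counting.

Lemma norm_second_difference {R : realType} (x y z w : R) :
  `|x| <= 1 -> `|y| <= 1 -> `|z| <= 1 -> `|w| <= 1 -> `|x - y - (z - w)| <= 4.
Proof.
rewrite !ler_norml => /andP[? ?] /andP[? ?] /andP[? ?] /andP[? ?].
by apply/andP; split; lra.
Qed.

Lemma second_differenceC {V : zmodType} (x y z w : V) :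
  x - y - (z - w) = w - z - (y - x).
Proof. by rewrite -[z - w]opprB opprK addrC opprB. Qed.

(** The difference of two window means has a rate bounded through the flux, and
    [excess_chain_rule] applies to it. *)
Lemma excess_difference_rule {R : realType} (delta c : R) (U V x x' y y' : R -> R) (T : R) :
  0 <= T -> 0 < c ->
  measurable_fun `[0, T] U -> measurable_fun `[0, T] V ->
  (forall t, `|x t| <= 1) -> (forall t, `|x' t| <= 1) ->
  (forall t, `|y t| <= 1) -> (forall t, `|y' t| <= 1) ->
  (forall s t, 0 <= s -> leb.-integrable `[s, t] (EFin \o (fun r => c * (x r - x' r)))) ->
  (forall s t, 0 <= s -> leb.-integrable `[s, t] (EFin \o (fun r => c * (y r - y' r)))) ->
  (forall s t, 0 <= s -> s <= t ->
     U s - U t = \int[leb]_(r in `[s, t]) (c * (x r - x' r))) ->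
  (forall s t, 0 <= s -> s <= t ->
     V s - V t = \int[leb]_(r in `[s, t]) (c * (y r - y' r))) ->
  let rate t := 2 * excess delta (U t - V t) * (c * ((x' t - x t) - (y' t - y t))) in
  leb.-integrable `[0, T] (EFin \o rate) /\
  excess delta (U T - V T) ^+ 2 - excess delta (U 0 - V 0) ^+ 2 =
  \int[leb]_(t in `[0, T]) rate t.
Proof.
move=> T0 c0 mU mV x1 x1' y1 y1' Ix Iy UE VE rate.
pose om t := c * ((x' t - x t) - (y' t - y t)).
have omb t : `|om t| <= c * 4.
  by rewrite normrM (gtr0_norm c0) ler_pM2l//; exact: norm_second_difference.
have omE : om = fun r => c * (y r - y' r) - c * (x r - x' r).
  by apply/funext => r; rewrite /om -mulrBr; congr (_ * _); exact: second_differenceC.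
have Iom s t : 0 <= s -> leb.-integrable `[s, t] (EFin \o om).
  by move=> s0; rewrite omE; exact: (integrableB _ (Iy s t s0) (Ix s t s0)).
apply: (@excess_chain_rule _ delta (fun t => U t - V t) om (c * 4) T T0) => //.
- exact: measurable_funB.
- exact: Iom.
- move=> s t s0 st _; rewrite omE RintegralB//; [|exact: Iy|exact: Ix].
  by rewrite -UE// -VE//; ring.
Qed.

Section oscillation.
Context {R : realType}.

(** What the contraction argument uses of a strong solution. The flux is bounded
    by [1] everywhere and not only almost everywhere, and [flow_weak] is the
    equation with time and space separated. *)
Record regular_flow (u Z : R -> R -> R)
    (Du : R -> {charge set (measurableTypeR R) -> \bar R}) (C : R) : Prop := {
  flow_int : slab_int u ;
  flow_cont : forall t K e : R, 0 <= t -> 0 < e -> exists2 d : R, 0 < d &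
    forall s : R, 0 <= s -> `|t - s| < d ->
      \int[leb]_(x in `[- K, K]) `|u s x - u t x| <= e ;
  flow_meas : measurable2 Z ;
  flow_le1 : forall t x, `|Z t x| <= 1 ;
  flow_weak : forall (eta xi : R -> R) (s T K : R), smooth eta -> smooth xi -> 0 < s ->
    (forall t, ~~ (s <= t <= T) -> eta t = 0) -> (forall x, K < `|x| -> xi x = 0) ->
    \int[leb]_t (derive1 eta t * pair (u t) xi) =
    \int[leb]_t (eta t * pair (Z t) (derive1 xi)) ;
  flow_bv : {ae leb, forall t : R, 0 < t ->
    distr_derivative (u t) (Du t) /\ (total_variation_mass (Du t) <= C%:E)%E} ;
  flow_contZ : {ae leb, forall t : R, 0 < t -> continuous (Z t)} ;
  flow_energy : forall tau : R, 0 < tau ->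
    (\int[leb]_(t in `]0%R, tau[) charge_integral (Du t) (Z t) =
     \int[leb]_(t in `]0%R, tau[) total_variation_mass (Du t))%E }.

Variables (u Z : R -> R -> R) (Du : R -> {charge set (measurableTypeR R) -> \bar R}) (C : R).
Hypothesis flow : regular_flow u Z Du C.

Let su := flow_int flow.
Let mZ := flow_meas flow.
Let Z1 := flow_le1 flow.

Let sZ : slab_int Z := bounded_slab_int mZ Z1.
Let lu t : loc_int (u t). Proof. by case: su. Qed.
Let lZ t : loc_int (Z t). Proof. by case: sZ. Qed.

Variables (a b : R).
Hypothesis ab : a < b.

Let mesh0 n : 0 < mesh a b n. Proof. exact: mesh_gt0. Qed.

Lemma ugrid_integrable n k T : 
  leb.-integrable `[0, T] (EFin \o (fun t => ugrid a b (u t) n k)).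
Proof.
have [M wM] := win_weight (node a b n k) (mesh0 n).
exact: (slab_pair_integrable_itv T su wM (lexx 0)).
Qed.

Lemma zgrid_integrable n k T :
  leb.-integrable `[0, T] (EFin \o (fun t => zgrid a b (Z t) n k)).
Proof.
have [M wM] := moll_weight (node a b n k) (mesh0 n).
exact: (slab_pair_integrable_itv T sZ wM (lexx 0)).
Qed.

Lemma ujump_integrable n k T :
  leb.-integrable `[0, T] (EFin \o (fun t => ujump a b (u t) n k)).
Proof.
exact: (integrableB _ (ugrid_integrable n k T) (ugrid_integrable n k.-1 T)).
Qed.

Lemma zjump_integrable n k T :
  leb.-integrable `[0, T] (EFin \o (fun t => zgrid a b (Z t) n k * ujump a b (u t) n k)).
Proof.
rewrite (_ : EFin \o _ = ((EFin \o (fun t => zgrid a b (Z t) n k)) \*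
  (EFin \o (fun t => ujump a b (u t) n k)))%E); last first.
  by apply/funext => t; rewrite /= EFinM.
apply: integrableMr => //; last exact: ujump_integrable.
  by apply/measurable_EFinP; exact: measurable_int (zgrid_integrable n k T).
exists 1; split; first exact: num_real.
by move=> M M1 t _ /=; rewrite (le_trans (zgrid_norm ab _ _ _ _))// ltW.
Qed.

Lemma jump_var_integrable n T :
  leb.-integrable `[0, T] (EFin \o (fun t => jump_var a b (u t) n)).
Proof.
apply: (@Rintegral_sum _ _ R leb nat _ `[0, T] _ _ _).1 => // k.
exact: integrable_norm (ujump_integrable n k T).
Qed.

Lemma jump_z_integrable n T :
  leb.-integrable `[0, T] (EFin \o (fun t => jump_z a b (u t) (Z t) n)).
Proof.
apply: (@Rintegral_sum _ _ R leb nat _ `[0, T] _ _ _).1 => // k.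
exact: zjump_integrable.
Qed.

Lemma pair_derive_win (w : R -> R) (h c : R) : 0 < h -> loc_int w ->
  pair w (derive1 (win h c)) = h^-1 * (pair w (moll h c) - pair w (moll h (c + h))).
Proof.
move=> h0 lw; have [M1 w1] := moll_weight c h0; have [M2 w2] := moll_weight (c + h) h0.
rewrite (is_derive1_funE (is_derive_win h c)).
rewrite (@pairZr _ w (fun x => moll h c x - moll h (c + h) x) _ _ h^-1 lw (weightB w1 w2)).
by rewrite (pairBr lw w1 w2).
Qed.

(** The discrete flow: each window mean moves with the difference quotient of the
    flux. *)
Lemma ugrid_time n k s t : 0 <= s -> s <= t ->
  ugrid a b (u s) n k - ugrid a b (u t) n k =
  \int[leb]_(r in `[s, t])
     ((mesh a b n)^-1 * (zgrid a b (Z r) n k - zgrid a b (Z r) n k.+1)).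
Proof.
move=> s0 st; have h0 := mesh0 n.
have [M [_ _ win0]] := win_weight (node a b n k) h0.
rewrite (time_identity su (flow_cont flow) mZ Z1 (flow_weak flow) (@smooth_win _ _ _) win0 s0 st).
by apply: eq_Rintegral => r _; rewrite (pair_derive_win _ h0 (lZ r)) /zgrid nodeS.
Qed.

Lemma zdiff_integrable n k s t : 0 <= s ->
  leb.-integrable `[s, t] (EFin \o (fun r =>
    (mesh a b n)^-1 * (zgrid a b (Z r) n k - zgrid a b (Z r) n k.+1))).
Proof.
move=> s0; apply: (@integrableZl _ _ _ leb _ _ (mesh a b n)^-1 (EFin \o (fun r =>
   (zgrid a b (Z r) n k - zgrid a b (Z r) n k.+1)))) => //.
have I : leb.-integrable `[0, t] (EFin \o (fun r =>
   (zgrid a b (Z r) n k - zgrid a b (Z r) n k.+1))).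
  exact: (integrableB _ (zgrid_integrable n k t) (zgrid_integrable n k.+1 t)).
by apply: integrableS I => //; apply: subset_itv; rewrite bnd_simp.
Qed.

Variable delta : R.
Hypothesis delta0 : 0 <= delta.

Definition cell_excess n i j t : R := excess delta (ugrid a b (u t) n i - ugrid a b (u t) n j).

Definition cell_excess_rate n i j t : R := 2 * cell_excess n i j t * ((mesh a b n)^-1 *
  ((zgrid a b (Z t) n i.+1 - zgrid a b (Z t) n i) -
   (zgrid a b (Z t) n j.+1 - zgrid a b (Z t) n j))).

Lemma cell_excess_time n i j T : 0 <= T ->
  leb.-integrable `[0, T] (EFin \o cell_excess_rate n i j) /\
  cell_excess n i j T ^+ 2 - cell_excess n i j 0 ^+ 2 = \int[leb]_(t in `[0, T]) cell_excess_rate n i j t.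
Proof.
move=> T0; have hV : 0 < (mesh a b n)^-1 by rewrite invr_gt0.
apply: (@excess_difference_rule R delta (mesh a b n)^-1
  (fun t => ugrid a b (u t) n i) (fun t => ugrid a b (u t) n j)
  (fun t => zgrid a b (Z t) n i) (fun t => zgrid a b (Z t) n i.+1)
  (fun t => zgrid a b (Z t) n j) (fun t => zgrid a b (Z t) n j.+1) T T0 hV).
- by apply/measurable_EFinP; exact: measurable_int (ugrid_integrable n i T).
- by apply/measurable_EFinP; exact: measurable_int (ugrid_integrable n j T).
- by move=> t; exact: zgrid_norm.
- by move=> t; exact: zgrid_norm.
- by move=> t; exact: zgrid_norm.
- by move=> t; exact: zgrid_norm.
- exact: zdiff_integrable.
- exact: zdiff_integrable.
- exact: ugrid_time.
- exact: ugrid_time.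
Qed.

(** Index in the whole grid of the [i]-th cell of [(a, b)]. *)
Definition cell n i := (first_node n + i)%N.

Definition excess_energy n m t : R :=
  \sum_(0 <= i < m.+1) \sum_(0 <= j < m.+1) cell_excess n (cell n i) (cell n j) t ^+ 2.

(** The amount by which the relation [z Du = |Du|] fails on the grid. *)
Definition gap n t : R := jump_var a b (u t) n - jump_z a b (u t) (Z t) n.

Lemma flow_zgrid_norm n k t : `|zgrid a b (Z t) n k| <= 1.
Proof. exact: zgrid_norm. Qed.

(** All the terms of the gap are nonnegative, and the defect keeps those of the
    cells inside [(a, b)]. *)
Lemma defect_le_gap n m t : (m <= n)%N ->
  defect (fun i => ugrid a b (u t) n (cell n i)) (fun i => zgrid a b (Z t) n (cell n i)) m
  <= gap n t.
Proof.
move=> mn; rewrite /gap /jump_var /jump_z -sumrB.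
set f := fun k => `|ujump a b (u t) n k| - zgrid a b (Z t) n k * ujump a b (u t) n k.
have f0 k : 0 <= f k.
  by rewrite /f subr_ge0 (le_trans (ler_norm _))// normrM ler_piMl// flow_zgrid_norm.
have -> : defect (fun i => ugrid a b (u t) n (cell n i))
   (fun i => zgrid a b (Z t) n (cell n i)) m =
   \sum_((first_node n).+1 <= k < (first_node n).+1 + m) f k.
  rewrite -{1}[(first_node n).+1]add0n big_addn addKn /defect.
  apply: eq_bigr => i _; rewrite /f /ujump /cell.
  have -> : (i + (first_node n).+1)%N = (first_node n + i.+1)%N by lia.
  by rewrite addnS.
have nn : ((first_node n).+1 + m <= nnodes n)%N.
  rewrite /nnodes /first_node.
  have : (n.+1 <= n.+1 ^ 2)%N by rewrite -{1}[n.+1]expn1 leq_pexp2l.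
  move: (n.+1 ^ 2)%N => N nn.
  lia.
rewrite [leRHS](big_cat_nat (n := (first_node n).+1)) //=; last first.
  exact: leq_trans (leq_addr m _) nn.
rewrite [X in _ <= _ + X](big_cat_nat (n := (first_node n).+1 + m)) //=; last exact: leq_addr.
rewrite addrCA lerDl; apply: addr_ge0; apply: sumr_ge0 => k _; exact: f0.
Qed.

Lemma gap_ge0 n t : 0 <= gap n t.
Proof.
apply: le_trans (defect_le_gap t (leq0n n)).
by rewrite /defect big_geq.
Qed.

Lemma gap_integrable n T : leb.-integrable `[0, T] (EFin \o gap n).
Proof.
exact: (integrableB _ (jump_var_integrable n T) (jump_z_integrable n T)).
Qed.

Lemma excess_energy_time n m T : (m <= n)%N -> 0 <= T ->
  excess_energy n m T - excess_energy n m 0 <=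
  (mesh a b n)^-1 * (m.+1%:R * 4) * \int[leb]_(t in `[0, T]) gap n t.
Proof.
move=> mn T0; have h0 := mesh0 n; have hV : 0 < (mesh a b n)^-1 by rewrite invr_gt0.
rewrite /excess_energy -sumrB.
under eq_bigr do rewrite -sumrB.
under eq_bigr do under eq_bigr do rewrite (cell_excess_time n _ _ T0).2.
have I i j := (cell_excess_time n (cell n i) (cell n j) T0).1.
have J i := @Rintegral_sum _ _ R leb nat (index_iota 0 m.+1) `[0, T]
   (fun j t => cell_excess_rate n (cell n i) (cell n j) t) (measurable_itv _) (I i).
under eq_bigr do rewrite -(J _).2.
have [JI <-] := @Rintegral_sum _ _ R leb nat (index_iota 0 m.+1) `[0, T]
   (fun i t => \sum_(0 <= j < m.+1) cell_excess_rate n (cell n i) (cell n j) t)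
   (measurable_itv _) (fun i => (J i).1).
rewrite -RintegralZl//; last exact: gap_integrable.
apply: le_Rintegral => //.
  by apply: (@integrableZl _ _ _ leb _ _ _ (EFin \o gap n)) => //; exact: gap_integrable.
move=> t _.
pose U i := ugrid a b (u t) n (cell n i); pose z i := zgrid a b (Z t) n (cell n i).
have := @excess_rate _ delta delta0 U z m (fun i => flow_zgrid_norm n _ t).
rewrite -(ler_pM2l hV) => rate.
apply: (@le_trans _ _ ((mesh a b n)^-1 * (m.+1%:R * (4 * defect U z m)))).
  apply: le_trans rate; rewrite mulr_sumr.
  apply: ler_sum => i _; rewrite mulr_sumr; apply: ler_sum => j _.
  by rewrite /cell_excess_rate mulrCA /z /cell !addnS.
rewrite -!mulrA ler_pM2l// ler_pM2l ?ltr0n// ler_pM2l//.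
exact: defect_le_gap.
Qed.

(** The energy identity, read on the grid. *)
Lemma gap_small T e : 0 < T -> 0 < e ->
  \forall n \near \oo, \int[leb]_(t in `[0, T]) gap n t <= e.
Proof.
move=> T0 e0.
have sub : `]0, T[ `<=` (`[0, T] : set R).
  by move=> t; rewrite /= !in_itv/= => /andP[t0 tT]; rewrite !ltW.
have mT : measurable (`]0, T[ : set R) by [].
have G := @energy_gap R T C (fun t => total_variation_mass (Du t))
  (fun t => charge_integral (Du t) (Z t)) (fun t => Rvariation (Du t)) (fun t => Rcharge_integral (Du t) (Z t))
  (fun n t => jump_var a b (u t) n) (fun n t => jump_z a b (u t) (Z t) n).
have {}G : \forall n \near \oo, \int[leb]_(t in `]0, T[)
    (jump_var a b (u t) n - jump_z a b (u t) (Z t) n) <= e.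
  apply: G => //.
  - by move=> n t; apply: sumr_ge0.
  - by move=> n; apply: integrableS (jump_var_integrable n T).
  - by move=> n; apply: integrableS (jump_z_integrable n T).
  - apply: (ae_mono (ae_and (flow_bv flow) (flow_contZ flow))) => t [DuC cZ]; rewrite /= in_itv/= => /andP[t0 _].
    have [dw TV] := DuC t0; have {}cZ := cZ t0.
    have mZt : measurable_fun setT (Z t) by case: (lZ t).
    split.
    + exact: charge_integralE mZt (Z1 t).
    + exact: RvariationE.
    + move=> n; rewrite (le_trans (jump_z_le ab _ (lu t) dw (lZ t) (Z1 t)))//.
      by rewrite -lee_fin -RvariationE.
    + by move=> n; exact: jump_var_le.
    + exact: jump_z_cvg.
  - exact: (flow_energy flow).
  - apply: (ae_mono (flow_bv flow)) => t H; rewrite /= in_itv/= => /andP[t0 _].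
    by have [] := H t0.
near=> n.
have <- : \int[leb]_(t in `]0, T[) gap n t = \int[leb]_(t in `[0, T]) gap n t.
  have I1 : leb.-integrable `]0, T] (EFin \o gap n).
    by apply: integrableS (gap_integrable n T) => //; apply: subset_itv; rewrite bnd_simp.
  rewrite -(Rintegral_itv_obnd_cbnd I1) Rintegral_itv_bndo_bndc//.
  by apply: integrableS (gap_integrable n T) => //; exact: sub.
by near: n.
Unshelve. all: by end_near. Qed.

Lemma ugrid_ge n k t alpha p q : p <= node a b n k -> node a b n k + 2 * mesh a b n <= q ->
  {ae leb, forall x, p < x < q -> alpha <= u t x} -> alpha <= ugrid a b (u t) n k.
Proof.
move=> pk kq aeu; have h0 := mesh0 n; have [M wM] := win_weight (node a b n k) h0.
rewrite -[alpha]mulr1 -(mass_win (node a b n k) h0).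
apply: (pair_ge_ae (lu t) wM _ (fun x => @win_out R _ _ x h0)).
  by move=> x; exact: win_ge0.
apply: (ae_mono aeu) => x H /andP[x1 x2]; apply: H.
by rewrite (le_lt_trans pk x1) (lt_le_trans x2 kq).
Qed.

Lemma ugrid_le n k t beta p q : p <= node a b n k -> node a b n k + 2 * mesh a b n <= q ->
  {ae leb, forall x, p < x < q -> u t x <= beta} -> ugrid a b (u t) n k <= beta.
Proof.
move=> pk kq aeu; have h0 := mesh0 n; have [M wM] := win_weight (node a b n k) h0.
rewrite -[beta]mulr1 -(mass_win (node a b n k) h0).
apply: (pair_le_ae (lu t) wM _ (fun x => @win_out R _ _ x h0)).
  by move=> x; exact: win_ge0.
apply: (ae_mono aeu) => x H /andP[x1 x2]; apply: H.
by rewrite (le_lt_trans pk x1) (lt_le_trans x2 kq).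
Qed.

(** The support of each window involved lies in [(a, b)], where the values of [u 0]
    are in [[lo, hi]]. *)
Lemma excess_energy0 n m (lo hi : R) : (m < n)%N -> hi - lo <= delta ->
  {ae leb, forall x, a < x < b -> lo <= u 0 x <= hi} -> excess_energy n m 0 = 0.
Proof.
move=> mn hl aeu; have h0 := mesh0 n.
have U0 i : (i <= m)%N -> lo <= ugrid a b (u 0) n (cell n i) <= hi.
  move=> im.
  have ai : a <= node a b n (cell n i) by rewrite node_first lerDl mulr_ge0// ltW.
  have ib : node a b n (cell n i) + 2 * mesh a b n <= b.
    rewrite node_first -addrA -lerBrDl -mulrDl.
    have -> : b - a = n.+1%:R * mesh a b n by rewrite /mesh mulrCA divff ?mulr1// pnatr_eq0.
    by rewrite ler_pM2r// -natrD ler_nat; lia.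
  apply/andP; split.
    by apply: ugrid_ge ai ib _; apply: (ae_mono aeu) => x H /H /andP[].
  by apply: ugrid_le ai ib _; apply: (ae_mono aeu) => x H /H /andP[].
rewrite /excess_energy big_nat big1// => i /andP[_ im]; rewrite big_nat big1// => j /andP[_ jm].
rewrite /cell_excess excess_le0 ?expr0n//.
have /andP[_ ui] := U0 i im; have /andP[uj _] := U0 j jm.
by rewrite (le_trans _ hl)// lerB.
Qed.

(** Otherwise the cells in [(p, q)] and those in [(p', q')], at least half of
    what these intervals can hold, would contribute at least [c / h^2] to the
    excess energy for a constant [c > 0], whereas the energy is at most
    [4 (b - a) / h^2] times the integral of the gap. *)
Lemma oscillation_contraction (lo hi alpha beta p q p' q' T : R) :
  hi - lo <= delta ->
  {ae leb, forall x, a < x < b -> lo <= u 0 x <= hi} ->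
  0 < T -> a <= p -> p < q -> q <= b -> a <= p' -> p' < q' -> q' <= b ->
  {ae leb, forall x, p < x < q -> alpha <= u T x} ->
  {ae leb, forall x, p' < x < q' -> u T x <= beta} ->
  alpha - beta <= delta.
Proof.
move=> hl ae0 T0 ap pq qb ap' pq' qb' aeA aeB.
rewrite leNgt; apply/negP => dab.
pose eps := alpha - beta - delta.
have eps0 : 0 < eps by rewrite subr_gt0.
(* The cells of [(p, q)] and of [(p', q')] number at least [(q - p) / (2 h)] and
   [(q' - p') / (2 h)], and each pair has a squared excess of at least [eps ^ 2]. *)
pose c := eps ^+ 2 * ((q - p) / 2) * ((q' - p') / 2).
have c0 : 0 < c by rewrite !mulr_gt0 ?divr_gt0 ?subr_gt0 ?exprn_gt0.
have ba0 : 0 < b - a by rewrite subr_gt0.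
(* So that [4 (b - a) e] is [c / 2]. *)
pose e := c / (8 * (b - a)).
have e0 : 0 < e by rewrite divr_gt0// mulr_gt0.
have [N [N1 gapN hA hB]] : exists N, [/\ (0 < N)%N,
    \int[leb]_(t in `[0, T]) gap N t <= e, mesh a b N < (q - p) / 10 &
    mesh a b N < (q' - p') / 10].
  near \oo => N; exists N; split; near: N.
  - exact: nbhs_infty_gt.
  - exact: gap_small.
  - by apply: mesh_cvg0; rewrite ?divr_gt0 ?subr_gt0.
  - by apply: mesh_cvg0; rewrite ?divr_gt0 ?subr_gt0.
(* On the grid [n.+1] of [n.+2] cells, the last cell is left out: its window leaves
   [(a, b)]. *)
case: N N1 gapN hA hB => // n _ gapN hA hB; have h0 := mesh0 n.+1.
have bah : b - a = n.+2%:R * mesh a b n.+1.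
  by rewrite /mesh mulrCA divff ?mulr1// pnatr_eq0.
have [|i0 [L [iL hL Hi]]] := cells_inside h0 bah ap qb; first by lra.
have [|j0 [L' [jL hL' Hj]]] := cells_inside h0 bah ap' qb'; first by lra.
have E := excess_energy_time (leqnSn n) (ltW T0).
rewrite (excess_energy0 (ltnSn n) hl ae0) subr0 in E.
have low : eps ^+ 2 * L%:R * L'%:R <= excess_energy n.+1 n T.
  rewrite /excess_energy (big_cat_nat (n := i0)) //=; last first.
    by rewrite (leq_trans (leq_addr L _)).
  rewrite [X in _ + X](big_cat_nat (n := i0 + L)) //=; last exact: leq_addr.
  set S1 := \sum_(0 <= _ < _) _; set S2 := \sum_(i0 <= _ < _) _; set S3 := \sum_(_ <= _ < n.+1) _.
  have S10 : 0 <= S1 by apply: sumr_ge0 => i _; apply: sumr_ge0 => j _; exact: sqr_ge0.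
  have S30 : 0 <= S3 by apply: sumr_ge0 => i _; apply: sumr_ge0 => j _; exact: sqr_ge0.
  suff : eps ^+ 2 * L%:R * L'%:R <= S2 by lra.
  have -> : eps ^+ 2 * L%:R * L'%:R = \sum_(i0 <= i < i0 + L) (eps ^+ 2 * L'%:R).
    by rewrite sumr_const_nat addKn -[RHS]mulr_natr; ring.
  rewrite /S2 big_nat [leRHS]big_nat; apply: ler_sum => i iI.
  rewrite (big_cat_nat (n := j0)) //=; last by rewrite (leq_trans (leq_addr L' _)).
  rewrite [X in _ + X](big_cat_nat (n := j0 + L')) //=; last exact: leq_addr.
  set R1 := \sum_(0 <= _ < _) _; set R2 := \sum_(j0 <= _ < _) _; set R3 := \sum_(_ <= _ < n.+1) _.
  have R10 : 0 <= R1 by apply: sumr_ge0 => j _; exact: sqr_ge0.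
  have R30 : 0 <= R3 by apply: sumr_ge0 => j _; exact: sqr_ge0.
  suff : eps ^+ 2 * L'%:R <= R2 by lra.
  have -> : eps ^+ 2 * L'%:R = \sum_(j0 <= j < j0 + L') (eps ^+ 2).
    by rewrite sumr_const_nat addKn -[RHS]mulr_natr.
  rewrite /R2 big_nat [leRHS]big_nat; apply: ler_sum => j jI.
  have [i1 i2] := Hi i iI; have [j1 j2] := Hj j jI.
  have ui : alpha <= ugrid a b (u T) n.+1 (cell n.+1 i).
    by apply: ugrid_ge aeA; rewrite node_first.
  have uj : ugrid a b (u T) n.+1 (cell n.+1 j) <= beta.
    by apply: ugrid_le aeB; rewrite node_first.
  rewrite lerXn2r ?nnegrE ?excess_ge0 ?(ltW eps0)//.
  by rewrite /cell_excess /excess le_max; apply/orP; left; rewrite lerD2r lerB.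
have := le_trans low E; rewrite leNgt => /negP; apply.
set h := mesh a b n.+1 in h0 bah hA hB hL hL' *.
set I := \int[leb]_(t in `[0, T]) gap n.+1 t in gapN *.
have I0 : 0 <= I by apply: Rintegral_ge0 => t _; exact: gap_ge0.
rewrite -(ltr_pM2l (exprn_gt0 2 h0)).
have -> : h ^+ 2 * (h^-1 * (n.+1%:R * 4) * I) = 4 * (n.+1%:R * h) * I.
  by field; rewrite gt_eqF.
have -> : h ^+ 2 * (eps ^+ 2 * L%:R * L'%:R) = eps ^+ 2 * (h * L%:R) * (h * L'%:R) by ring.
have nh : n.+1%:R * h <= b - a by rewrite bah ler_pM2r// ler_nat.
apply: (@le_lt_trans _ _ (4 * (b - a) * e)).
  apply: ler_pM => //; last by rewrite ler_pM2l.
  by rewrite !mulr_ge0 ?ler0n// ltW.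
apply: (@lt_le_trans _ _ c).
  rewrite /e; have -> : 4 * (b - a) * (c / (8 * (b - a))) = c / 2.
    by field; rewrite gt_eqF.
  by lra.
rewrite /c; apply: ler_pM => //.
- by rewrite mulr_ge0 ?sqr_ge0// divr_ge0// subr_ge0 ltW.
- by rewrite divr_ge0// subr_ge0 ltW.
- by rewrite ler_wpM2l ?sqr_ge0.
Unshelve. all: by end_near. Qed.

End oscillation.
(** * Functions of bounded variation along a set of full measure *)

Section monotone_functions.
Context {R : realType}.
Implicit Types (A B f g : R -> R) (x y : R).

Lemma nondecreasing_cvg_right A x : nondecreasing A -> cvg (A y @[y --> x^'+]).
Proof.
move=> ndA; apply: nondecreasing_at_right_is_cvgr; near=> y.
  by move=> p q _ _; exact: ndA.
exists (A x) => _ [p + <-]; rewrite /= in_itv/= => /andP[xp _].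
exact/ndA/ltW.
Unshelve. all: by end_near. Qed.

Lemma nondecreasing_cvg_left A x : nondecreasing A -> cvg (A y @[y --> x^'-]).
Proof.
move=> ndA; apply: nondecreasing_at_left_is_cvgr; near=> y.
  by move=> p q _ _; exact: ndA.
exists (A x) => _ [p + <-]; rewrite /= in_itv/= => /andP[_ px].
exact/ndA/ltW.
Unshelve. all: by end_near. Qed.

Lemma nondecreasing_ae_no_jump A : nondecreasing A ->
  {ae leb, forall x : R, lim (A y @[y --> x^'-]) = lim (A y @[y --> x^'+])}.
Proof.
move=> ndA.
pose S (n : nat) := [set x | x \in (`]- n%:R, n%:R[ : interval R) /\ discontinuity A x].
have cS : countable (\bigcup_n S n).
  apply: bigcup_countable => // n _; apply: discontinuity_countable.
  by move=> p q _ _; exact: ndA.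
exists (\bigcup_n S n); split.
- exact: countable_measurable.
- exact: countable_lebesgue_measure0.
- move=> x /= jx; exists (Num.bound `|x|) => //=; split.
    by rewrite in_itv/= -ltr_norml archi_boundP.
  by split; [exact: nondecreasing_cvg_left|exact: nondecreasing_cvg_right|exact/eqP].
Qed.

(** Take for [A x] the infimum of [g] over the points of [E] to the right of [x].
    At the points of [E] the value of [g] lies between the left limit of [A] and
    [A x], and these differ at countably many points only. *)
Lemma monotone_extension (E : set R) g m M :
  {ae leb, forall x : R, E x} ->
  (forall x y, E x -> E y -> x <= y -> g x <= g y) ->
  (forall x, E x -> m <= g x <= M) ->
  exists A, [/\ nondecreasing A, right_continuous A, forall x, m <= A x <= M &
    {ae leb, forall x : R, E x -> g x = A x}].
Proof.
move=> aeE gnd gb.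
have Edense x y : x < y -> exists2 z, x < z < y & E z by move=> xy; exact: ae_ex_itv.
pose G x := g @` (E `&` `]x, +oo[).
have Gx x : has_inf (G x).
  split.
    have [z /andP[xz _] Ez] := Edense x (x + 1) ltac:(lra).
    by exists (g z); exists z => //; split => //=; rewrite in_itv/= xz.
  by exists m => _ [z [Ez _] <-]; case/andP: (gb z Ez).
pose A x := inf (G x).
have Ale x z : E z -> x < z -> A x <= g z.
  move=> Ez xz; apply: ge_inf; first exact: (Gx x).2.
  by exists z => //; split => //=; rewrite in_itv/= xz.
have Age x c : (forall z, E z -> x < z -> c <= g z) -> c <= A x.
  move=> H; apply: lb_le_inf; first exact: (Gx x).1.
  by move=> _ [z [Ez +] <-]; rewrite /= in_itv/= andbT; exact: H.
have ndA : nondecreasing A.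
  by move=> x y xy; apply: Age => z Ez yz; apply: Ale => //; exact: le_lt_trans yz.
have rcA : right_continuous A.
  move=> x; apply/cvgrPdist_le => e e0.
  have [_ [z [Ez +] <-] gze] := inf_adherent e0 (Gx x).
  rewrite /= in_itv/= andbT => xz.
  near=> y.
  have yz : y < z by near: y; exact: nbhs_right_lt.
  have xy : x <= y by near: y; exact: nbhs_right_ge.
  have := Ale y z Ez yz; have := ndA _ _ xy; have : g z < A x + e by [].
  by rewrite ler_distlC; move=> *; lra.
exists A; split=> //.
- move=> x; apply/andP; split.
    by apply: Age => z Ez _; case/andP: (gb z Ez).
  have [z /andP[xz _] Ez] := Edense x (x + 1) ltac:(lra).
  by apply: (le_trans (Ale x z Ez xz)); case/andP: (gb z Ez).
- refine (@ae_mono _ _ R leb _ _ (nondecreasing_ae_no_jump ndA) _) => x jx Ex.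
  apply/eqP; rewrite eq_le; apply/andP; split.
    by apply: Age => z Ez xz; apply: gnd => //; exact: ltW.
  rewrite -(cvg_lim (@Rhausdorff R) (rcA x)) -jx.
  apply: limr_le; first exact: nondecreasing_cvg_left.
  by near=> y; apply: Ale => //; near: y; exact: nbhs_left_lt.
Unshelve. all: by end_near. Qed.

(** Finite sequences are indexed by [nat] so that one is extended by modifying its
    values beyond [m]. *)
Definition zigzag f (m : nat) (s : nat -> R) :=
  \sum_(0 <= i < m) `|f (s i.+1) - f (s i)|.

(** The Jordan decomposition [f = (f + V) - V], where [V x] is the variation of [f]
    along the sequences of points of [E] ending at [x]. *)
Lemma bv_decomposition (E : set R) f C :
  {ae leb, forall x : R, E x} ->
  (forall m (s : nat -> R), (forall i, E (s i)) -> (forall i, s i <= s i.+1) ->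
    zigzag f m s <= C) ->
  exists A B M, [/\ nondecreasing A /\ nondecreasing B, right_continuous A /\ right_continuous B,
    forall x, `|A x| <= M /\ `|B x| <= M &
    {ae leb, forall x : R, f x = A x - B x}].
Proof.
move=> aeE vC.
pose S x := [set zigzag f p.1 p.2 | p in [set p : nat * (nat -> R) |
  [/\ forall i, E (p.2 i), forall i, p.2 i <= p.2 i.+1 & p.2 p.1 = x]]].
pose V x := sup (S x).
have S0 x : E x -> S x 0.
  move=> Ex; exists (0%N, fun=> x) => //=; by rewrite /zigzag big_geq.
have Sub x : ubound (S x) C by move=> _ [[m s] [/= Es snd _] <-]; exact: vC.
have hS x : E x -> has_sup (S x).
  by move=> Ex; split; [exists 0; exact: S0|exists C].
have V0 x : E x -> 0 <= V x by move=> Ex; apply: ub_le_sup; [exists C|exact: S0].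
have VC x : E x -> V x <= C by move=> Ex; apply: ge_sup; [exists 0; exact: S0|exact: Sub].
have Vinc x y : E x -> E y -> x <= y -> V x + `|f y - f x| <= V y.
  move=> Ex Ey xy; rewrite -lerBrDr; apply: ge_sup; first by exists 0; exact: S0.
  move=> _ [[m s] [/= Es snd smx] <-]; rewrite lerBrDr; apply: ub_le_sup; first by exists C.
  have smono : {homo s : i j / (i <= j)%N >-> i <= j} by exact/nondecreasing_seqP.
  exists (m.+1, fun i => if (i <= m)%N then s i else y) => /=.
    split=> [i|i|]; last by rewrite ltnn.
      by case: ifP.
    have [im|mi] := leqP i.+1 m; first by rewrite (ltnW im).
    case: ifPn => // im; suff -> : i = m by rewrite smx.
    by apply/eqP; rewrite eqn_leq im -ltnS.
  rewrite /zigzag big_nat_recr//= ltnn leqnn smx; congr (_ + _).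
  rewrite big_nat [RHS]big_nat; apply: eq_bigr => i /andP[_ im].
  by rewrite im (ltnW im).
have [x0 _ Ex0] : exists2 x : R, 0 < x < 1 & E x by apply: ae_ex_itv.
have fC x : E x -> `|f x| <= `|f x0| + C.
  move=> Ex.
  have : `|f x - f x0| <= C.
    have [xx|xx] := leP x x0.
      by rewrite distrC; have := Vinc _ _ Ex Ex0 xx; have := V0 _ Ex; have := VC _ Ex0; lra.
    by have := Vinc _ _ Ex0 Ex (ltW xx); have := V0 _ Ex0; have := VC _ Ex; lra.
  have := ler_normD (f x0) (f x - f x0); rewrite subrKC; lra.
have C0 : 0 <= C by exact: le_trans (V0 _ Ex0) (VC _ Ex0).
pose M := `|f x0| + C + C.
have [A [ndA rcA bA fA]] := @monotone_extension E (fun x => f x + V x) (- M) M aeE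
  ltac:(move=> x y Ex Ey xy; have := Vinc x y Ex Ey xy; have := ler_norm (f x - f y);
        rewrite distrC; lra)
  ltac:(move=> x Ex; have := fC x Ex; rewrite /M ler_norml => /andP[? ?];
        have := V0 x Ex; have := VC x Ex; move=> *; apply/andP; split; lra).
have [B [ndB rcB bB fB]] := @monotone_extension E V (- M) M aeE
  ltac:(move=> x y Ex Ey xy; have := Vinc x y Ex Ey xy; have := normr_ge0 (f y - f x); lra)
  ltac:(move=> x Ex; have := normr_ge0 (f x0); rewrite /M => ?;
        have := V0 x Ex; have := VC x Ex; move=> *; apply/andP; split; lra).
exists A, B, M; split=> //.
  by move=> x; rewrite !ler_norml.
refine (@ae_mono _ _ R leb _ _ (ae_and aeE (ae_and fA fB)) _) => x [Ex [/(_ Ex) <- /(_ Ex) <-]].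
by rewrite addrK.
Qed.

End monotone_functions.
(** * Mollification at Lebesgue points *)

Section lebesgue_points.
Context {R : realType}.
Implicit Types (w phi : R -> R).

Lemma moll_le : exists2 M : R, 0 < M & forall h a x : R, 0 < h -> moll h a x <= M / h.
Proof.
have [M wM] := @continuous_weight R mollifier 1 (smooth_continuous smooth_mollifier)
  ltac:(move=> x x1; apply: mollifier_out; apply/negP => /andP[x0 xlt1];
        move: x1; rewrite gtr0_norm//; lra).
exists (M + 1); first by rewrite ltr_wpDl// (weight_ge0 wM).
move=> h a x h0; rewrite /moll /rescale mulrC ler_wpM2r ?invr_ge0 ?ltW//.
by case: wM => _ /(_ ((x - a) / h)) + _; have := ler_norm (mollifier ((x - a) / h)); lra.
Qed.

Lemma pair_deviation_le w phi (c L M K a r : R) : loc_int w -> weight M K phi -> 0 <= L ->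
  (forall x, 0 <= phi x) -> (forall x, phi x <= L) ->
  (forall x, ~~ (a - r < x < a + r) -> phi x = 0) -> mass phi = 1 ->
  `|pair w phi - c| <= L * \int[leb]_(x in ball a r) `|w x - c|.
Proof.
move=> lw wp L0 p0 pL pout m1.
have lc := loc_int_cst c.
have -> : pair w phi - c = \int[leb]_x (w x * phi x - c * phi x).
  by rewrite RintegralB//; [rewrite -/(pair (cst c) phi) (pair_cst c wp) m1 mulr1|
    exact: pair_integrable lw wp|exact: (pair_integrable lc wp)].
have mB : measurable (ball a r : set R) by exact: measurable_ball.
have lwc : loc_int (fun x => w x - c).
  split; first by apply: measurable_funB => //; case: lw.
  by move=> k; apply: (integrableB _ (lw.2 k) (lc.2 k)).
have I : leb.-integrable (ball a r) (EFin \o (fun x => w x - c)).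
  apply: integrableS (lwc.2 (`|a| + `|r|)) => // x; rewrite /ball/= => xr.
  rewrite -[_ \in _]/(x \in `[- (`|a| + `|r|), `|a| + `|r|]) itv_normE.
  have := ler_normD a (x - a); rewrite subrKC => /le_trans; apply.
  by rewrite lerD2l distrC (le_trans (ltW xr))// ler_norm.
have I1 := pair_integrable lw wp.
have I2 : leb.-integrable setT (fun x => (c * phi x)%:E) by exact: (pair_integrable lc wp).
have I3 : leb.-integrable setT (EFin \o (fun x => w x * phi x - c * phi x)).
  exact: (@integrableB _ _ _ leb _ measurableT (fun x => (w x * phi x)%:E)
    (fun x => (c * phi x)%:E)).
rewrite (le_trans (le_normr_Rintegral _ I3))//.
have -> : \int[leb]_x `|w x * phi x - c * phi x| =
          \int[leb]_(x in ball a r) `|w x * phi x - c * phi x|.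
  rewrite [RHS]Rintegral_mkcond; apply: eq_Rintegral => x _.
  rewrite /patch; case: ifPn => //; rewrite notin_setE /ball/= => /negP xr.
  by rewrite pout ?mulr0 ?subrr ?normr0//; move: xr; rewrite ltr_distlC.
rewrite -RintegralZl//; last exact: integrable_norm.
apply: le_Rintegral => //.
- by apply: integrableS (integrable_norm I3).
- apply: (@integrableZl _ _ _ leb _ mB L (fun x => `|w x - c|%:E)) => //.
  exact: integrable_norm.
- by move=> x _; rewrite -mulrBl normrM mulrC (ger0_norm (p0 x)) ler_wpM2r.
Qed.

(** The mollifier of width [h] is bounded by [M / h] and supported in the ball of
    radius [h]. *)
Lemma lebesgue_pt_moll w (x : R) : loc_int w -> lebesgue_pt w x ->
  pair w (moll n.+1%:R^-1 x) @[n --> \oo] --> w x.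
Proof.
move=> lw lx; have [M M0 mM] := moll_le.
apply/cvgrPdist_le => e e0.
have e1 : (0 < e / (2 * M)) by rewrite divr_gt0// mulr_gt0.
have [d /= d0 H] : \forall r \near 0^'+, (davg w x r <= (e / (2 * M))%:E)%E.
  move/fine_cvgP : lx => [fin_ cv].
  move/cvgrPdist_le : cv => /(_ _ e1) cv; near=> r.
  have F : davg w x r \is a fin_num by near: r.
  rewrite -(fineK F) lee_fin; have : `|0 - fine (davg w x r)| <= e / (2 * M) by near: r.
  by rewrite sub0r normrN; apply: le_trans; exact: ler_norm.
near=> n.
have : n.+1%:R^-1 < d by near: n; exact: near_infty_natSinv_lt (PosNum d0).
set h : R := n.+1%:R^-1 => hd.
have h0 : 0 < h by rewrite invr_gt0 ltr0n.
have [M' wM] := moll_weight x h0.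
have Q : `|pair w (moll h x) - w x| <= M / h * \int[leb]_(y in ball x h) `|w y - w x|.
  apply: (pair_deviation_le (w x) lw wM _ _ _ _ (mass_moll x h0)).
  - exact: divr_ge0 (ltW M0) (ltW h0).
  - by move=> y; exact: moll_ge0.
  - by move=> y; exact: mM.
  - move=> y yN; apply: moll_out => //; apply: contraNN yN => /andP[xy ->]; rewrite andbT.
    by rewrite (lt_trans _ xy)// gtrBl.
rewrite distrC (le_trans Q)//.
have := H h; rewrite /= sub0r normrN gtr0_norm// => /(_ hd h0).
rewrite /davg/= /iavg/= (lebesgue_measure_ball _ (ltW h0))// inver mulrn_eq0/= gt_eqF//.
rewrite lee_pdivrMl; last by rewrite mulrn_wgt0.
set I := (\int[_]_(y in _) _)%E => HI.
have I0 : (0 <= I)%E by apply: integral_ge0.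
have FI : I \is a fin_num.
  by rewrite ge0_fin_numE// (le_lt_trans HI)// -EFinM ltry.
have {HI} : fine I <= h *+ 2 * (e / (2 * M)) by rewrite -lee_fin fineK// EFinM.
rewrite -/(Rintegral leb (ball x h) (fun y => `|w y - w x|)).
change (fine I) with (\int[leb]_(y in ball x h) `|w y - w x|).
move: (\int[leb]_(y in ball x h) `|w y - w x|) => J HJ.
have : M / h * J <= M / h * (h *+ 2 * (e / (2 * M))).
  by rewrite ler_wpM2l// divr_ge0 ?ltW.
move=> /le_trans; apply; rewrite le_eqVlt; apply/orP; left; apply/eqP.
rewrite -mulr_natl; field; lra.
Unshelve. all: by end_near. Qed.

End lebesgue_points.
(** * Variation of mollified functions *)

Section total_variation_bound.
Context {R : realType}.
Implicit Types (w : R -> R) (nu : {charge set (measurableTypeR R) -> \bar R}).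

(** The increment of the mollified function between two points is the integral
    against [nu] of the difference of two smooth steps. These differences are
    nonnegative along a nondecreasing sequence and telescope to at most [1]. *)
Lemma zigzag_mollified w nu (h : R) m (s : nat -> R) : loc_int w -> 0 < h ->
  (forall i, s i <= s i.+1) -> distr_derivative w nu ->
  zigzag (fun x => pair w (moll h x)) m s <= Rvariation nu.
Proof.
move=> lw h0 snd dw.
pose phi i x := rescale smooth_step h (s i) x - rescale smooth_step h (s i.+1) x.
have sphi i : smooth (phi i).
  by apply: smoothB; apply: smooth_rescale; exact: smooth_smooth_step.
have D i : derive1 (phi i) = fun x => moll h (s i) x - moll h (s i.+1) x.
  apply: is_derive1_funE => x.
  exact: (is_deriveB (is_derive_step h (s i) x) (is_derive_step h (s i.+1) x)).
have pe i : pair w (moll h (s i.+1)) - pair w (moll h (s i)) = Rcharge_integral nu (phi i).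
  have [M1 w1] := moll_weight (s i) h0; have [M2 w2] := moll_weight (s i.+1) h0.
  rewrite -opprB -(pairBr lw w1 w2) -D.
  rewrite (distr_pair (K := `|s i| + `|s i.+1| + h) lw (sphi i) _ dw) ?opprK// => x xK.
  have h1 := h0; have := ler_norm (s i); have := ler_norm (s i.+1).
  have := ler_norm (- s i); have := ler_norm (- s i.+1); rewrite !normrN => n1 n2 n3 n4.
  have := normr_ge0 (s i); have := normr_ge0 (s i.+1) => n5 n6.
  rewrite /phi /rescale.
  have [x0|x0] := leP 0 x.
    move: xK; rewrite (ger0_norm x0) => xK.
    by rewrite !smooth_step_ge1 ?subrr// ler_pdivlMr//; lra.
  move: xK; rewrite (ltr0_norm x0) => xK.
  by rewrite !smooth_step_le0 ?subrr//; apply: mulr_le0_ge0; rewrite ?invr_ge0; lra.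
rewrite /zigzag (eq_bigr (fun i => `|Rcharge_integral nu (phi i)|)); last by move=> i _; rewrite pe.
apply: sum_norm_Rcharge_integral => [i|i x|x].
- by apply: continuous_measurable_fun; exact/smooth_continuous/sphi.
- rewrite subr_ge0; apply: smooth_step_nondecreasing; rewrite ler_wpM2r ?invr_ge0 ?(ltW h0)//.
  exact: lerB.
- have -> : \sum_(0 <= i < m) phi i x =
      rescale smooth_step h (s 0%N) x - rescale smooth_step h (s m) x.
    rewrite -[LHS]opprK -sumrN.
    rewrite (eq_bigr (fun i => rescale smooth_step h (s i.+1) x - rescale smooth_step h (s i) x)).
      by rewrite (telescope_sumr (fun i => rescale smooth_step h (s i) x))// opprB.
    by move=> i _; rewrite opprB.
  have /andP[_] := smooth_step01 ((x - s 0%N) / h); have /andP[+ _] := smooth_step01 ((x - s m) / h).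
  rewrite /rescale; lra.
Qed.

Lemma lebesgue_pt_zigzag w C m (s : nat -> R) :
  (forall i, pair w (moll n.+1%:R^-1 (s i)) @[n --> \oo] --> w (s i)) ->
  (forall n, zigzag (fun x => pair w (moll n.+1%:R^-1 x)) m s <= C) ->
  zigzag w m s <= C.
Proof.
move=> cv zC.
have L : zigzag (fun x => pair w (moll n.+1%:R^-1 x)) m s @[n --> \oo] --> zigzag w m s.
  rewrite /zigzag; elim: m {zC} => [|k IH].
    by rewrite big_geq//; under eq_fun do rewrite big_geq//; exact: cvg_cst.
  rewrite big_nat_recr//=; under eq_fun do rewrite big_nat_recr//=.
  by apply: cvgD => //; apply: cvg_norm; exact: cvgB.
rewrite -(cvg_lim (@Rhausdorff R) L); apply: limr_le; last exact: nearW.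
by apply/cvg_ex; exists (zigzag w m s).
Qed.

End total_variation_bound.
(** * Stieltjes measures and distributional derivatives *)

Section stieltjes.
Context {R : realType}.
Implicit Types (f A B phi : R -> R) (K M : R).
Local Notation fmeasure := {finite_measure set (measurableTypeR R) -> \bar R}.

Lemma stieltjes_measure A M : nondecreasing A -> right_continuous A ->
  (forall x, `|A x| <= M) ->
  exists m : fmeasure, forall a b, a <= b -> m `]a, b]%classic = (A b - A a)%:E.
Proof.
move=> ndA rcA bA.
pose isC := isCumulative.Build R _ R A ndA rcA.
pose cA : cumulative R R := HB.pack A isC.
pose m := lebesgue_stieltjes_measure cA.
have m_oc a b : a <= b -> m `]a, b]%classic = (A b - A a)%:E.
  move=> ab; rewrite /m /lebesgue_stieltjes_measure /measure_extension.
  by rewrite measurable_mu_extE/=; [rewrite wlength_itv_bnd|exact: is_ocitv].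
have mT : (m setT <= (M + M)%:E)%E.
  rewrite -(bigcup_itvT false false).
  have cv : (m \o (fun n => `]- n%:R, n%:R]%classic)) n @[n --> \oo] -->
      m (\bigcup_n `]- n%:R, n%:R]%classic).
    apply: nondecreasing_cvg_mu => //; first exact: bigcup_measurable.
    by move=> i j ij; apply/subsetPset/subset_itv; rewrite leBSide/= ?lerN2 ler_nat.
  rewrite -(cvg_lim _ cv)//; apply: lime_le; first by apply/cvg_ex; eexists; exact: cv.
  apply: nearW => n /=; rewrite m_oc ?ge0_cp// lee_fin.
  have := bA n%:R; have := bA (- n%:R); rewrite !ler_norml => /andP[? ?] /andP[? ?]; lra.
have fm : fin_num_fun m.
  apply: lty_fin_num_fun; exact: le_lt_trans mT (ltry _).
pose isF := Measure_isFinite.Build _ _ _ m fm.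
pose fmm : fmeasure := HB.pack (lebesgue_stieltjes_measure cA) isF.
by exists fmm.
Qed.

(** The fundamental theorem of calculus up to a point beyond the support. *)
Lemma derive1_tail_integral phi (phi' : R -> R) K x : (forall x : R, is_derive x 1 phi (phi' x)) ->
  continuous phi' -> (forall y, K < `|y| -> phi y = 0) -> (forall y, K < `|y| -> phi' y = 0) ->
  0 <= K -> \int[leb]_(y in `[x, +oo[) phi' y = - phi x.
Proof.
move=> D c' p0 p'0 K0; have [Kx|xK] := ltP K x.
  have xK : K < `|x| by rewrite gtr0_norm// (le_lt_trans K0).
  rewrite p0// oppr0; under eq_Rintegral.
    move=> y; rewrite inE/= in_itv/= andbT => xy.
    by rewrite p'0; [over|rewrite (lt_le_trans Kx)// (le_trans xy)// ler_norm].
  by rewrite Rintegral_cst// mul0r.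
have xK1 : x < K + 1 by rewrite (le_lt_trans xK)// ltrDl.
transitivity (\int[leb]_(y in `[x, K + 1]) phi' y).
  rewrite Rintegral_mkcond [RHS]Rintegral_mkcond; apply: eq_Rintegral => y _.
  rewrite /patch !mem_setE/= !in_itv/= andbT.
  have [xy|xy] := leP x y => //=; case: ifPn => //; rewrite -ltNge => Ky.
  by rewrite p'0// (lt_le_trans _ (ler_norm _))// (lt_trans _ Ky)// ltrDl.
have cphi : continuous phi.
  move=> y; apply/differentiable_continuous/derivable1_diffP.
  exact: (@ex_derive _ _ _ _ _ _ _ (D y)).
rewrite /Rintegral (continuous_FTC2 xK1 (F := phi)) //.
- have -> : phi (K + 1) = 0 by apply: p0; rewrite gtr0_norm; lra.
  by rewrite -EFinB/= sub0r.
- exact: continuous_subspaceT.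
- split.
  + by move=> y _; exact: (@ex_derive _ _ _ _ _ _ _ (D y)).
  + exact/cvg_at_right_filter/cphi.
  + exact/cvg_at_left_filter/cphi.
- by move=> y _; rewrite derive1E derive_val.
Qed.

(** Fubini for [phi' y] over the set of [(x, y)] with [a < x <= y], where [a] is to
    the left of the support: integrating in [x] first gives [A y - A a], and
    integrating in [y] first gives [- phi x]. *)
Lemma stieltjes_by_parts A (m : fmeasure) phi K : loc_int A ->
  (forall a b, a <= b -> m `]a, b]%classic = (A b - A a)%:E) ->
  smooth phi -> 0 < K -> (forall x, K < `|x| -> phi x = 0) ->
  pair A (derive1 phi) = - \int[m]_x phi x.
Proof.
move=> lA mE sphi K0 phi0; set phi' := derive1 phi.
have [N w'] := weight_derive1 sphi phi0; rewrite -/phi' in w'.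
have [mphi' phi'N phi'0] := w'.
have D (x : R) : is_derive x 1 phi (phi' x) by exact: is_derive_smooth.
have c' : continuous phi' by exact/smooth_continuous/smooth_derive1.
have N0 := weight_ge0 w'.
(* Any point strictly to the left of the support of [phi]. *)
pose a := - K - 1.
pose h (p : R * R) : R := if (a < p.1) && (p.1 <= p.2) then phi' p.2 else 0.
have mh : measurable_fun [set: measurableTypeR R * R] (h : measurableTypeR R * R -> R).
  apply: measurable_fun_ifT => //.
    apply: measurable_and; first exact: measurable_fun_ltr.
    exact: (measurable_fun_ler measurable_fst measurable_snd).
  exact: (measurableT_comp mphi' measurable_snd).
pose S : set (measurableTypeR R * R) := setT `*` `[- K, K].
have mS : measurable S by exact: measurableX.
have Slty : ((m \x leb)%E S < +oo)%E.
  rewrite product_measure1E//= lebesgue_measure_itv/= lte_fin gtrN//.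
  by rewrite lte_mul_pinfty ?fin_num_measure// ltry.
have Ih : (m \x leb)%E.-integrable setT (EFin \o h).
  have : (m \x leb)%E.-integrable S (EFin \o h).
    apply: measurable_bounded_integrable => //; first exact: measurable_funTS.
    exists N; split; first exact: num_real.
    move=> M NM p _ /=; rewrite (le_trans _ (ltW NM))// /h.
    by case: ifP; rewrite ?normr0.
  rewrite integrable_mkcond//; congr (_.-integrable _ _); apply/funext => p.
  rewrite /patch; case: ifPn => //; rewrite notin_setE /S /= => /not_andP[//|/negP].
  rewrite -[_ \in _]/(p.2 \in `[- K, K]) itv_normE -ltNge => Kp.
  by rewrite /h phi'0// if_same.
have E := Fubini Ih.
have EL : (\int[m]_x \int[leb]_y (EFin \o h) (x, y))%E = (- \int[m]_x phi x)%:E.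
  transitivity (\int[m]_x (- phi x)%:E)%E.
    apply: eq_integral => x _.
    have T := @derive1_tail_integral phi phi' K x D c' phi0 phi'0 (ltW K0).
    have [ax|xa] := ltP a x; last first.
      rewrite phi0; last by rewrite /a in xa; rewrite ler0_norm; lra.
      under eq_integral do rewrite /h/= ltNge xa/=.
      by rewrite integral0 oppr0.
    rewrite -T /Rintegral integral_mkcond fineK.
      apply: eq_integral => y _; rewrite /h/= ax/= /patch mem_setE/= in_itv/= andbT.
      by case: ifP.
    rewrite -integral_mkcond; apply: integrable_fin_num => //.
    have := pair_integrable (loc_int_cst 1) w'.
    under eq_fun do rewrite mul1r.
    by apply: integrableS.
  have [B [mphi phiB _]] := continuous_weight (smooth_continuous sphi) phi0.
  have I := finite_bounded_integrable m mphi phiB.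
  rewrite /Rintegral EFinN fineK; last exact: integrable_fin_num.
  by rewrite -integralN//; exact: integrable_add_def.
have ER : (\int[leb]_y \int[m]_x (EFin \o h) (x, y))%E = (pair A phi')%:E.
  have lAa : loc_int (fun x => A x - A a).
    split; first by apply: measurable_funB => //; case: lA.
    by move=> k; apply: (integrableB _ (lA.2 k) ((loc_int_cst (A a)).2 k)).
  transitivity (\int[leb]_y ((A y - A a) * phi' y)%:E)%E.
    apply: eq_integral => y _.
    have [ya|ay] := ltP y a.
      rewrite phi'0; last by rewrite /a in ya; rewrite ltr0_norm; lra.
      rewrite mulr0; apply: integral0_eq => x _ /=; rewrite /h/=; case: ifP => // /andP[ax xy].
      by have := lt_le_trans ax xy; rewrite ltNge (ltW ya).
    transitivity (\int[m]_(x in `]a, y]) (phi' y)%:E)%E.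
      rewrite [RHS]integral_mkcond; apply: eq_integral => x _.
      by rewrite /h/= /patch mem_setE/= in_itv/=; case: ifP.
    rewrite integral_cst//; transitivity ((phi' y)%:E * (A y - A a)%:E)%E.
      by congr (_ * _)%E; exact: mE.
    by rewrite -EFinM mulrC.
  rewrite -[LHS]fineK; last exact: integrable_fin_num (pair_integrable lAa w').
  congr (_%:E); rewrite -[LHS]/(pair (fun y => A y - A a) phi').
  have -> : pair (fun y => A y - A a) phi' = pair A phi' - pair (cst (A a)) phi'.
    rewrite /pair -RintegralB//; [|exact: pair_integrable lA w'|exact: pair_integrable (loc_int_cst _) w'].
    by apply: eq_Rintegral => x _; rewrite mulrBl.
  have K1 : 0 < K + 1 by rewrite ltr_wpDl ?ltW.
  have w1 := weightW (lexx N) (ltW (ltr_pwDr ltr01 (lexx K))) w'.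
  rewrite (pair_cst _ w') (mass_antiderivative K1 c' w1 D).
  by rewrite !phi0 ?subrr ?mulr0 ?subr0// ?normrN gtr0_norm// ltrDl.
by apply: EFin_inj; rewrite -EL -ER; exact/esym.
Qed.

Definition measure_difference (m1 m2 : fmeasure) : {charge set (measurableTypeR R) -> \bar R} :=
  cadd (charge_of_finite_measure m1) (copp (charge_of_finite_measure m2)).

(** [m1] and [m2] need not be the Jordan parts of their difference, but adding the
    negative parts to both sides gives an equality of measures. *)
Lemma charge_integral_difference (m1 m2 : fmeasure) phi M :
  measurable_fun setT phi -> (forall x, `|phi x| <= M) ->
  charge_integral (measure_difference m1 m2) phi = (\int[m1]_x phi x - \int[m2]_x phi x)%:E.
Proof.
move=> mphi phiM; set nu := measure_difference m1 m2.
pose Jp : fmeasure := jordan_pos (hahn_posneg nu).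
pose Jn : fmeasure := jordan_neg (hahn_posneg nu).
have I (m : fmeasure) := finite_bounded_integrable m mphi phiM.
rewrite (charge_integralE nu mphi phiM) /Rcharge_integral -/Jp -/Jn; congr (_%:E).
have E : (\int[m1]_x (phi x)%:E + \int[Jn]_x (phi x)%:E =
          \int[Jp]_x (phi x)%:E + \int[m2]_x (phi x)%:E)%E.
  rewrite -(integral_measure_add measurableT (I m1) (I Jn)).
  rewrite -(integral_measure_add measurableT (I Jp) (I m2)).
  apply: eq_measure_integral => S mS _.
  transitivity (m1 S + Jn S)%E; first exact: measure_addE.
  transitivity (Jp S + m2 S)%E; last exact/esym/measure_addE.
  have H : (m1 S - m2 S = Jp S + (-1)%:E * Jn S)%E := jordan_decomp (hahn_posneg nu) mS.
  rewrite mulN1e in H; move: H.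
  rewrite -(fineK (fin_num_measure m1 _ mS)) -(fineK (fin_num_measure m2 _ mS)).
  rewrite -(fineK (fin_num_measure Jp _ mS)) -(fineK (fin_num_measure Jn _ mS)).
  move: (fine (m1 S)) (fine (m2 S)) (fine (Jp S)) (fine (Jn S)) => a b c d.
  by rewrite -!EFinB -!EFinD => -[H]; congr (_%:E); lra.
have F (m : fmeasure) : (\int[m]_x (phi x)%:E)%E = (\int[m]_x phi x)%:E.
  by have Im := I m; rewrite /Rintegral fineK//; exact: integrable_fin_num.
move: E; rewrite !F -!EFinD => -[]; lra.
Qed.

Lemma test_function_smooth phi : test_function phi ->
  smooth phi /\ exists2 K, 0 < K & forall x, K < `|x| -> phi x = 0.
Proof.
move=> [sphi cphi]; split=> //.
have [M [_ HM]] := compact_bounded cphi.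
have K0 : 0 < `|M| + 1 by rewrite ltr_wpDl.
exists (`|M| + 1) => // x Kx; apply/eqP/negPn/negP => phix.
have : `|x| <= `|M| + 1.
  apply: (HM (`|M| + 1)); first by rewrite (le_lt_trans (ler_norm _))// ltrDl.
  exact: subset_closure.
by rewrite leNgt Kx.
Qed.

Lemma monotone_loc_int A M : nondecreasing A -> (forall x, `|A x| <= M) -> loc_int A.
Proof.
move=> ndA bA.
have mA : measurable_fun setT A by exact: nondecreasing_measurable.
split=> // K; apply: measurable_bounded_integrable => //.
- rewrite [X in (X < _)%E](@lebesgue_measure_itv R `[- K, K])/=.
  by case: ifP => _; rewrite -?EFinB ltry.
- exact: measurable_funTS.
- exists M; split; first exact: num_real.
  by move=> N MN x _ /=; rewrite (le_trans (bA x))// ltW.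
Qed.

Lemma monotone_difference_bv f A B M : loc_int f ->
  nondecreasing A -> nondecreasing B -> right_continuous A -> right_continuous B ->
  (forall x, `|A x| <= M) -> (forall x, `|B x| <= M) ->
  {ae leb, forall x : R, f x = A x - B x} ->
  exists nu, distr_derivative f nu.
Proof.
move=> lf ndA ndB rcA rcB bA bB fAB.
have [mA mAE] := stieltjes_measure ndA rcA bA.
have [mB mBE] := stieltjes_measure ndB rcB bB.
have lA := monotone_loc_int ndA bA; have lB := monotone_loc_int ndB bB.
exists (measure_difference mA mB) => phi /test_function_smooth[sphi [K K0 phi0]].
have [N [mphi phiN _]] := continuous_weight (smooth_continuous sphi) phi0.
have [N' w'] := weight_derive1 sphi phi0.
rewrite (charge_integral_difference mA mB mphi phiN).
have -> : (\int[leb]_x (f x * derive1 phi x)%:E =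
           \int[leb]_x ((A x - B x) * derive1 phi x)%:E)%E.
  apply: ae_eq_integral => //.
  - exact: measurable_int (pair_integrable lf w').
  - apply/measurable_EFinP; apply: measurable_funM; last by case: w'.
    by apply: measurable_funB; [case: lA|case: lB].
  - refine (@ae_mono _ _ R leb _ _ fAB _) => x E _; by rewrite E.
under eq_integral do rewrite mulrBl EFinB.
rewrite (@integralB _ _ _ leb _ _ (fun x => (A x * derive1 phi x)%:E)
  (fun x => (B x * derive1 phi x)%:E))//; [|exact: pair_integrable lA w'|exact: pair_integrable lB w'].
have F g : loc_int g -> (\int[leb]_x (g x * derive1 phi x)%:E)%E = (pair g (derive1 phi))%:E.
  by move=> lg; rewrite /pair /Rintegral fineK//; exact: integrable_fin_num (pair_integrable lg w').
rewrite (F A lA) (F B lB) (stieltjes_by_parts lA mAE sphi K0 phi0).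
rewrite (stieltjes_by_parts lB mBE sphi K0 phi0) -EFinB -EFinN; congr (_%:E).
by rewrite opprB opprK addrC.
Qed.

Lemma loc_int_locally_integrable f : loc_int f -> locally_integrable setT f.
Proof.
move=> [mf intf]; split=> //; first exact: openT.
move=> C _ cC; have [M [_ HM]] := compact_bounded cC.
have H : C `<=` `[- (`|M| + 1), `|M| + 1].
  move=> x Cx; rewrite -[_ _]/(is_true (x \in `[- (`|M| + 1), `|M| + 1])) itv_normE.
  by apply: (HM (`|M| + 1)) => //; rewrite (le_lt_trans (ler_norm _))// ltrDl.
have mC : measurable C by apply: closed_measurable; apply: compact_closed => //; exact: Rhausdorff.
have I : leb.-integrable C (EFin \o f) by apply: integrableS (intf (`|M| + 1)).
by have /integrableP[_] := I.
Qed.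

Lemma bv_good_representative f A B M : loc_int f ->
  nondecreasing A -> nondecreasing B -> right_continuous A -> right_continuous B ->
  (forall x, `|A x| <= M) -> (forall x, `|B x| <= M) ->
  {ae leb, forall x : R, f x = A x - B x} ->
  good_representative f (fun x => A x - B x).
Proof.
move=> lf ndA ndB rcA rcB bA bB fAB; split=> //.
  split; first exact: loc_int_locally_integrable.
  exact: (monotone_difference_bv lf ndA ndB rcA rcB bA bB fAB).
move=> x; exists (lim (A y @[y --> x^'-]) - lim (B y @[y --> x^'-])), (A x - B x); split.
- by apply: cvgB; exact: nondecreasing_cvg_left.
- by apply: cvgB; [exact: rcA|exact: rcB].
- by rewrite ge_min le_max !lexx !orbT.
Qed.

End stieltjes.
(** * Bounded variation at every time *)

Section flow_bounded_variation.
Context {R : realType}.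
Variables (u Z : R -> R -> R) (Du : R -> {charge set (measurableTypeR R) -> \bar R}) (C : R).
Hypothesis flow : regular_flow u Z Du C.

(** A finite sum of pairings with fixed weights is continuous in time. *)
Lemma zigzag_continuous (h t e : R) m (s : nat -> R) : 0 < h -> 0 <= t -> 0 < e ->
  exists2 d, 0 < d & forall r, 0 <= r -> `|t - r| < d ->
    zigzag (fun x => pair (u t) (moll h x)) m s <=
    zigzag (fun x => pair (u r) (moll h x)) m s + m%:R * (2 * e).
Proof.
move=> h0 t0 e0.
have P i : exists2 d, 0 < d & forall r, 0 <= r -> `|t - r| < d ->
    `|pair (u r) (moll h (s i)) - pair (u t) (moll h (s i))| <= e.
  have [M wM] := moll_weight (s i) h0.
  exact: (pair_continuous (flow_int flow) (flow_cont flow) wM t0 e0).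
elim: m => [|m [d d0 IH]].
  by exists 1 => // r _ _; rewrite /zigzag !big_geq// add0r mul0r.
have [d1 d10 H1] := P m; have [d2 d20 H2] := P m.+1.
exists (Num.min d (Num.min d1 d2)); first by rewrite !lt_min d0 d10.
move=> r r0; rewrite !lt_min => /andP[/(IH _ r0) IHr /andP[/(H1 _ r0) + /(H2 _ r0)]].
move: IHr; rewrite /zigzag !big_nat_recr//= mulrS mulrDl mul1r.
move: (\sum_(0 <= i < m) _) (\sum_(0 <= i < m) _) => X Y.
move: (pair (u r) (moll h (s m))) (pair (u r) (moll h (s m.+1))).
move: (pair (u t) (moll h (s m))) (pair (u t) (moll h (s m.+1))) => a b c d'.
move: (m%:R * (2 * e)) => k XY ac bd.
have := ler_normD (d' - c) ((b - d') + (c - a)).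
have := ler_normD (b - d') (c - a).
have -> : d' - c + (b - d' + (c - a)) = b - a by ring.
rewrite (distrC b d'); lra.
Qed.

(** The bound holds at almost every time by duality with [Du], and passes to every
    time by continuity of the left side. *)
Lemma flow_zigzag (h t : R) m (s : nat -> R) : 0 < h -> 0 <= t ->
  (forall i, s i <= s i.+1) -> zigzag (fun x => pair (u t) (moll h x)) m s <= C.
Proof.
move=> h0 t0 snd; apply/ler_addgt0Pr => e e0.
have e1 : 0 < e / (2 * m.+1%:R) by rewrite divr_gt0// mulr_gt0.
have [d d0 H] := zigzag_continuous m s h0 t0 e1.
have [r /andP[tr rd] Hr] : exists2 r : R, t < r < t + d & 0 < r ->
    distr_derivative (u r) (Du r) /\ (total_variation_mass (Du r) <= C%:E)%E.
  by apply: ae_ex_itv; [rewrite ltrDl|exact: flow_bv flow].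
have r0 : 0 < r by exact: le_lt_trans tr.
have [dr TC] := Hr r0.
have [_ lu _] := flow_int flow.
have Z1 := zigzag_mollified m (lu r) h0 snd dr.
have Z2 : Rvariation (Du r) <= C by rewrite -lee_fin -RvariationE.
have Z3 := H r (ltW r0) ltac:(rewrite distrC gtr0_norm ?subr_gt0//; lra).
have Z4 : m%:R * (2 * (e / (2 * m.+1%:R))) <= e.
  have -> : m%:R * (2 * (e / (2 * m.+1%:R))) = m%:R / m.+1%:R * e.
    have m1 : m.+1%:R != 0 :> R by rewrite pnatr_eq0.
    by field.
  by rewrite ler_piMl ?(ltW e0)// ler_pdivrMr// mul1r ler_nat.
apply: (le_trans Z3); apply: lerD Z4; exact: le_trans Z1 Z2.
Qed.

Lemma flow_good_representative (t : R) : 0 <= t -> exists v, good_representative (u t) v.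
Proof.
move=> t0; have [_ lu _] := flow_int flow.
have aeL := lebesgue_differentiation (loc_int_locally_integrable (lu t)).
have [|A [B [M [[ndA ndB] [rcA rcB] AB fAB]]]] :=
    @bv_decomposition R [set x : R | lebesgue_pt (u t) x] (u t) C aeL.
  move=> m s Es snd; apply: lebesgue_pt_zigzag => [i|n].
    exact: (lebesgue_pt_moll (lu t) (Es i)).
  by apply: flow_zigzag => //; rewrite invr_gt0.
exists (fun x => A x - B x); apply: (bv_good_representative (M := M)) => //.
- by move=> x; case: (AB x).
- by move=> x; case: (AB x).
Qed.

End flow_bounded_variation.
(** * Strong solutions as regular flows *)

Section from_strong_solutions.
Context {R : realType}.

(** The product measure of a set is the integral of the measures of its sections. *)
Lemma ae_section (P : R * R -> Prop) : {ae leb2, forall p : R * R, P p} ->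
  {ae leb, forall t : R, {ae leb, forall x : R, P (t, x)}}.
Proof.
move=> [N [mN N0 PN]].
have mx := @measurable_fun_xsection _ _ _ _ R (@lebesgue_measure R) N mN.
have : (\int[leb]_t `|(leb \o xsection N) t| = 0)%E.
  by rewrite -[RHS]N0; apply: eq_integral => t _; rewrite gee0_abs.
move/(ae_eq_integral_abs _ measurableT mx) => H.
refine (@ae_mono _ _ R leb _ _ H _) => t /(_ Logic.I) /= Nt0.
exists (xsection N t); split => //; first exact: measurable_xsection.
by move=> x /= nP; rewrite /xsection/= inE; exact: PN.
Qed.

Lemma continuous_ae_le1 (z : R -> R) : continuous z ->
  {ae leb, forall x : R, `|z x| <= 1} -> forall x, `|z x| <= 1.
Proof.
move=> cz z1 x; rewrite leNgt; apply/negP => zx.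
have [d /= d0 H] : \forall y \near x, 1 < `|z y|.
  have cn : `|z y| @[y --> x] --> `|z x| by apply: cvg_norm; exact: cz.
  by move/cvgr_gt : cn; apply.
have [y /andP[xy yd]] : exists2 y, x < y < x + d & `|z y| <= 1.
  by apply: ae_ex_itv => //; rewrite ltrDl.
rewrite leNgt => /negP; apply; apply: H => /=.
by rewrite distrC gtr0_norm ?subr_gt0//; lra.
Qed.

Definition clamp (r : R) : R := Num.max (- 1) (Num.min 1 r).

Lemma clamp_le1 r : `|clamp r| <= 1.
Proof. by rewrite ler_norml /clamp le_max lexx/= ge_max ge_min lexx andbT; lra. Qed.

Lemma clamp_id r : `|r| <= 1 -> clamp r = r.
Proof. by rewrite ler_norml /clamp => /andP[r1 r2]; rewrite min_r// max_r. Qed.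

(** Equal to [z] almost everywhere on the half plane, and everywhere on the sections
    [z t] that are continuous. *)
Definition clamped_flux (z : R -> R -> R) (t x : R) : R := if 0 < t then clamp (z t x) else 0.

Lemma measurable_clamped_flux (z : R -> R -> R) :
  measurable_fun half_plane (fun p => z p.1 p.2) -> measurable2 (clamped_flux z).
Proof.
move=> mz; apply: measurable_fun_if => //.
- by apply: measurable_fun_ltr => //; exact: measurable_fst.
- rewrite setTI; apply: measurable_maxr => //; apply: measurable_minr => //.
  apply: measurable_funS mz; first by apply: measurableX.
  by move=> p /= p0; split => //=; rewrite in_itv/= p0.
Qed.

Lemma half_plane_Rintegral_ae (f g : R * R -> R) :
  {ae leb2, forall p : R * R, half_plane p -> f p = g p} ->
  \int[leb2]_(p in half_plane) f p = \int[leb2]_(p in half_plane) g p.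
Proof.
move=> fg; rewrite /Rintegral; congr fine; apply: ae_eq_lower_integral.
by refine (@ae_mono _ _ R leb2 _ _ fg _) => p E hp; rewrite E.
Qed.

Lemma support_weight (eta : R -> R) (s T : R) : continuous eta ->
  (forall t, ~~ (s <= t <= T) -> eta t = 0) -> exists N, weight N (`|s| + `|T|) eta.
Proof.
move=> ceta eta0; apply: continuous_weight => // t tK; apply: eta0.
apply/negP => /andP[st tT]; move: tK; rewrite ltNge => /negP; apply.
rewrite ler_norml; have := ler_norm T; have := ler_norm (- s).
rewrite normrN; have := normr_ge0 s; have := normr_ge0 T; move=> *; apply/andP; split; lra.
Qed.

(** For almost every [t > 0] the section [z t] is continuous and bounded by [1]
    almost everywhere, hence everywhere, and clamping does not change it. The
    separated equation is obtained with tensor products as test functions. *)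
Lemma strong_solution_flow (u0 : R -> R) (u : R -> R -> R) : strong_solution_TVF u0 u ->
  exists Z Du C, regular_flow (extend0 u) Z Du C.
Proof.
move=> [Du [ut [z [zx [[[C bvC] [uL2 _ wt uC] _] [[mz z1 _ wx cz] [utzx en]]]]]]].
have ext t : 0 <= t -> extend0 u t = u t by move=> t0; apply/funext => x; rewrite /extend0 t0.
have mZ := measurable_clamped_flux mz.
have Z1 t x : `|clamped_flux z t x| <= 1.
  by rewrite /clamped_flux; case: ifP => _; rewrite ?clamp_le1 ?normr0.
have su := extend0_slab_int uL2 uC.
have sZ := bounded_slab_int mZ Z1.
have Zz : {ae leb, forall t : R, 0 < t -> continuous (z t) /\ clamped_flux z t = z t}.
  refine (@ae_mono _ _ R leb _ _ (ae_and (ae_section z1) cz) _) => t [zt1 czt] t0.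
  have {}czt := czt t0; split=> //; apply/funext => x; rewrite /clamped_flux t0 clamp_id//.
  apply: continuous_ae_le1 => //.
  refine (@ae_mono _ _ R leb _ _ zt1 _) => y; apply.
  by split => //=; rewrite in_itv/= t0.
exists (clamped_flux z), Du, C; split; [exact: su| |exact: mZ|exact: Z1| | | |].
- move=> t K e t0 e0; have [d d0 H] := section_L1_continuous uL2 uC K t0 e0.
  by exists d => // s s0 ts; rewrite !ext//; exact: H.
- move=> eta xi s T K seta sxi s0 eta0 xi0.
  have tf := test_function2_mul seta sxi s0 eta0 xi0.
  have [N wN] := support_weight (smooth_continuous seta) eta0.
  have eta'0 := derive1_out eta0.
  have [N' wN'] := support_weight (smooth_continuous (smooth_derive1 seta)) eta'0.
  have [M wM] := continuous_weight (smooth_continuous sxi) xi0.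
  have [M' wM'] := weight_derive1 sxi xi0.
  have [me eN _] := wN; have [me' eN' _] := wN'.
  rewrite -(slab_fubini_half_plane su me' eN' s0 eta'0 wM).
  rewrite -(slab_fubini_half_plane sZ me eN s0 eta0 wM').
  have E := wt _ tf; have E' := wx _ tf.
  transitivity (\int[leb2]_(p in half_plane)
      (u p.1 p.2 * partial_t (fun t x => eta t * xi x) p.1 p.2)).
    apply: eq_Rintegral => p; rewrite inE => -[/= + _]; rewrite in_itv/= andbT => p0.
    by rewrite partial_t_mul// ext// ltW.
  rewrite E; transitivity (\int[leb2]_(p in half_plane)
      (z p.1 p.2 * partial_x (fun t x => eta t * xi x) p.1 p.2)).
    rewrite E'; congr (- _); apply: half_plane_Rintegral_ae.
    by refine (@ae_mono _ _ R leb2 _ _ utzx _) => p H hp; rewrite H.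
  apply: half_plane_Rintegral_ae.
  refine (@ae_mono _ _ R leb2 _ _ z1 _) => p H hp.
  rewrite partial_x_mul//; congr (_ * _); rewrite /clamped_flux clamp_id ?H//.
  by move: hp => [/= + _]; rewrite in_itv/= andbT => ->.
- refine (@ae_mono _ _ R leb _ _ bvC _) => t H t0; have [_ ? ?] := H t0.
  by rewrite ext// ltW.
- by refine (@ae_mono _ _ R leb _ _ Zz _) => t H t0; have [c ->] := H t0.
- move=> tau tau0; rewrite -(en tau tau0); apply: ae_eq_lower_integral.
  refine (@ae_mono _ _ R leb _ _ Zz _) => t H; rewrite /= in_itv/= => /andP[t0 _].
  by have [_ ->] := H t0.
Qed.

End from_strong_solutions.
(** * Good representatives and oscillations *)

Section representatives.
Context {R : realType}.
Implicit Types (v : R -> R) (a b x e l r : R).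

(** As [v x] is below the larger one of the one-sided limits, [v] is above
    [v x - e] on a small interval on the side of this limit. *)
Lemma one_sided_lower v x l r a b e : v @ x^'- --> l -> v @ x^'+ --> r ->
  v x <= Num.max l r -> a < x < b -> 0 < e ->
  exists p q, [/\ a <= p, p < q, q <= b & forall y, p < y < q -> v x - e <= v y].
Proof.
move=> vl vr vx /andP[ax xb] e0.
have [lr|rl] := leP l r.
- move: vx; rewrite max_r// => vx.
  move/cvgrPdist_le : vr => /(_ _ e0)[d /= d0 H].
  exists x, (Num.min b (x + d)); split; rewrite ?ge_min ?lexx ?(ltW ax)//.
    by rewrite lt_min xb ltrDl.
  move=> y; rewrite lt_min => /and3P[xy _ yd].
  have := H y; rewrite /= distrC gtr0_norm ?subr_gt0// => /(_ ltac:(lra) xy).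
  by rewrite ler_distl => /andP[? ?]; lra.
- move: vx; rewrite (max_l (ltW rl)) => vx.
  move/cvgrPdist_le : vl => /(_ _ e0)[d /= d0 H].
  exists (Num.max a (x - d)), x; split; rewrite ?le_max ?lexx ?(ltW xb)//.
    by rewrite gt_max ax gtrBl.
  move=> y; rewrite gt_max => /andP[/andP[_ yd] xy].
  have := H y; rewrite /= gtr0_norm ?subr_gt0// => /(_ ltac:(lra) xy).
  by rewrite ler_distl => /andP[? ?]; lra.
Qed.

Lemma good_lower f v x a b e : good_representative f v -> a < x < b -> 0 < e ->
  exists p q, [/\ a <= p, p < q, q <= b & {ae leb, forall y : R, p < y < q -> v x - e <= f y}].
Proof.
move=> [_ fv lim_v] axb e0; have [l [r [vl vr /andP[_ vx]]]] := lim_v x.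
have [p [q [ap pq qb H]]] := one_sided_lower vl vr vx axb e0.
exists p, q; split=> //; refine (@ae_mono _ _ R leb _ _ fv _) => y -> ; exact: H.
Qed.

Lemma good_upper f v x a b e : good_representative f v -> a < x < b -> 0 < e ->
  exists p q, [/\ a <= p, p < q, q <= b & {ae leb, forall y : R, p < y < q -> f y <= v x + e}].
Proof.
move=> [_ fv lim_v] axb e0; have [l [r [vl vr /andP[vx _]]]] := lim_v x.
have vx' : - v x <= Num.max (- l) (- r).
  by rewrite -oppr_min lerN2.
have [p [q [ap pq qb H]]] := one_sided_lower (cvgN vl) (cvgN vr) vx' axb e0.
exists p, q; split=> //; refine (@ae_mono _ _ R leb _ _ fv _) => y E /H Hy.
have {}Hy : - v x - e <= - v y by exact: Hy.
by rewrite E; lra.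
Qed.

(** Up to any [e > 0], [v x] is a lower bound of [v] on some interval near [x], and
    [v y] an upper bound on some interval near [y]. *)
Lemma good_oscillation_contraction (u0 v0 : R -> R) (u : R -> R -> R) v (t a b lo hi x y : R) :
  good_representative u0 v0 -> strong_solution_TVF u0 u -> 0 < t ->
  good_representative (u t) v ->
  (forall y, a < y < b -> lo <= v0 y <= hi) -> a < x < b -> a < y < b ->
  v x - v y <= hi - lo.
Proof.
move=> [_ uv0 _] hu t0 gv v0ab axb ayb.
have [Z [Du [C flow]]] := strong_solution_flow hu.
have u00 : {ae leb, forall x : R, u 0 x = u0 x}.
  by case: hu => ? [? [? [? [[_ _ ?] _]]]].
have ab : a < b by case/andP: axb; exact: lt_trans.
have d0 : 0 <= hi - lo.
  by have /andP[h1 h2] := v0ab x axb; rewrite subr_ge0 (le_trans h1).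
have ext s : 0 <= s -> extend0 u s = u s by move=> s0; apply/funext => z; rewrite /extend0 s0.
apply/ler_addgt0Pr => e e0; have e2 : 0 < e / 2 by rewrite divr_gt0.
have [p [q [ap pq qb Hp]]] := good_lower gv axb e2.
have [p' [q' [ap' pq' qb' Hp']]] := good_upper gv ayb e2.
have H : v x - e / 2 - (v y + e / 2) <= hi - lo.
  apply: (oscillation_contraction flow ab d0 (lexx _) _ t0 ap pq qb ap' pq' qb').
  - refine (@ae_mono _ _ R leb _ _ (ae_and uv0 u00) _) => s [E1 E2] abs.
    by rewrite ext// E2 E1; exact: v0ab.
  - by rewrite ext ?(ltW t0).
  - by rewrite ext ?(ltW t0).
lra.
Qed.

Lemma osc_le (I : set R) v v0 : 
  (forall S i x y, (forall z, I z -> i <= v0 z <= S) -> I x -> I y -> v x - v y <= S - i) ->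
  (osc I v <= osc I v0)%E.
Proof.
move=> H; have [->|/set0P[c Ic]] := eqVneq I set0; first by rewrite /osc !image_set0.
rewrite {2}/osc.
have c_sup := @ereal_sup_ubound R [set (v0 x)%:E | x in I] _ (imageP _ Ic).
have c_inf := @ereal_inf_lbound R [set (v0 x)%:E | x in I] _ (imageP _ Ic).
have ub z : I z -> ((v0 z)%:E <= ereal_sup [set (v0 x)%:E | x in I])%E.
  by move=> Iz; apply: ereal_sup_ubound; exact: imageP.
have lb z : I z -> (ereal_inf [set (v0 x)%:E | x in I] <= (v0 z)%:E)%E.
  by move=> Iz; apply: ereal_inf_lbound; exact: imageP.
move: (ereal_sup _) (ereal_inf _) c_sup c_inf ub lb => [S||] [i||]//=; rewrite ?leey//.
move=> _ _ ub lb.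
have {}H x y : I x -> I y -> v x - v y <= S - i.
  by apply: H => z Iz; rewrite -!lee_fin lb// ub.
have inf_ge x : I x -> ((v x - (S - i))%:E <= ereal_inf [set (v x)%:E | x in I])%E.
  move=> Ix; apply: le_ereal_inf_tmp => _ [y Iy <-]; rewrite lee_fin.
  by have := H x y Ix Iy; lra.
have inf_le : (ereal_inf [set (v x)%:E | x in I] <= (v c)%:E)%E.
  by apply: ereal_inf_lbound; exact: imageP.
rewrite /osc; move: (ereal_inf _) inf_ge inf_le => [j||] inf_ge inf_le//; last first.
  by have := inf_ge c Ic.
have : (ereal_sup [set (v x)%:E | x in I] <= (j + (S - i))%:E)%E.
  apply: ge_ereal_sup => _ [y Iy <-]; rewrite lee_fin.
  by have := inf_ge y Iy; rewrite lee_fin; lra.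
rewrite -EFinB => sup_le; rewrite leeBlDr// (le_trans sup_le)// -EFinD lee_fin; lra.
Qed.

Lemma open_itv_around (I : set R) (x y : R) : is_interval I -> open I -> I x -> I y ->
  exists a b, [/\ a < x < b, a < y < b & forall z, a < z < b -> I z].
Proof.
move=> iI oI Ix Iy.
have near_in w : I w -> exists2 d : R, 0 < d & I (w - d) /\ I (w + d).
  move=> Iw; have [d /= d0 H] : \forall z \near w, I z by exact: open_nbhs_nbhs.
  exists (d / 2); first by rewrite divr_gt0.
  have d2 : 0 < d / 2 by rewrite divr_gt0.
  have d2d : d / 2 < d by rewrite ltr_pdivrMr// ltr_pMr// ltr1n.
  split; apply: H => /=; first by rewrite subKr gtr0_norm.
  by rewrite opprD addNKr normrN gtr0_norm.
have [d1 d10 [Ixm Ixp]] := near_in _ Ix.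
have [d2 d20 [Iym Iyp]] := near_in _ Iy.
have [xy|yx] := leP x y.
  exists (x - d1), (y + d2); split; [apply/andP; split; lra|apply/andP; split; lra|].
  by move=> z /andP[z1 z2]; apply: iI Ixm Iyp _ _; rewrite !ltW.
exists (y - d2), (x + d1); split; [apply/andP; split; lra|apply/andP; split; lra|].
by move=> z /andP[z1 z2]; apply: iI Iym Ixp _ _; rewrite !ltW.
Qed.

End representatives.

Theorem theorem2p8 (R : realType) (u0 v0 : R -> R) (u : R -> R -> R)
    (I : set R)
    (hv0 : good_representative u0 v0)
    (hnneg : {ae leb, forall x, 0 <= u0 x})
    (hu : strong_solution_TVF u0 u)
    (hIint : is_interval I) (hIopen : open I)
    (hcont : {within I, continuous v0}) :
  forall t : R, 0 < t ->
    (exists v, good_representative (u t) v) /\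
    forall v, good_representative (u t) v ->
      {within I, continuous v} /\ (osc I v <= osc I v0)%E.
Proof.
move=> t t0; split.
  have [Z [Du [C flow]]] := strong_solution_flow hu.
  have [v gv] := flow_good_representative flow (ltW t0); exists v.
  by move: gv; rewrite (_ : extend0 u t = u t)//; apply/funext => x; rewrite /extend0 (ltW t0).
move=> v gv; have contraction := good_oscillation_contraction hv0 hu t0 gv.
split.
- rewrite continuous_open_subspace// in hcont; rewrite continuous_open_subspace//.
  move=> x; rewrite inE => Ix; apply/cvgrPdist_le => e e0.
  have e2 : 0 < e / 2 by rewrite divr_gt0.
  have : v0 y @[y --> x] --> v0 x by apply: hcont; rewrite inE.
  move/cvgrPdist_le => /(_ _ e2)[d /= d0 Hd].
  near=> y.
  have xy : `|x - y| < d by near: y; exists d.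
  have Q z w : x - d < z < x + d -> x - d < w < x + d -> v z - v w <= e.
    move=> zd wd; rewrite [leRHS](_ : e = (v0 x + e / 2) - (v0 x - e / 2)); last by field.
    apply: contraction zd wd => r; rewrite -ltr_distlC => rd.
    have K : `|v0 x - v0 r| <= e / 2 by exact: Hd.
    by move: K; rewrite distrC ler_distl.
  have xx : x - d < x < x + d by apply/andP; split; lra.
  move: xy; rewrite distrC ltr_distl => yy.
  have := Q _ _ xx yy; have := Q _ _ yy xx; move: (v x) (v y) => p q qp pq.
  by rewrite ler_norml; apply/andP; split; lra.
- apply: osc_le => S i x y v0S Ix Iy.
  have [a [b [axb ayb abI]]] := open_itv_around hIint hIopen Ix Iy.
  by apply: contraction axb ayb => z /abI; exact: v0S.
Unshelve. all: by end_near. Qed.
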